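(* Let $\mathit{LS}=\{(\beta,\alpha)\in(0,9]\times[0,2):\beta<9(\frac{\alpha-2}{\alpha+2})^2\}$ be the linear stability region and $\mathit{SS}=\{(\beta,\alpha)\in(0,9]\times[0,2):\beta=9(\frac{\alpha-2}{\alpha+2})^2\}$ the stability curve. For $k\in\mathbb{N}\setminus\{0\}$ and $l\in\{1,\dots,[\sqrt2\,k]\}$ (with $[\cdot]$ the integer part) let $f_{k,l}$ be the curve in the $(\beta,\alpha)$-plane of equation $$\beta=-\frac{36}{(\alpha+2)^2}\,\frac{l^2}{k^2}\left(\frac{l^2}{k^2}+\alpha-2\right).$$ Then: (1) in the region $\mathit{LS}$, the Maslov index $i_1(\phi_3^k)$ of the $k$-th iteration of $\phi_3$ jumps, as a function of $(\beta,\alpha)$, exactly on the curves $f_{k,l}$, $l\in\{1,\dots,[\sqrt2\,k]\}$; (2) each of the curves $f_{k,l}$ is convex, and for $l\in\{1,\dots,k\}$ it is tangent to $\mathit{SS}$ at exactly one point, namely $$\left(\frac{9l^4}{(2k^2-l^2)^2},\ 2\left(1-\frac{l^2}{k^2}\right)\right);$$ (3) the stability curve $\mathit{SS}$ is the envelope of the one-parameter family $\{f_t\}_{t\in(0,1]}$ of curves of equations $$\beta=-\frac{36}{(\alpha+2)^2}\,t^2\,(t^2+\alpha-2).$$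
   Context: For $(\beta,\alpha)\in(0,9]\times[0,2)$ let $$\Lambda_3=\begin{pmatrix}0&1&\frac12\left(\alpha+\frac{\alpha+2}{3}\sqrt{9-\beta}\right)&0\\ -1&0&0&\frac12\left(\alpha-\frac{\alpha+2}{3}\sqrt{9-\beta}\right)\\ 1&0&0&1\\ 0&1&-1&0\end{pmatrix}$$ and $\phi_3(\tau)=\exp(\tau\Lambda_3)$, $\tau\in[0,2\pi]$. (It is the essential part of the linearisation at the circular Lagrangian solution of the three-body problem with $\alpha$-homogeneous, or logarithmic if $\alpha=0$, potential; $\beta=27(m_1m_2+m_1m_3+m_2m_3)/(m_1+m_2+m_3)^2$.) ''Jumps at a point'' means that the integer-valued function is not locally constant there. The curves are graphs of $\beta$ as a function of $\alpha\in[0,2)$, and convexity refers to this description. Iteration: for a path $\gamma:[0,T]\to\mathrm{Sp}(2n)$ with $\gamma(0)=I$, $\gamma^m:[0,mT]\to\mathrm{Sp}(2n)$ is $\gamma^m(t)=\gamma(t-jT)\gamma(T)^j$ for $jT\le t\le(j+1)T$, $j=0,\dots,m-1$. Maslov index $i_1$: let $J=\begin{pmatrix}0&-I_n\\ I_n&0\end{pmatrix}$, $\mathrm{Sp}(2n,\mathbb{C})=\{M\in\mathrm{GL}(2n,\mathbb{C}):M^\dagger JM=J\}$, $\mathrm{Sp}(2n)$ its subgroup of real matrices, $\mathrm{Sp}_k(2n,\mathbb{C})=\{M\in\mathrm{Sp}(2n,\mathbb{C}):\dim_{\mathbb{C}}\ker(M-I)=k\}$. The closure $\overline{\mathrm{Sp}_1(2n,\mathbb{C})}=\bigcup_{k\ge1}\mathrm{Sp}_k(2n,\mathbb{C})$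 is a codimension-one cycle whose top stratum is co-oriented by the vector field $\frac{d}{dt}(Me^{Jt})|_{t=0}$. For a continuous path with end-points in $\mathrm{Sp}_0(2n,\mathbb{C})$, $[\,\cdot:\overline{\mathrm{Sp}_1(2n,\mathbb{C})}]$ is its intersection number with this cycle: the signed number of crossings after a homotopy with fixed end-points to a path crossing the cycle only at points of $\mathrm{Sp}_1(2n,\mathbb{C})$ and transversally, a crossing in the direction of the co-orientation counting $+1$. Let $\mathcal{P}_T(2n)$ be the set of continuous $\gamma:[0,T]\to\mathrm{Sp}(2n,\mathbb{C})$ with $\gamma(0)=I$ ($C^0$ topology) and $\xi_n(t)=\mathrm{diag}\big((2-\frac tT)I_n,(2-\frac tT)^{-1}I_n\big)$. If $1$ is not an eigenvalue of $\gamma(T)$, $i_1(\gamma)=[\gamma*\xi_n:\overline{\mathrm{Sp}_1(2n,\mathbb{C})}]$, where $\gamma*\xi_n$ first runs along $\xi_n$ from $\xi_n(0)$ to $\xi_n(T)=I$ and then along $\gamma$; otherwise $i_1(\gamma)=\sup_U\inf\{i_1(\delta):\delta\in U,\ 1\text{ not an eigenvalue of }\delta(T)\}$ over open neighbourhoods $U$ of $\gamma$ in $\mathcal{P}_T(2n)$. *)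

(* Defs.v *)
From HB Require Import structures.
From mathcomp Require Import all_boot all_order all_algebra.
From mathcomp Require Import all_classical all_reals all_analysis.
From mathcomp Require Import complex.

Set Implicit Arguments.
Unset Strict Implicit.
Unset Printing Implicit Defensive.

Import Order.TTheory GRing.Theory Num.Theory.
Import numFieldNormedType.Exports.

Local Open Scope classical_set_scope.
Local Open Scope ring_scope.

(* The complex numbers with their usual topology: MathComp-Analysis attaches
   it to any type presented as a [numClosedFieldType]. *)
Definition Cplx (R : realType) : numClosedFieldType := R[i].

Definition toC (R : realType) (x : R) : Cplx R := (x%:C)%C.

Section Maslov.
Variable R : realType.
Variable n : nat.

Local Notation mat := 'M[Cplx R]_(n + n).
Implicit Types (M X Y : mat) (g : R -> mat) (T L t : R).

Definition stdJ : mat := block_mx 0 (- 1%:M) 1%:M 0.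

Definition dagger M : mat := (map_mx Num.conj M)^T.

Definition Sp : set mat :=
  [set M | M \in unitmx /\ dagger M *m stdJ *m M = stdJ].

(* [kermx] is a left kernel, hence the transpose. *)
Definition Sp_ (k : nat) : set mat :=
  [set M | Sp M /\ \rank (kermx (M - 1%:M)^T) = k].

Definition maslov_cycle : set mat := \bigcup_(k in [set k | (1 <= k)%N]) Sp_ k.

Definition velocity g t X : Prop :=
  (fun h : R => toC h^-1 *: (g (t + h) - g t)) @ 0^' --> X.

(* [Y] is tangent at [M] to the top stratum of the cycle. *)
Definition tangent_Sp1 M Y : Prop :=
  exists c : R -> mat, [/\ forall s, Sp_ 1 (c s), c 0 = M & velocity c 0 Y].

(* The path [g] crosses the top stratum transversally at time [t], with sign
   [e].  Since [M e^{Js}] has velocity [M J] at [s = 0], and [M J] spans a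
   complement of the tangent hyperplane at [M], the velocity of [g] is
   [a M J] up to a tangent vector; [e] is the sign of [a]. *)
Definition crossing g t (e : int) : Prop :=
  exists (a : R) Y, [/\ Sp_ 1 (g t), tangent_Sp1 (g t) Y,
    velocity g t (toC a *: (g t *m stdJ) + Y), a != 0 & e = sgz a].

(* Paths are represented by functions on [R] of which only the restriction to
   the relevant interval matters. *)
Definition homotopic_rel_ends L g0 g1 : Prop :=
  exists H : R * R -> mat,
  [/\ {within `[0, 1] `*` `[0, L], continuous H},
      forall p, (`[0, 1] `*` `[0, L]) p -> Sp (H p),
      forall t, t \in `[0, L] -> H (0, t) = g0 t /\ H (1, t) = g1 t &
      forall s, s \in `[0, 1] -> H (s, 0) = g0 0 /\ H (s, L) = g0 L].

Definition is_intersection_number L g (m : int) : Prop :=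
  exists g' : R -> mat, homotopic_rel_ends L g g' /\
  exists (s : seq R) (e : R -> int),
    [/\ uniq s,
        forall t, t \in s <-> t \in `[0, L] /\ maslov_cycle (g' t),
        forall t, t \in s -> crossing g' t (e t) &
        m = \sum_(t <- s) e t].

(* Meaningful for paths on [0, L] with end-points off the cycle; the [m]
   satisfying [is_intersection_number] is then unique, as the intersection
   number with a cycle is homotopy invariant. *)
Definition intersection_number L g : int :=
  xget 0 [set m | is_intersection_number L g m].

Definition paths T : set (R -> mat) :=
  [set g | [/\ {within `[0, T], continuous g},
               forall t, t \in `[0, T] -> Sp (g t) & g 0 = 1%:M]].

Definition xi T t : mat :=
  block_mx (toC (2 - t / T))%:M 0 0 (toC (2 - t / T)^-1)%:M.

Definition concat_xi T g t : mat := if t <= T then xi T t else g (t - T).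

Definition nondegenerate T g : bool := ~~ eigenvalue (g T) 1.

Definition i1_nondegenerate T g : int :=
  intersection_number (T + T) (concat_xi T g).

(* Values are taken in [\bar R], where the supremum and infimum of the
   degenerate case are total; in that case the open neighbourhoods in the
   space of paths are the traces on [paths T] of open neighbourhoods for the
   topology of uniform convergence on [0, T]. *)
Definition i1 T g : \bar R :=
  if nondegenerate T g then ((i1_nondegenerate T g)%:~R)%:E
  else ereal_sup
    [set ereal_inf [set ((i1_nondegenerate T d)%:~R)%:E
                   | d in [set d : R -> mat |
                            [/\ U d, paths T d & nondegenerate T d]]]
    | U in [set U : set {uniform` `[0, T] -> mat} |
             open_nbhs (g : {uniform` `[0, T] -> mat}) U]].

(* The iterates [g^m] for all [m] are restrictions to [0, m T] of this path;
   at [t = (j + 1) T] the formulas for [j] and [j + 1] agree as [g 0 = 1]. *)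
Definition iteration T g t : mat :=
  let j := Num.truncn (t / T) in g (t - j%:R * T) *m (g T) ^+ j.

End Maslov.

Section PlanarCurves.
Variable R : realType.
Implicit Types (D P : set R) (f h : R -> R) (C E : set (R * R)) (p : R * R).

Definition derivative_within D f (a d : R) : Prop :=
  (fun x => (f x - f a) / (x - a)) @ within D a^' --> d.

(* Points of the plane are pairs [(beta, alpha)], and curves are graphs of
   [beta] as a function of [alpha]. *)
Definition graph D f : set (R * R) := [set p | D p.2 /\ p.1 = f p.2].

Definition convex_curve D C : Prop :=
  exists f, C = graph D f /\ @convex_function R R^o D f.

Definition tangent_at D C1 C2 p : Prop :=
  exists f h, [/\ C1 = graph D f, C2 = graph D h, C1 p, C2 p &
    exists d, derivative_within D f p.2 d /\ derivative_within D h p.2 d].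

(* [E] is the envelope of the curves [graph D (F t)], [t] in [P]: it is tangent
   to each of them, the points of tangency make up the whole of [E], and [E] is
   the discriminant of the family, that is the locus [G = 0, dG/dt = 0] for
   [G t (beta, alpha) = beta - F t alpha]. *)
Definition is_envelope D P (F : R -> R -> R) E : Prop :=
  [/\ forall t, P t -> exists p, tangent_at D (graph D (F t)) E p,
      forall p, E p -> exists2 t, P t & tangent_at D (graph D (F t)) E p &
      E = [set p | exists2 t, P t &
            graph D (F t) p /\ derivative_within P (fun u => p.1 - F u p.2) t 0]].

(* [V] is not locally constant at [p], as a function on [E]. *)
Definition jumps_at (T : Type) E (V : R * R -> T) p : Prop :=
  ~ \forall q \near within E (nbhs p), V q = V p.

End PlanarCurves.

Section ThreeBody.
Variable R : realType.
Implicit Types (p : R * R) (alpha beta tau t : R) (k l : nat).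

Definition alpha_range : set R := `[0, 2[%classic.
Definition param_domain : set (R * R) :=
  [set p | 0 < p.1 <= 9 /\ alpha_range p.2].

Definition LS : set (R * R) :=
  [set p | param_domain p /\ p.1 < 9 * ((p.2 - 2) / (p.2 + 2)) ^+ 2].
Definition SS : set (R * R) :=
  [set p | param_domain p /\ p.1 = 9 * ((p.2 - 2) / (p.2 + 2)) ^+ 2].

Definition Lambda3 p : 'M[R]_4 :=
  let: (beta, alpha) := p in
  let s := (alpha + 2) / 3 * Num.sqrt (9 - beta) in
  \matrix_(i, j)
    (nth [::] [:: [:: 0; 1; (alpha + s) / 2; 0];
                  [:: -1; 0; 0; (alpha - s) / 2];
                  [:: 1; 0; 0; 1];
                  [:: 0; 1; -1; 0]] i)`_j.

Definition expmx n (A : 'M[R]_n.+1) : 'M[R]_n.+1 :=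
  limn (series (fun m : nat => (m`!%:R : R)^-1 *: A ^+ m)).

Definition phi3 p tau : 'M[Cplx R]_(2 + 2) :=
  map_mx (@toC R) (expmx (tau *: Lambda3 p)).

(* i_1 of the k-th iterate of phi_3, a path on [0, 2 k pi]. *)
Definition index_iterate k p : \bar R :=
  i1 (k%:R * (2 * pi)) (iteration (2 * pi) (phi3 p)).

Definition f_kl k l : set (R * R) :=
  graph alpha_range (fun alpha =>
    - (36 / (alpha + 2) ^+ 2) * (l%:R ^+ 2 / k%:R ^+ 2)
      * (l%:R ^+ 2 / k%:R ^+ 2 + alpha - 2)).

Definition f_t t alpha : R :=
  - (36 / (alpha + 2) ^+ 2) * t ^+ 2 * (t ^+ 2 + alpha - 2).

End ThreeBody.

Arguments LS : clear implicits.
Arguments SS : clear implicits.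
Arguments index_iterate : clear implicits.
Arguments f_kl : clear implicits.
Arguments f_t : clear implicits.
Arguments alpha_range : clear implicits.

(* Main.v *)
Require Import Defs.
From HB Require Import structures.
From mathcomp Require Import all_boot all_order all_algebra.
From mathcomp Require Import all_classical all_reals all_analysis.
From mathcomp Require Import complex ring lra zify.

Set Implicit Arguments.
Unset Strict Implicit.
Unset Printing Implicit Defensive.

Import Order.TTheory GRing.Theory Num.Theory.
Import numFieldNormedType.Exports.

Local Open Scope classical_set_scope.
Local Open Scope ring_scope.

(** Every complex symplectic [M] satisfies [det ((M - 1) + s (M + 1) K) <> 0] for real [s <> 0], with
    [K = i J].  Hence the intersection number of a path [g] on [0, L] with the Maslov cycle is the
    winding number of [(t, s) |-> det ((g t - 1) + s (g t + 1) K)] around the boundary of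
    [0, L] x [-1, 1]: a transversal crossing is a simple zero whose index is its sign.  In
    particular it is unique.

    In [LS] the matrix [Lambda3] has four distinct imaginary eigenvalues [+- i w1], [+- i w2] with
    [w1 ^ 2 > w2 ^ 2] the roots of [w ^ 2 - (2 - alpha) w + (alpha + 2) ^ 2 beta / 36], so the
    iterates of [phi_3] stay in a torus.  Turning the phases one at a time gives the index
    [2 (floor (k w1) - floor (k w2))] when neither [k w1] nor [k w2] is an integer, and
    [k w_j = l] is the equation of [f_{k,l}].  On such a curve the two nondegenerate sides carry
    different values arbitrarily close to the point, whatever the value at the point itself.

    For the curves, [SS - f_t = (3 (alpha - 2 + 2 t ^ 2) / (alpha + 2)) ^ 2] is a square. *)

(** * Curves in the parameter plane *)

Section PlaneCurves.
Variable R : realType.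
Implicit Types (D : set R) (f h : R -> R) (A B c a x t : R).

Lemma derivative_within_eq D f h a d : D a -> {in D, f =1 h} ->
  derivative_within D f a d -> derivative_within D h a d.
Proof.
move=> Da fh; apply: cvg_trans; apply: near_eq_cvg.
suff : nbhs a (fun x => x != a -> D x -> (f x - f a) / (x - a) = (h x - h a) / (x - a)) by [].
by apply: filterE => x _ Dx; rewrite !fh ?inE.
Qed.

(** Carathéodory's form of the derivative: once the factor x - a is divided out algebraically, only
    continuity of [q] at [a] remains to be checked. *)
Lemma derivative_within_quotient D f (q : R -> R) a : D a ->
  (forall x, D x -> x != a -> f x - f a = q x * (x - a)) ->
  {for a, continuous q} -> derivative_within D f a (q a).
Proof.
move=> Da fq cq; have : q @ within D a^' --> q a by do 2!apply: cvg_within_filter.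
apply: cvg_trans; apply: near_eq_cvg.
suff : nbhs a (fun x => x != a -> D x -> q x = (f x - f a) / (x - a)) by [].
by apply: filterE => x xa Dx; rewrite fq// mulfK// subr_eq0.
Qed.

Lemma derivative_within_rational D A B c a : (forall x, D x -> -2 < x) -> D a ->
  derivative_within D (fun x => A / (x + 2) ^+ 2 + B / (x + 2) + c) a
    (- (2 * A) / (a + 2) ^+ 3 - B / (a + 2) ^+ 2).
Proof.
move=> D2 Da; have a2 : a + 2 != 0 by apply: lt0r_neq0; have := D2 a Da; lra.
(* The difference quotient after cancelling x - a, using (x + 2)^2 - (a + 2)^2 = (x - a) (x + a +
   4). *)
pose q x := - A * ((x + a + 4) / ((x + 2) ^+ 2 * (a + 2) ^+ 2)) - B / ((x + 2) * (a + 2)).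
have -> : - (2 * A) / (a + 2) ^+ 3 - B / (a + 2) ^+ 2 = q a by rewrite /q; field.
apply: derivative_within_quotient => //.
  move=> x Dx xa; have x2 : x + 2 != 0 by apply: lt0r_neq0; have := D2 x Dx; lra.
  by rewrite /q; field; rewrite a2 x2.
have c1 : (fun x : R => x + 2) @ a --> a + 2 by apply: cvgD; [exact: cvg_id|exact: cvg_cst].
apply: cvgB; apply: cvgM; try exact: cvg_cst.
  apply: cvgM.
    by apply: cvgD; [apply: cvgD; [exact: cvg_id|exact: cvg_cst]|exact: cvg_cst].
  apply: cvgV; first by rewrite mulf_neq0// expf_neq0.
  by apply: cvgM; [apply: cvgM; exact: c1|exact: cvg_cst].
apply: cvgV; first by rewrite mulf_neq0.
by apply: cvgM; [exact: c1|exact: cvg_cst].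
Qed.

Definition ss_curve (alpha : R) : R := 9 * ((alpha - 2) / (alpha + 2)) ^+ 2.

(** The bounds 0 < beta <= 9 of the parameter domain hold on the whole graph because 0 < 2 - alpha
    <= alpha + 2. *)
Lemma SS_graph : SS R = graph (alpha_range R) ss_curve.
Proof.
apply/seteqP; split=> -[b al] [].
  by move=> [_ ra] e; split.
move=> ra /= e; split=> //; split=> //=; rewrite e.
have := ra; rewrite /alpha_range /= in_itv/= => /andP[a0 a2]; have a4 : 0 < al + 2 by lra.
rewrite /ss_curve expr_div_n; apply/andP; split.
  apply: mulr_gt0 => //; apply: divr_gt0; last exact: exprn_gt0.
  by rewrite -sqrrN exprn_gt0//; lra.
rewrite -[leRHS]mulr1 ler_pM2l// ler_pdivrMr ?exprn_gt0// mul1r; nra.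
Qed.

Lemma range_gtN2 alpha : alpha_range R alpha -> -2 < alpha.
Proof. by rewrite /alpha_range /= in_itv/= => /andP[]; lra. Qed.

(** Partial fractions in alpha + 2, the shape expected by [derivative_within_rational]. *)
Lemma f_tE t alpha : alpha_range R alpha -> f_t R t alpha =
  36 * t ^+ 2 * (4 - t ^+ 2) / (alpha + 2) ^+ 2 + (- (36 * t ^+ 2)) / (alpha + 2) + 0.
Proof. by move=> /range_gtN2 a2; rewrite /f_t; field; apply: lt0r_neq0; lra. Qed.

Lemma ss_curveE alpha : alpha_range R alpha ->
  ss_curve alpha = 144 / (alpha + 2) ^+ 2 + (- 72) / (alpha + 2) + 9.
Proof. by move=> /range_gtN2 a2; rewrite /ss_curve; field; apply: lt0r_neq0; lra. Qed.

Lemma f_t_sub_ss t alpha : alpha_range R alpha ->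
  ss_curve alpha - f_t R t alpha = (3 * (alpha - 2 + 2 * t ^+ 2) / (alpha + 2)) ^+ 2.
Proof. by move=> /range_gtN2 a2; rewrite /f_t /ss_curve; field; apply: lt0r_neq0; lra. Qed.

Lemma f_t_eq_ss t alpha : alpha_range R alpha ->
  ss_curve alpha = f_t R t alpha <-> alpha = 2 * (1 - t ^+ 2).
Proof.
move=> ra; have := range_gtN2 ra => a2; have h := f_t_sub_ss t ra.
have d0 : alpha + 2 != 0 by apply: lt0r_neq0; lra.
split=> [e|e]; last first.
  apply/eqP; rewrite -subr_eq0 h; apply/eqP.
  have -> : alpha - 2 + 2 * t ^+ 2 = 0 by rewrite e; ring.
  by rewrite mulr0 mul0r expr0n.
move: h; rewrite e subrr => /esym/eqP; rewrite sqrf_eq0 !mulf_eq0 invr_eq0 (negbTE d0) orbF.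
rewrite pnatr_eq0 /= => /eqP; lra.
Qed.

Lemma f_t_tangent_ss t alpha : alpha_range R alpha -> alpha = 2 * (1 - t ^+ 2) ->
  tangent_at (alpha_range R) (graph (alpha_range R) (f_t R t)) (SS R) (ss_curve alpha, alpha).
Proof.
move=> ra e; exists (f_t R t), ss_curve; split => //.
- by rewrite SS_graph.
- by split=> //=; apply/f_t_eq_ss.
- by rewrite SS_graph; split.
exists (- (2 * 144) / (alpha + 2) ^+ 3 - (- 72) / (alpha + 2) ^+ 2); rewrite /=; split; last first.
  apply: (derivative_within_eq ra _ (@derivative_within_rational _ 144 (- 72) 9 _ (@range_gtN2) ra)).
  by move=> x; rewrite inE => /ss_curveE ->.
have d0 : alpha + 2 != 0 by apply: lt0r_neq0; have := range_gtN2 ra; lra.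
have -> : - (2 * 144) / (alpha + 2) ^+ 3 - (- 72) / (alpha + 2) ^+ 2 =
   - (2 * (36 * t ^+ 2 * (4 - t ^+ 2))) / (alpha + 2) ^+ 3 - (- (36 * t ^+ 2)) / (alpha + 2) ^+ 2.
  have et : t ^+ 2 = 1 - alpha / 2 by lra.
  by rewrite et; field.
apply: (derivative_within_eq ra _ (@derivative_within_rational _ _ _ 0 _ (@range_gtN2) ra)).
by move=> x; rewrite inE => /f_tE ->.
Qed.

(** Since the difference of the two functions is a square, every common point is already a point of
    tangency, and tangency reduces to intersection. *)
Lemma tangent_ssP t p :
  tangent_at (alpha_range R) (graph (alpha_range R) (f_t R t)) (SS R) p <->
  [/\ alpha_range R p.2, p.2 = 2 * (1 - t ^+ 2) & p.1 = ss_curve p.2].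
Proof.
split=> [[f [h [_ _ [rp e1] c2 _]]]|[ra e1 e2]].
  move: c2; rewrite SS_graph => -[_ e2]; split=> //.
  by apply/f_t_eq_ss; rewrite -?e2 -?e1.
by have := f_t_tangent_ss ra e1; rewrite -e2 -surjective_pairing.
Qed.

Lemma convex_f_t t : 0 <= t -> t ^+ 2 <= 2 ->
  @convex_function R R^o (alpha_range R) (f_t R t).
Proof.
move=> t0 t2 l x y; rewrite !inE => rx ry.
have := rx; have := ry; rewrite /alpha_range /= !in_itv/= => /andP[y0 y2] /andP[x0 x2].
have s0 : 0 <= l%:num by [].
have s1 : l%:num <= 1 by [].
suff : f_t R t (l%:num * x + (1 - l%:num) * y) <= l%:num * f_t R t x + (1 - l%:num) * f_t R t y by [].
move: (l%:num : R) s0 s1 => s s0 s1; set z := s * x + (1 - s) * y.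
have [z0 z2] : 0 <= z /\ z < 2.
  split; rewrite /z; first by rewrite addr_ge0// mulr_ge0//; lra.
  have [->|s_neq0] := eqVneq s 0; first by lra.
  have s_gt0 : 0 < s by rewrite lt_neqAle eq_sym s_neq0.
  by nra.
pose m v := 36 * t ^+ 2 * (- (2 * (4 - t ^+ 2)) / (v + 2) ^+ 3 + 1 / (v + 2) ^+ 2).
(* Convexity by the tangent lines: [m z] is the slope of [f_t] at [z]. *)
have above v : 0 <= v -> v < 2 -> f_t R t z + m z * (v - z) <= f_t R t v.
  move=> v0 v2; rewrite -subr_ge0.
  have d1 : v + 2 != 0 by apply: lt0r_neq0; lra.
  have d2 : z + 2 != 0 by apply: lt0r_neq0; lra.
  have -> : f_t R t v - (f_t R t z + m z * (v - z)) = 36 * t ^+ 2 * ((v - z) ^+ 2 *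
     ((4 - t ^+ 2) * (2 * (v + 2) + (z + 2)) - (v + 2) * (z + 2))) / ((v + 2) ^+ 2 * (z + 2) ^+ 3).
    by rewrite /f_t /m; field; rewrite d1 d2.
  apply: divr_ge0; last by rewrite mulr_ge0// exprn_ge0//; lra.
  apply: mulr_ge0; first by rewrite mulr_ge0// sqr_ge0.
  apply: mulr_ge0; first exact: sqr_ge0.
  (* With a = v + 2 and b = z + 2 < 4, and since t^2 <= 2, the bracket is at least 2 (2 a + b) - a b
     = a (4 - b) + 2 b > 0. *)
  by nra.
have hx := above x x0 x2; have hy := above y y0 y2.
have -> : f_t R t z = s * (f_t R t z + m z * (x - z)) + (1 - s) * (f_t R t z + m z * (y - z)).
  by rewrite /z; ring.
by apply: lerD; apply: ler_wpM2l => //; lra.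
Qed.

Lemma derivative_within_f_t_param (p : R * R) t : alpha_range R p.2 -> 0 < t <= 1 ->
  derivative_within `]0, 1]%classic (fun u => p.1 - f_t R u p.2) t
    (36 / (p.2 + 2) ^+ 2 * (2 * t * (2 * t ^+ 2 - (2 - p.2)))).
Proof.
move=> /range_gtN2 a2 t01.
pose q u := 36 / (p.2 + 2) ^+ 2 * ((u + t) * (u ^+ 2 + t ^+ 2 - (2 - p.2))).
have -> : 36 / (p.2 + 2) ^+ 2 * (2 * t * (2 * t ^+ 2 - (2 - p.2))) = q t.
  by rewrite /q; congr (_ * _); ring.
have d0 : p.2 + 2 != 0 by apply: lt0r_neq0; lra.
apply: derivative_within_quotient; first by rewrite /= in_itv.
  by move=> x _ _; rewrite /q /f_t; field.
apply: cvgM; first exact: cvg_cst.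
apply: cvgM; first by apply: cvgD; [exact: cvg_id|exact: cvg_cst].
apply: cvgB; last exact: cvg_cst.
by apply: cvgD; [apply: cvgM; exact: cvg_id|exact: cvg_cst].
Qed.

(** Gives uniqueness of the derivative in t, also at t = 1, where the parameter interval only offers
    points on the left; hence a witness below t. *)
Lemma within_itv_proper t : 0 < t <= 1 -> ProperFilter (within `]0, 1]%classic t^').
Proof.
move=> /andP[t0 t1]; apply: Build_ProperFilter_ex => A HA.
have {}HA : nbhs t (fun x => x != t -> `]0, 1]%classic x -> A x) := HA.
have [e /= e0 he] := (nbhs_ballP _ _).1 HA.
pose x := t - Num.min e t / 2.
have m0 : 0 < Num.min e t by rewrite lt_min e0 t0.
have me : Num.min e t <= e by rewrite ge_min lexx.
have mt : Num.min e t <= t by rewrite ge_min lexx orbT.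
exists x; apply: he; rewrite /x.
- by rewrite /ball /= opprB addrC subrK gtr0_norm; lra.
- by apply/eqP; lra.
- by rewrite /= in_itv/=; apply/andP; split; lra.
Qed.

Lemma f_t_param_critical (p : R * R) t : alpha_range R p.2 -> 0 < t <= 1 ->
  derivative_within `]0, 1]%classic (fun u => p.1 - f_t R u p.2) t 0 <->
  p.2 = 2 * (1 - t ^+ 2).
Proof.
move=> ra t01; have h := derivative_within_f_t_param (p := p) ra t01.
have /andP[t0 _] := t01; have a2 := range_gtN2 ra.
split=> [h0|e].
  have PF := within_itv_proper t01.
  rewrite /derivative_within in h0 h.
  have /esym/eqP := @cvg_unique _ (@Rhausdorff R) _ (fmap_proper_filter _ PF) _ _ h0 h.
  rewrite !mulf_eq0 invr_eq0 expf_eq0 /= (gt_eqF t0) !pnatr_eq0 /=.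
  have -> : (p.2 + 2 == 0) = false by apply/negbTE/lt0r_neq0; lra.
  by move=> /eqP; lra.
suff E : 36 / (p.2 + 2) ^+ 2 * (2 * t * (2 * t ^+ 2 - (2 - p.2))) = 0 by rewrite E in h.
have -> : 2 * t ^+ 2 - (2 - p.2) = 0 by rewrite e; ring.
by rewrite !mulr0.
Qed.

Lemma envelope_SS : is_envelope (alpha_range R) `]0, 1]%classic (f_t R) (SS R).
Proof.
(* The abscissa of the contact point inverts to t = sqrt (1 - alpha / 2), so each point of [SS] is
   touched by one curve of the family. *)
have param al : alpha_range R al -> exists2 t : R, 0 < t <= 1 & al = 2 * (1 - t ^+ 2).
  rewrite /alpha_range /= in_itv/= => /andP[a0 a2].
  have h : 0 <= 1 - al / 2 by lra.
  exists (Num.sqrt (1 - al / 2)); last by rewrite sqr_sqrtr//; lra.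
  by rewrite sqrtr_gt0 -[X in _ <= X]sqrtr1 ler_sqrt//; apply/andP; split; lra.
split.
- move=> t; rewrite /= in_itv/= => /andP[t0 t1].
  have ra : alpha_range R (2 * (1 - t ^+ 2)).
    by rewrite /alpha_range /= in_itv/=; apply/andP; split; nra.
  exists (ss_curve (2 * (1 - t ^+ 2)), 2 * (1 - t ^+ 2)).
  by apply: (iffRL (tangent_ssP _ _)).
- move=> p; rewrite SS_graph => -[rp e]; have [t t01 et] := param _ rp.
  by exists t; [rewrite /= in_itv|rewrite -SS_graph; apply: (iffRL (tangent_ssP _ _))].
- rewrite SS_graph; apply/seteqP; split=> p.
    move=> [rp e]; have [t t01 et] := param _ rp; exists t; first by rewrite /= in_itv.
    split; first by split=> //; rewrite e; apply/f_t_eq_ss.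
    exact/f_t_param_critical.
  move=> [t]; rewrite /= in_itv/= => t01 [[rp e] /(f_t_param_critical rp t01) et].
  by split=> //; rewrite e; apply/esym/f_t_eq_ss.
Qed.

Lemma f_klE k l : (0 < k)%N -> f_kl R k l = graph (alpha_range R) (f_t R (l%:R / k%:R)).
Proof. by move=> k0; rewrite /f_kl /f_t expr_div_n. Qed.

(** Translates the range of l into the condition t^2 <= 2 under which [convex_f_t] applies. *)
Lemma sqr_ratio_le2 k l : (0 < k)%N -> (l <= Num.truncn (Num.sqrt 2 * k%:R : R))%N ->
  (l%:R / k%:R : R) ^+ 2 <= 2.
Proof.
move=> k0; have s0 : 0 <= Num.sqrt 2 * k%:R :> R by rewrite mulr_ge0 ?sqrtr_ge0.
rewrite truncn_ge_nat// => lk; have k1 : 0 < k%:R :> R by rewrite ltr0n.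
rewrite expr_div_n ler_pdivrMr ?exprn_gt0// -[leRHS](_ : (Num.sqrt 2 * k%:R) ^+ 2 = _).
  by rewrite lerXn2r ?nnegrE.
by rewrite exprMn sqr_sqrtr.
Qed.

Lemma convex_f_kl k l : (0 < k)%N -> (l <= Num.truncn (Num.sqrt 2 * k%:R : R))%N ->
  convex_curve (alpha_range R) (f_kl R k l).
Proof.
move=> k0 lk; exists (f_t R (l%:R / k%:R)); split; first exact: f_klE.
by apply: convex_f_t; [rewrite divr_ge0|exact: sqr_ratio_le2].
Qed.

Lemma tangent_f_kl_SS k l (p : R * R) : (0 < k)%N -> (0 < l <= k)%N ->
  tangent_at (alpha_range R) (f_kl R k l) (SS R) p <->
  p = (9 * l%:R ^+ 4 / (2 * k%:R ^+ 2 - l%:R ^+ 2) ^+ 2, 2 * (1 - l%:R ^+ 2 / k%:R ^+ 2)).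
Proof.
move=> k0 /andP[l0 lk]; rewrite f_klE// -expr_div_n.
have k1 : 0 < k%:R :> R by rewrite ltr0n.
have l1 : 0 < l%:R :> R by rewrite ltr0n.
have lk1 : l%:R <= k%:R :> R by rewrite ler_nat.
set t : R := l%:R / k%:R; have t0 : 0 < t by rewrite divr_gt0.
have t1 : t <= 1 by rewrite ler_pdivrMr// mul1r.
have -> : 9 * l%:R ^+ 4 / (2 * k%:R ^+ 2 - l%:R ^+ 2) ^+ 2 = ss_curve (2 * (1 - t ^+ 2)).
  have d0 : 2 * k%:R ^+ 2 - l%:R ^+ 2 != 0 :> R by apply: lt0r_neq0; nra.
  have d1 : 2 * (k%:R ^+ 2 - l%:R ^+ 2) + 2 * k%:R ^+ 2 != 0 :> R.
    by apply: lt0r_neq0; nra.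
  by rewrite /ss_curve /t; field; rewrite ?d1 ?d0 (gt_eqF k1) ?d1 ?d0.
split=> [/tangent_ssP[_ e1 e2]|->]; first by rewrite [LHS]surjective_pairing e2 e1.
apply/tangent_ssP; split=> //=.
by rewrite /alpha_range /= in_itv/=; apply/andP; split; nra.
Qed.

End PlaneCurves.

(** * Limits of complex numbers and of complex matrices *)

Lemma cvg_mx_coordP (K : numFieldType) (T : Type) (F : set_system T) (FF : Filter F) (m n : nat)
    (f : T -> 'M[K]_(m, n)) (A : 'M[K]_(m, n)) :
  f @ F --> A <-> forall i j, (fun t => f t i j) @ F --> A i j.
Proof.
split=> [fA i j|fA].
  by apply: (@cvg_comp _ _ _ f (fun M : 'M[K]_(m, n) => M i j)); [exact: fA|exact: coord_continuous].
move=> B [P MP PB]; rewrite /nbhs /=.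
have : F (fun t => forall ij : 'I_m * 'I_n, P ij.1 ij.2 (f t ij.1 ij.2)).
  by apply: filter_forall => -[i j] /=; apply: (fA i j); exact: MP.
by apply: filterS => t Pt; apply: PB => i j; exact: (Pt (i, j)).
Qed.

Section ComplexLimits.
Variable R : realType.
Local Notation C := (Cplx R).
Implicit Types (z w : C) (x y : R).

Definition reC z : R := complex.Re (z : R[i]).
Definition imC z : R := complex.Im (z : R[i]).
Definition iC : C := ('i : R[i])%C.
Definition cis x : C := toC (cos x) + iC * toC (sin x).

Arguments reC : simpl never.
Arguments imC : simpl never.
Arguments iC : simpl never.
Arguments toC : simpl never.

Lemma toC_is_zmod_morphism : zmod_morphism (@toC R).
Proof. by move=> x y; exact: (rmorphB (real_complex R)). Qed.
Lemma toC_is_monoid_morphism : monoid_morphism (@toC R).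
Proof. by split=> [|x y]; [exact: (rmorph1 (real_complex R))|exact: (rmorphM (real_complex R))]. Qed.
HB.instance Definition _ := GRing.isZmodMorphism.Build R C (@toC R) toC_is_zmod_morphism.
HB.instance Definition _ := GRing.isMonoidMorphism.Build R C (@toC R) toC_is_monoid_morphism.

Lemma reC_is_zmod_morphism : zmod_morphism reC.
Proof. by case=> [a b] [c d]. Qed.
HB.instance Definition _ := GRing.isZmodMorphism.Build C R reC reC_is_zmod_morphism.
Lemma imC_is_zmod_morphism : zmod_morphism imC.
Proof. by case=> [a b] [c d]. Qed.
HB.instance Definition _ := GRing.isZmodMorphism.Build C R imC imC_is_zmod_morphism.

Lemma cplxE z : z = toC (reC z) + iC * toC (imC z).
Proof. exact: complexE. Qed.

Lemma reC_toC x : reC (toC x) = x. Proof. by []. Qed.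
Lemma imC_toC x : imC (toC x) = 0. Proof. by []. Qed.
Lemma reCM z w : reC (z * w) = reC z * reC w - imC z * imC w.
Proof. by case: z w => [a b] [c d]. Qed.
Lemma imCM z w : imC (z * w) = reC z * imC w + imC z * reC w.
Proof. by case: z w => [a b] [c d]. Qed.
Lemma reC_i : reC iC = 0. Proof. by []. Qed.
Lemma imC_i : imC iC = 1. Proof. by []. Qed.
Lemma iC2 : iC * iC = -1.
Proof. by rewrite -expr2; exact: sqr_i. Qed.
Lemma cplxP z w : reC z = reC w -> imC z = imC w -> z = w.
Proof. by move=> h1 h2; rewrite (cplxE z) (cplxE w) h1 h2. Qed.
Lemma toC_inj : injective (@toC R).
Proof. exact: complexI. Qed.
Lemma toC_eq0 x : (toC x == 0) = (x == 0).
Proof. exact: (fmorph_eq0 (real_complex R)). Qed.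
Lemma reC_conj z : reC (Num.conj z) = reC z.
Proof. by case: z => [a b]. Qed.
Lemma imC_conj z : imC (Num.conj z) = - imC z.
Proof. by case: z => [a b]. Qed.
Lemma conj_toC x : Num.conj (toC x) = toC x.
Proof. by apply: cplxP; rewrite ?reC_conj ?imC_conj ?imC_toC ?oppr0. Qed.
Lemma conj_iC : Num.conj iC = - iC.
Proof. by apply: cplxP; rewrite ?reC_conj ?imC_conj raddfN ?reC_i ?imC_i ?oppr0. Qed.

Lemma normCE z : `|z| = toC (Num.sqrt (reC z ^+ 2 + imC z ^+ 2)).
Proof. exact: normc_def. Qed.
Lemma norm_toC x : `|toC x| = toC `|x|.
Proof. by rewrite normCE reC_toC imC_toC expr0n addr0 sqrtr_sqr. Qed.
Lemma toC_lt x y : (toC x < toC y) = (x < y).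
Proof. exact: ltcR. Qed.
Lemma toC_le x y : (toC x <= toC y) = (x <= y).
Proof. exact: lecR. Qed.
Lemma gt0_toC z : 0 < z -> exists2 x, 0 < x & z = toC x.
Proof.
move=> z0; exists (reC z); last first.
  by apply: cplxP => //; rewrite imC_toC; apply: ger0_Im; exact: ltW.
by move: z0; case: z => a b; rewrite ltcE /= => /andP[].
Qed.
Lemma norm_reC z : toC `|reC z| <= `|z|.
Proof. exact: normc_ge_Re. Qed.
Lemma norm_iC : `|iC| = 1.
Proof. by rewrite normCE reC_i imC_i expr0n add0r expr1n sqrtr1 rmorph1. Qed.
Lemma norm_imC z : toC `|imC z| <= `|z|.
Proof.
have -> : `|z| = `|z * - iC| by rewrite normrM normrN norm_iC mulr1.
suff -> : imC z = reC (z * - iC) by exact: norm_reC.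
by rewrite reCM !raddfN /= reC_i imC_i oppr0 mulr0 mulrN1 opprK add0r.
Qed.

Section Filters.
Variables (T : Type) (F : set_system T).
Hypothesis FF : Filter F.

Lemma cvg_toC (f : T -> R) x : f @ F --> x -> @toC R \o f @ F --> toC x.
Proof.
move=> /cvgrPdist_lt fx; apply/cvgrPdist_lt => _ /gt0_toC[e e0 ->].
have := fx _ e0; apply: filterS => t.
by rewrite /= -rmorphB norm_toC toC_lt.
Qed.
Lemma cvg_reC (f : T -> C) z : f @ F --> z -> reC \o f @ F --> reC z.
Proof.
move=> /cvgrPdist_lt fx; apply/cvgrPdist_lt => e e0.
have e0' : 0 < toC e by rewrite -(rmorph0 (@toC R)) toC_lt.
have := fx _ e0'; apply: filterS => t.
by move=> /(le_lt_trans (norm_reC _)); rewrite toC_lt raddfB.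
Qed.
Lemma cvg_imC (f : T -> C) z : f @ F --> z -> imC \o f @ F --> imC z.
Proof.
move=> /cvgrPdist_lt fx; apply/cvgrPdist_lt => e e0.
have e0' : 0 < toC e by rewrite -(rmorph0 (@toC R)) toC_lt.
have := fx _ e0'; apply: filterS => t.
by move=> /(le_lt_trans (norm_imC _)); rewrite toC_lt raddfB.
Qed.
Lemma cvg_cis (f : T -> R) x : f @ F --> x -> cis \o f @ F --> cis x.
Proof.
move=> fx; apply: cvgD.
  by apply: (@cvg_toC (cos \o f)); apply: continuous_cvg => //; exact: continuous_cos.
apply: cvgM; first exact: cvg_cst.
by apply: (@cvg_toC (sin \o f)); apply: continuous_cvg => //; exact: continuous_sin.
Qed.

Lemma cvg_atan (f : T -> R) x : f @ F --> x -> atan \o f @ F --> atan x.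
Proof. by move=> fx; apply: continuous_cvg => //; exact: continuous_atan. Qed.

Lemma cvg_mxP m n (f : T -> 'M[C]_(m, n)) (A : 'M[C]_(m, n)) :
  f @ F --> A <-> forall i j, (fun t => f t i j) @ F --> A i j.
Proof. exact: cvg_mx_coordP. Qed.

Lemma cvg_mulmx m n p (f : T -> 'M[C]_(m, n)) (g : T -> 'M[C]_(n, p))
    (A : 'M[C]_(m, n)) (B : 'M[C]_(n, p)) :
  f @ F --> A -> g @ F --> B -> (fun t => f t *m g t) @ F --> A *m B.
Proof.
move=> /cvg_mxP fA /cvg_mxP gB; apply/cvg_mxP => i j.
rewrite mxE; under eq_fun do rewrite mxE.
apply: cvg_big => [|k _]; first exact: add_continuous.
by apply: cvgM; [exact: fA|exact: gB].
Qed.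

Lemma cvg_det n (f : T -> 'M[C]_n) (A : 'M[C]_n) :
  f @ F --> A -> (fun t => \det (f t)) @ F --> \det A.
Proof.
move=> /cvg_mxP fA; apply: cvg_big => [|s _]; first exact: add_continuous.
apply: cvgM; first exact: cvg_cst.
apply: cvg_big => [|k _]; first exact: mul_continuous.
exact: fA.
Qed.

Lemma cvg_cofactor n (f : T -> 'M[C]_n) (A : 'M[C]_n) i j :
  f @ F --> A -> (fun t => cofactor (f t) i j) @ F --> cofactor A i j.
Proof.
move=> /cvg_mxP fA; apply: cvgM; first exact: cvg_cst.
apply: cvg_det; apply/cvg_mxP => k l; rewrite !mxE.
under eq_fun do rewrite !mxE; exact: fA.
Qed.

Lemma cvg_invmx n (f : T -> 'M[C]_n) (A : 'M[C]_n) :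
  A \in unitmx -> f @ F --> A -> (fun t => invmx (f t)) @ F --> invmx A.
Proof.
move=> uA fA; have dA : \det A != 0 by rewrite unitmxE unitfE in uA.
have dfA := cvg_det fA.
have ndf : \forall t \near F, \det (f t) != 0.
  exact: (cvgr_neq0 _ dfA).
have e : \forall t \near F, (\det (f t))^-1 *: \adj (f t) = invmx (f t).
  by apply: filterS ndf => t dt; rewrite /invmx unitmxE unitfE dt.
apply: cvg_trans (near_eq_cvg e) _.
rewrite /invmx uA; apply/cvg_mxP => i j; rewrite !mxE.
under eq_fun do rewrite !mxE.
by apply: cvgM; [exact: cvgV|exact: cvg_cofactor].
Qed.
End Filters.

Lemma reC_comb x y : reC (toC x + iC * toC y) = x.
Proof. by rewrite raddfD /= reCM reC_i imC_i !reC_toC imC_toC; ring. Qed.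
Lemma imC_comb x y : imC (toC x + iC * toC y) = y.
Proof. by rewrite raddfD /= imCM reC_i imC_i !reC_toC !imC_toC; ring. Qed.

Lemma cisD x y : cis (x + y) = cis x * cis y.
Proof.
by apply: cplxP; rewrite /cis ?(raddfD, reCM, imCM, reC_toC, imC_toC, reC_i, imC_i) /=
  ?(raddfD, reCM, imCM, reC_toC, imC_toC, reC_i, imC_i) ?cosD ?sinD; ring.
Qed.
Lemma reC_cis x : reC (cis x) = cos x.
Proof. by rewrite raddfD /= reCM !reC_toC reC_i imC_toC; ring. Qed.
Lemma imC_cis x : imC (cis x) = sin x.
Proof. by rewrite raddfD /= imCM !reC_toC imC_i reC_i !imC_toC; ring. Qed.
Lemma cis0 : cis 0 = 1.
Proof. by apply: cplxP; rewrite ?reC_cis ?imC_cis ?cos0 ?sin0. Qed.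
Lemma cisN x : cis (- x) = Num.conj (cis x).
Proof. by apply: cplxP; rewrite ?reC_conj ?imC_conj ?reC_cis ?imC_cis ?cosN ?sinN. Qed.
Lemma cis_neq0 x : cis x != 0.
Proof.
apply/eqP => h; have := cis0; rewrite -(subrr x) cisD h mul0r => /eqP.
by rewrite eq_sym oner_eq0.
Qed.
Lemma cisV x : (cis x)^-1 = cis (- x).
Proof.
by apply: (mulfI (cis_neq0 x)); rewrite mulfV ?cis_neq0// -cisD subrr cis0.
Qed.
Lemma cis_conjM x : Num.conj (cis x) * cis x = 1.
Proof. by rewrite -cisN -cisD addNr cis0. Qed.
Lemma cis2pi : cis (2 * pi) = 1.
Proof.
by apply: cplxP; rewrite ?reC_cis ?imC_cis mulrC mulr_natr ?cos2pi ?sin2pi.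
Qed.
Lemma cis2pi_nat (m : nat) : cis (2 * pi * m%:R) = 1.
Proof.
elim: m => [|m ih]; first by rewrite mulr0 cis0.
have -> : m.+1%:R = m%:R + 1 :> R by rewrite natr1.
by rewrite mulrDr mulr1 cisD ih cis2pi mul1r.
Qed.
Lemma cis2pi_int (m : int) : cis (2 * pi * m%:~R) = 1.
Proof.
case: m => m; first exact: cis2pi_nat.
by rewrite NegzE mulrNz mulrN -cisV cis2pi_nat invr1.
Qed.
Lemma cis_eq1 x : cis x = 1 -> exists m : int, x = 2 * pi * m%:~R.
Proof.
move=> h; exists (Num.floor (x / (2 * pi))); set m := Num.floor _.
have pi0 : 0 < (pi : R) by exact: pi_gt0.
have p2 : 0 < 2 * (pi : R) by rewrite mulr_gt0.
set y := x - 2 * pi * m%:~R.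
have : cis y = 1 by rewrite cisD h mul1r -cisV cis2pi_int invr1.
have [y0 y2] : 0 <= y /\ y < 2 * pi.
  have /andP[h1 h2] := floor_itv (x / (2 * pi)).
  rewrite -/m in h1 h2.
  have e : x = 2 * pi * (x / (2 * pi)) by rewrite mulrCA mulfV ?mulr1// gt_eqF.
  rewrite /y; split.
    by rewrite subr_ge0 [leRHS]e ler_pM2l.
  rewrite ltrBlDr; suff : x < 2 * pi * (m%:~R + 1) by rewrite mulrDr mulr1; lra.
  by rewrite {1}e ltr_pM2l// -[1]/(1%:~R) -intrD.
move=> /(congr1 reC); rewrite reC_cis => cy.
have {}cy : cos y = 1 by rewrite cy -(rmorph1 (@toC R)) reC_toC.
suff : y = 0 by rewrite /y; lra.
(* The cosine is injective only on [0, pi]; a remainder above pi is reflected to 2 pi - y. *)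
have [yp|yp] := leP y pi.
apply: cos_inj; last by rewrite cos0.
    by rewrite in_itv/= y0 yp.
  by rewrite in_itv/= lexx ltW.
have : 2 * pi - y = 0.
  apply: cos_inj.
  - by rewrite in_itv/=; apply/andP; split; lra.
  - by rewrite in_itv/= lexx ltW.
  by rewrite cos0 -cosN opprB -(cosD2pi (y - 2 * pi)) -(mulr_natl pi 2) subrK.
lra.
Qed.
End ComplexLimits.

(** * Limits within subsets, and connectedness *)

Lemma cvg_within_comp (X Y : topologicalType) (f : X -> Y) (A : set X) (B : set Y) (x : X) :
  {for x, continuous f} -> (forall u, A u -> B (f u)) ->
  f @ within A (nbhs x) --> within B (nbhs (f x)).
Proof.
move=> fx AB U; rewrite /= /within /= /nbhs /= => /fx.
by rewrite nbhs_simpl /=; apply: filterS => u h Au; apply: h; exact: AB.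
Qed.

Lemma cvg_pair_fun (T : Type) (X Y : topologicalType) (F : set_system T) (FF : Filter F)
    (f : T -> X) (g : T -> Y) (x : X) (y : Y) :
  f @ F --> x -> g @ F --> y -> (fun t => (f t, g t)) @ F --> ((x, y) : X * Y).
Proof. exact: cvg_pair. Qed.

Lemma cvg_within_pull (X Y Z : topologicalType) (f : X -> Y) (g : Y -> Z)
    (A : set X) (B : set Y) (x : X) (l : Z) :
  {for x, continuous f} -> (forall u, A u -> B (f u)) ->
  g @ within B (nbhs (f x)) --> l -> (fun u => g (f u)) @ within A (nbhs x) --> l.
Proof. by move=> fx AB; apply: cvg_comp; exact: cvg_within_comp. Qed.

(** Local constancy makes the points of [A] that satisfy [P] both relatively open and relatively
    closed, hence all of [A] once there is one. *)
Lemma connected_locally_const (T : topologicalType) (A : set T) (P : T -> Prop) :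
  connected A ->
  (forall s, A s -> \forall u \near within A (nbhs s), P s <-> P u) ->
  forall s, A s -> P s -> forall u, A u -> P u.
Proof.
move=> cA locP s As Ps u Au.
pose B := A `&` P.
suff AB : A = B by move: Au; rewrite {1}AB => -[].
apply/esym/cA; first by exists s.
  exists (interior (P `|` ~` A)); first exact: open_interior.
  apply/seteqP; split=> [v [Av Pv]|v [Av /interior_subset[]//]].
  split=> //; have H : nbhs v (fun u => A u -> (P v <-> P u)) := locP v Av.
  apply: filterS H => w h.
  by have [Aw|nAw] := pselect (A w); [left; apply/(h Aw)|right].
exists (~` (interior (~` P `|` ~` A))); first exact/open_closedC/open_interior.
apply/seteqP; split=> v [Av h]; split=> //.
  by move=> /interior_subset[].
apply: contrapT => nP; apply: h.
have H : nbhs v (fun u => A u -> (P v <-> P u)) := locP v Av.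
apply: filterS H => w h.
have [Aw|nAw] := pselect (A w); [left|by right].
by move=> Pw; apply: nP; apply/(h Aw).
Qed.

(** * Winding numbers *)

Section Logarithms.
Variable R : realType.
Local Notation C := (Cplx R).

(** Existence of a continuous logarithm on [K]: the modulus is determined by [f], so only the
    argument has to be chosen continuously. *)
Definition log_on (T : topologicalType) (K : set T) (f : T -> C) : Prop :=
  exists2 theta : T -> R, {within K, continuous theta} &
    forall x, K x -> exists2 r : R, 0 < r & f x = toC r * cis (theta x).

Section LogOn.
Variables (T : topologicalType) (K : set T).
Implicit Types f g : T -> C.

Lemma log_on_eq f g : {in K, f =1 g} -> log_on K f -> log_on K g.
Proof.
move=> fg [th cth h]; exists th => // x Kx.
by rewrite -fg ?inE//; exact: h.
Qed.

Lemma log_onM f g : log_on K f -> log_on K g -> log_on K (fun x => f x * g x).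
Proof.
move=> [th cth hf] [th' cth' hg]; exists (fun x => th x + th' x).
  apply/subspace_continuousP => x Kx.
  by apply: cvgD; move: x Kx; apply/subspace_continuousP.
move=> x Kx; have [r r0 ->] := hf x Kx; have [r' r'0 ->] := hg x Kx.
exists (r * r'); first exact: mulr_gt0.
by rewrite rmorphM cisD; ring.
Qed.

Lemma log_onV f : log_on K f -> log_on K (fun x => (f x)^-1).
Proof.
move=> [th cth hf]; exists (fun x => - th x).
  apply/subspace_continuousP => x Kx.
  by apply: cvgN; move: x Kx; apply/subspace_continuousP.
move=> x Kx; have [r r0 ->] := hf x Kx.
exists r^-1; first by rewrite invr_gt0.
by rewrite invfM fmorphV cisV.
Qed.

(** On the right half plane the principal argument is the arctangent of Im / Re. *)
Lemma log_on_re_gt0 f : {within K, continuous f} ->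
  (forall x, K x -> 0 < reC (f x)) -> log_on K f.
Proof.
move=> /subspace_continuousP cf f0.
exists (fun x => atan (imC (f x) / reC (f x))).
  apply/subspace_continuousP => x Kx.
  apply: cvg_atan.
  apply: cvgM; first exact: (cvg_imC _ (cf x Kx)).
  apply: cvgV; first by rewrite gt_eqF ?f0.
  exact: (cvg_reC _ (cf x Kx)).
move=> x Kx; have fx0 := f0 x Kx; set t := imC _ / _.
have ca : cos (atan t) = (Num.sqrt (1 + t ^+ 2))^-1 by exact: cos_atan.
have s0 : 0 < Num.sqrt (1 + t ^+ 2).
  by rewrite sqrtr_gt0 ltr_wpDr ?sqr_ge0.
have sa : sin (atan t) = t * cos (atan t).
  by rewrite -{2}(atanK t) /tan mulfVK// ca invr_eq0 gt_eqF.
exists (reC (f x) * Num.sqrt (1 + t ^+ 2)); first exact: mulr_gt0.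
apply: cplxP.
  by rewrite reCM reC_toC imC_toC mul0r subr0 reC_cis ca mulfK ?gt_eqF.
rewrite imCM reC_toC imC_toC mul0r addr0 imC_cis sa ca.
rewrite -[imC (f x)](@mulfVK _ (reC (f x))) ?gt_eqF// -/t.
by field; rewrite gt_eqF.
Qed.

Lemma log_on_cst (c : C) : c != 0 -> log_on K (fun=> c).
Proof.
move=> c0.
have cstpos (a : C) : 0 < reC a -> log_on K (fun=> a).
  by move=> a0; apply: log_on_re_gt0 => // x; exact: cst_continuous.
have cstcis t : log_on K (fun=> cis t).
  exists (fun=> t); first by move=> x; exact: cst_continuous.
  by move=> x _; exists 1 => //; rewrite rmorph1 mul1r.
have [c1|c1|c1] := ltgtP (reC c) 0; last 1 first.
- have ci : imC c != 0.
    by apply: contra c0 => /eqP ci; apply/eqP/cplxP; rewrite raddf0.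
  have [i0|i0|i0] := ltgtP (imC c) 0; last by rewrite i0 eqxx in ci.
  + suff : log_on K (fun=> (c * cis (pi / 2)) * cis (- (pi / 2))).
      by apply: log_on_eq => x _; rewrite /= -mulrA -cisD subrr cis0 mulr1.
    apply: log_onM => //; apply: cstpos.
    by rewrite reCM reC_cis imC_cis cos_pihalf sin_pihalf; lra.
  + suff : log_on K (fun=> (c * cis (- (pi / 2))) * cis (pi / 2)).
      by apply: log_on_eq => x _; rewrite /= -mulrA -cisD addNr cis0 mulr1.
    apply: log_onM => //; apply: cstpos.
    by rewrite reCM reC_cis imC_cis cosN sinN cos_pihalf sin_pihalf; lra.
- suff : log_on K (fun=> (c * cis pi) * cis (- pi)).
    by apply: log_on_eq => x _; rewrite /= -mulrA -cisD subrr cis0 mulr1.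
  apply: log_onM => //; apply: cstpos.
  by rewrite reCM reC_cis imC_cis cospi sinpi; lra.
- exact: cstpos.
Qed.

(* Locally in [s] the ratio of two stages of the homotopy lies in the right
   half plane, by compactness of [K]; then [0, 1] is connected. *)
Lemma log_on_homotopy (F : R * T -> C) : compact K ->
  {within `[0, 1]%classic `*` K, continuous F} ->
  (forall (s : R) x, s \in `[0, 1] -> K x -> F (s, x) != 0) ->
  log_on K (fun x => F (1, x) / F (0, x)).
Proof.
move=> cK /subspace_continuousP cF F0.
have slice (s : R) : `[0, 1]%classic s -> {within K, continuous (fun x => F (s, x))}.
  move=> s01; apply/subspace_continuousP => x Kx.
  apply: (@cvg_within_pull _ _ _ (fun x => (s, x)) F _ _ x (F (s, x)) _ _ (cF (s, x) _)) => //.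
  by apply: cvg_pair_fun; [exact: cvg_cst|exact: cvg_id].
have loc (s0 : R) : `[0, 1]%classic s0 -> \forall s \near within `[0, 1]%classic (nbhs s0),
    log_on K (fun x => F (s, x) / F (s0, x)).
  move=> s01.
  have : \forall s \near within `[0, 1]%classic (nbhs s0),
      K `<=` (fun x => 0 < reC (F (s, x) / F (s0, x))).
    move/compact_near_coveringP/near_covering_withinP : cK; apply => x Kx.
    have : (fun p : R * T => reC (F p / F (s0, p.2))) @
        within (`[0, 1]%classic `*` K) (nbhs (s0, x)) --> (1 : R).
      have e1 : reC (F (s0, x) / F (s0, x)) = 1.
        by rewrite divff ?F0// -(rmorph1 (@toC R)) reC_toC.
      rewrite -[X in _ --> X]e1.
      apply: cvg_reC; apply: cvgM; first by apply: (cF (s0, x)); split.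
      apply: cvgV; first by rewrite F0.
      apply: (@cvg_within_pull _ _ _ (fun p : R * T => (s0, p.2)) F _ _ (s0, x)
        (F (s0, x)) _ _ (cF (s0, x) _)) => //.
        by apply: cvg_pair_fun; [exact: cvg_cst|exact: cvg_snd].
      by move=> [u v] [/= _ Kv].
    move=> /cvgr_gt/(_ 0 ltr01).
    move=> Hn; have [[U V] /= [Us Vx] UV] : nbhs (s0, x) (fun p : R * T =>
      (`[0, 1]%classic `*` K) p -> 0 < reC (F p / F (s0, p.2))) := Hn.
    exists (V, [set s | `[0, 1]%classic s /\ U s]) => /=.
      split=> //; have H : nbhs s0 (fun s => `[0, 1]%classic s -> `[0, 1]%classic s /\ U s).
        by apply: filterS Us.
      by apply: filterS H => s h h'; exact: h.
    by move=> [v s] /= [Vv [Is Us']] Kv; apply: (UV (s, v)).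
  move=> H; have {}H : nbhs s0 (fun s => `[0, 1]%classic s ->
      K `<=` (fun x => 0 < reC (F (s, x) / F (s0, x)))) := H.
  apply: filterS H => s h Is; apply: log_on_re_gt0; last exact: h.
  apply/subspace_continuousP => x Kx; apply: cvgM.
    by move: x Kx; apply/subspace_continuousP; exact: slice.
  apply: cvgV; first exact: F0.
  by move: x Kx; apply/subspace_continuousP; exact: slice.
pose P s := log_on K (fun x => F (s, x) / F (0, x)).
apply: (@connected_locally_const _ _ P (@segment_connected R 0 1) _ 0 _ _ 1).
- move=> s Is; have H : nbhs s (fun u => `[0, 1]%classic u ->
    log_on K (fun x => F (u, x) / F (s, x))) := loc s Is.
  apply: filterS H => u h Iu; have {}h := h Iu.
  split=> hs.
    apply: log_on_eq (log_onM h hs) => x; rewrite inE => Kx /=.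
    by field; rewrite !F0 ?in_itv/= ?lexx ?ler01.
  apply: log_on_eq (log_onM (log_onV h) hs) => x; rewrite inE => Kx /=.
  by field; rewrite !F0 ?in_itv/= ?lexx ?ler01.
- by rewrite /= in_itv/= lexx ler01.
- have : log_on K (fun=> 1) by apply: log_on_cst; rewrite oner_eq0.
  by apply: log_on_eq => x; rewrite inE => Kx /=; rewrite divff// F0// in_itv/= lexx ler01.
- by rewrite /= in_itv/= lexx ler01.
Qed.
End LogOn.

Definition rect (L : R) : set (R * R) := `[0, L]%classic `*` `[-1, 1]%classic.
Definition rect_bd (L : R) : set (R * R) :=
  [set 0; L] `*` `[-1, 1]%classic `|` `[0, L]%classic `*` [set -1; 1].

Lemma compact_rect L : compact (rect L).
Proof. by apply: compact_setX; exact: segment_compact. Qed.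

Lemma compact_rect_bd L : compact (rect_bd L).
Proof.
by apply: compactU; apply: compact_setX; rewrite -?setU1r;
  solve [exact: segment_compact | by apply: compactU; exact: compact_set1].
Qed.

Lemma rect_bd_sub L : 0 <= L -> rect_bd L `<=` rect L.
Proof.
move=> L0 [t s] /= [[/= [->|->] h2]|[/= h1 [->|->]]]; split; rewrite //= !in_itv/= ?lexx ?L0 //.
all: by apply/andP; split; lra.
Qed.

Lemma log_on_sub (T : topologicalType) (A B : set T) (f : T -> C) :
  A `<=` B -> log_on B f -> log_on A f.
Proof.
move=> AB [th cth h]; exists th; last by move=> x /AB; exact: h.
exact: continuous_subspaceW cth.
Qed.

(** The rectangle is star-shaped about (0, 0), so [f] is homotopic, without zeros, to the constant f
    (0, 0) by scaling the argument. *)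
Lemma log_on_rect L (f : R * R -> C) : 0 <= L -> {within rect L, continuous f} ->
  (forall p, rect L p -> f p != 0) -> log_on (rect L) f.
Proof.
move=> L0 /subspace_continuousP cf f0.
have h0 : rect L (0, 0).
  by split; rewrite /= in_itv/= ?lexx ?L0//; apply/andP; split; lra.
pose F (p : R * (R * R)) := f (p.1 * p.2.1, p.1 * p.2.2).
have stab s p : s \in `[0, 1] -> rect L p -> rect L (s * p.1, s * p.2).
  rewrite in_itv/= => /andP[s0 s1] [/=]; rewrite !in_itv/= => /andP[a1 a2] /andP[b1 b2].
  split; rewrite /= in_itv/=; apply/andP; split; nra.
have := @log_on_homotopy _ (rect L) F (@compact_rect L).
have -> : (fun x => F (1, x) / F (0, x)) = (fun x => f x / f (0, 0)).
  by apply/funext => -[x y]; rewrite /F /= !mul1r !mul0r.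
move=> H; have {}H : log_on (rect L) (fun x : R * R => f x / f (0, 0)).
  apply: H.
    apply/subspace_continuousP => -[s [x y]] [/= Is Ip].
    apply: (@cvg_within_pull _ _ _ (fun p : R * (R * R) => (p.1 * p.2.1, p.1 * p.2.2)) f
      _ (rect L) (s, (x, y)) _ _ _ (cf _ _)) => /=.
    - apply: cvg_pair_fun => /=.
        apply: cvgM; first exact: cvg_fst.
        by apply: (@cvg_comp _ _ _ snd fst); [exact: cvg_snd|exact: cvg_fst].
      apply: cvgM; first exact: cvg_fst.
      by apply: (@cvg_comp _ _ _ snd snd); exact: cvg_snd.
    - by move=> [u p] [/= Iu rp]; exact: stab.
    - exact: (stab s (x, y)).
  by move=> s p Is rp; apply: f0; exact: stab.
have : log_on (rect L) (fun x => f (0, 0)) by apply: log_on_cst; exact: f0.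
move=> /(log_onM H); apply: log_on_eq => x; rewrite inE => rx /=.
by rewrite mulfVK// f0.
Qed.

End Logarithms.

Section Winding.
Variable R : realType.
Local Notation C := (Cplx R).

Lemma cis_exprz (x : R) (m : int) : cis x ^ m = cis (m%:~R * x).
Proof.
have nat_case (k : nat) : cis x ^+ k = cis (k%:R * x).
  elim: k => [|k ih]; first by rewrite expr0 mul0r cis0.
  by rewrite exprS ih -cisD -[k.+1%:R]natr1 mulrDl mul1r addrC.
case: m => k; first exact: nat_case.
by rewrite NegzE -exprnN nat_case cisV mulrNz mulNr.
Qed.

(** The point of the plane read as a complex number centred in the rectangle: the reference loop
    with winding number 1. *)
Definition zeta (L : R) (p : R * R) : C := toC (p.1 - L / 2) + iC R * toC p.2.

(* The winding number of [f] around the boundary of the rectangle is [m] when [f] differs from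
   [zeta ^ m] by a factor that has a continuous logarithm there. *)
Definition wind (L : R) (f : R * R -> C) (m : int) : Prop :=
  log_on (rect_bd L) (fun p => f p / zeta L p ^ m).

Lemma zeta_neq0 L p : 0 < L -> rect_bd L p -> zeta L p != 0.
Proof.
move=> L0 bp; apply/eqP => z0.
have := congr1 (@reC R) z0; have := congr1 (@imC R) z0.
rewrite /zeta reC_comb imC_comb !raddf0.
case: p bp {z0} => t s [[/= [->|->] _]|[/= _ [->|->]]] h1 h2; lra.
Qed.

Lemma cvg_maxr (T : Type) (F : set_system T) (FF : Filter F) (f g : T -> R) (x y : R) :
  f @ F --> x -> g @ F --> y ->
  (fun t => Num.max (f t) (g t)) @ F --> Num.max x y.
Proof.
move=> fx gy; apply: (@cvg_comp _ _ _ (fun t => (f t, g t)) (fun xy : R * R => Num.max xy.1 xy.2) _ (nbhs ((x, y) : R * R))).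
  exact: (cvg_pair_fun _ fx gy).
exact: (@max_continuous _ R (x, y)).
Qed.

Section Loop.
Variables (L : R) (L0 : 0 < L).

(* The central projection of the unit circle onto the boundary of the rectangle. *)
Let D (x : R) := Num.max (`|cos x| / (L / 2)) `|sin x|.
Let b (x : R) : R * R := (L / 2 + cos x / D x, sin x / D x).

Let L2 : 0 < L / 2. Proof. exact: divr_gt0. Qed.

Let D_gt0 x : 0 < D x.
Proof.
rewrite /D lt_max pmulr_lgt0 ?invr_gt0// !normr_gt0.
apply/negPn/negP; rewrite negb_or !negbK => /andP[/eqP c0 /eqP s0].
by have := cos2Dsin2 x; rewrite c0 s0 expr0n addr0 => /eqP; rewrite eq_sym oner_eq0.
Qed.

Let absdiv u v (w : R) : 0 < v -> `|u| <= w * v -> - w <= u / v <= w.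
Proof. by move=> v0 h; rewrite -ler_norml normrM normfV (gtr0_norm v0) ler_pdivrMr. Qed.

Let abseq u v (w : R) : 0 < v -> `|u| = w * v -> u / v = w \/ u / v = - w.
Proof.
move=> v0 h; have [u0|u0] := leP 0 u.
  by left; rewrite -(ger0_norm u0) h mulfK ?gt_eqF.
by right; rewrite -[u]opprK -(ltr0_norm u0) h mulNr mulfK ?gt_eqF.
Qed.

Let b_bd x : rect_bd L (b x).
Proof.
have Dx := D_gt0 x; rewrite /b.
have hc : `|cos x| <= L / 2 * D x.
  by rewrite mulrC -ler_pdivrMr// /D le_max lexx.
have hs : `|sin x| <= 1 * D x by rewrite mul1r /D le_max lexx orbT.
have [h1 h2] : (- (L / 2) <= cos x / D x <= L / 2) /\ (- 1 <= sin x / D x <= 1).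
  by split; exact: absdiv.
have [e|e] : `|cos x| = L / 2 * D x \/ `|sin x| = 1 * D x.
  have [le|le] := leP (`|cos x| / (L / 2)) `|sin x|.
    by right; rewrite mul1r /D max_r.
  by left; rewrite /D max_l ?ltW// mulrC mulfVK// gt_eqF.
- left; split; last by rewrite /= in_itv.
  by case: (abseq Dx e) => /= ->; [right|left]; lra.
- right; split; first by rewrite /= in_itv/=; apply/andP; split; lra.
  by case: (abseq Dx e) => /= ->; [right|left].
Qed.

Let zeta_b x : zeta L (b x) = toC (D x)^-1 * cis x.
Proof.
apply: cplxP; rewrite /zeta ?reC_comb ?imC_comb ?reCM ?imCM reC_toC imC_toC reC_cis imC_cis /=; lra.
Qed.

Let cvg_b x : b @ x --> b x.
Proof.
have cD : D @ x --> D x.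
  apply: cvg_maxr.
    apply: cvgM; last exact: cvg_cst.
    by apply: cvg_norm; exact: continuous_cos.
  by apply: cvg_norm; exact: continuous_sin.
have cDV : (fun x => (D x)^-1) @ x --> (D x)^-1 by apply: cvgV => //; rewrite gt_eqF.
apply: cvg_pair_fun.
  apply: cvgD; first exact: cvg_cst.
  by apply: cvgM => //; exact: continuous_cos.
by apply: cvgM => //; exact: continuous_sin.
Qed.

(** Along the loop [b], the argument of zeta^m is m x, so m x - theta (b x) is continuous with
    values in 2 pi Z, hence constant. After a full turn theta (b x) has returned to its initial
    value, which forces 2 pi m = 0. *)
Lemma zeta_log_on (m : int) : log_on (rect_bd L) (fun p => zeta L p ^ m) -> m = 0.
Proof.
move=> [th /subspace_continuousP cth hth].
pose h x := m%:~R * x - th (b x).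
have ch x : h @ x --> h x.
  apply: cvgB; first by apply: cvgM; [exact: cvg_cst|exact: cvg_id].
  have := @cvg_within_pull _ _ _ b th setT (rect_bd L) x (th (b x)) (@cvg_b x)
    (fun u _ => b_bd u) (cth _ (b_bd x)).
  move=> H U /H HU; have {}HU : nbhs x (fun u => setT u -> U (th (b u))) := HU.
  by apply: filterS HU => u; exact.
have hint x : exists k : int, h x = 2 * pi * k%:~R.
  apply: cis_eq1.
  have [r r0 e] := hth (b x) (b_bd x).
  have Dm : 0 < (D x)^-1 ^ m by apply: exprz_gt0; rewrite invr_gt0.
  move: e; rewrite zeta_b exprzMl ?cis_exprz; last 2 first.
    by rewrite unitfE toC_eq0 invr_eq0 gt_eqF.
    by rewrite unitfE cis_neq0.
  have -> : toC (D x)^-1 ^ m = toC ((D x)^-1 ^ m) by rewrite -fmorphXz.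
  move=> e; have {}e : cis (h x) = toC (r / (D x)^-1 ^ m).
    rewrite rmorphM fmorphV cisD -cisV.
    apply: (mulIf (cis_neq0 (th (b x)))); rewrite mulfVK ?cis_neq0//.
    apply: (mulfI (_ : toC ((D x)^-1 ^ m) != 0)); first by rewrite toC_eq0 gt_eqF.
    by rewrite e; field; rewrite toC_eq0 gt_eqF.
  have q0 : 0 < r / (D x)^-1 ^ m by rewrite divr_gt0.
  move: (r / (D x)^-1 ^ m) q0 e => q q0 e.
  have : toC (q ^+ 2) = 1.
    rewrite expr2 rmorphM; have := cis_conjM (h x); rewrite e.
    by rewrite conj_toC.
  rewrite -(rmorph1 (@toC R)) => /toC_inj/eqP; rewrite sqrf_eq1 => /orP[] /eqP e1.
    by rewrite e e1 rmorph1.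
  by move: q0; rewrite e1 oppr_gt0 ltr10.
have pi0 := @pi_gt0 R.
have hcst : forall u, `[0, 2 * pi]%classic u -> h u = h 0.
  move=> u Iu.
  apply: (@connected_locally_const _ _ (fun u => h u = h 0) (@segment_connected R 0 (2 * pi)) _ 0) Iu => //; last first.
    by rewrite /= in_itv/= lexx; lra.
  move=> s _; have /cvgrPdist_lt/(_ pi pi0) H := ch s.
  have {}H : nbhs s (fun v => `[0, 2 * pi]%classic v -> (h s = h 0 <-> h v = h 0)).
    apply: filterS H => v hv _; suff -> : h s = h v by [].
    have [k hk] := hint s; have [k' hk'] := hint v.
    move: hv; rewrite hk hk' -mulrBr -intrB normrM (gtr0_norm (_ : 0 < 2 * pi)); last lra.
    rewrite -intr_norm => lt1; suff -> : k = k' by [].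
    apply/eqP; rewrite -subr_eq0 -normr_le0.
    have : (`|k - k'|%:~R : R) < 1.
      by rewrite -(ltr_pM2l (_ : 0 < 2 * pi)) ?mulr1; lra.
    by rewrite -[1]/(1%:~R) ltr_int -[1]add0r ltzD1.
  exact: H.
have := hcst (2 * pi); rewrite /= in_itv/= lexx => /(_ _)/wrap[]; first by rewrite andbT; lra.
rewrite /h /b /D cos0 sin0 (mulrC 2) mulr_natr cos2pi sin2pi mulr0 => H.
have : m%:~R * (pi *+ 2) = 0 :> R by lra.
by move=> /eqP; rewrite mulf_eq0 mulrn_eq0 intr_eq0 (gt_eqF pi0) !orbF => /eqP.
Qed.
End Loop.

(** Dividing the two factors that have logarithms leaves a power of [zeta] with a logarithm. *)
Lemma wind_uniq L f m m' : 0 < L -> wind L f m -> wind L f m' -> m = m'.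
Proof.
move=> L0 h h'; apply/eqP; rewrite -subr_eq0; apply/eqP/(zeta_log_on L0).
have [th _ fne] := h.
have f0 p : rect_bd L p -> f p != 0.
  move=> bp; apply/eqP => fp; have [r r0] := fne p bp; rewrite fp mul0r => /eqP.
  by rewrite eq_sym mulf_eq0 (negbTE (cis_neq0 _)) orbF toC_eq0 gt_eqF.
apply: log_on_eq (log_onM (log_onV h) h') => p; rewrite inE => bp /=.
rewrite exprzDr ?unitfE ?zeta_neq0// -invr_expz.
by field; rewrite !expfz_neq0 ?zeta_neq0// f0.
Qed.

Lemma wind_eq L f g m : {in rect_bd L, f =1 g} -> wind L f m -> wind L g m.
Proof. by move=> fg; apply: log_on_eq => p bp /=; rewrite fg. Qed.

Lemma wind_log_on L f g m : (forall p, rect_bd L p -> f p != 0) ->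
  log_on (rect_bd L) (fun p => g p / f p) -> wind L f m -> wind L g m.
Proof.
move=> f0 lfg wf; apply: log_on_eq (log_onM lfg wf) => p; rewrite inE => bp /=.
by rewrite mulrA mulfVK ?f0.
Qed.

(** Homotopy invariance, stated from time 1 back to time 0: zeros are counted on the deformed path
    and the count is carried to the original one. *)
Lemma wind_sym L (F : R * (R * R) -> C) m :
  {within `[0, 1]%classic `*` rect_bd L, continuous F} ->
  (forall s p, s \in `[0, 1] -> rect_bd L p -> F (s, p) != 0) ->
  wind L (fun p => F (1, p)) m -> wind L (fun p => F (0, p)) m.
Proof.
move=> cF F0; apply: wind_log_on.
  by move=> p bp; apply: F0 => //; rewrite in_itv/= lexx ler01.
apply: log_on_eq (log_onV (log_on_homotopy (@compact_rect_bd _ L) cF F0)) => p.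
by rewrite /= invf_div.
Qed.

Lemma windM L f g m k : 0 < L -> wind L f m -> wind L g k ->
  wind L (fun p => f p * g p) (m + k).
Proof.
move=> L0 wf wg; apply: log_on_eq (log_onM wf wg) => p; rewrite inE => bp /=.
rewrite exprzDr ?unitfE ?zeta_neq0//.
by field; rewrite !expfz_neq0 ?zeta_neq0.
Qed.

Lemma wind0 L f : log_on (rect_bd L) f -> wind L f 0.
Proof. by apply: log_on_eq => p _; rewrite /= expr0z divr1. Qed.

(* [lin a t0] is the linear model, at a zero [(t0, 0)], of the determinant below. *)
Definition lin (a t0 : R) (p : R * R) : C := toC (a * (p.1 - t0)) + iC R * toC (2 * p.2).

Lemma lin_eq0 a t0 p : a != 0 -> lin a t0 p = 0 -> p = (t0, 0).
Proof.
move=> a0 h; have := congr1 (@reC R) h; have := congr1 (@imC R) h.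
rewrite /lin reC_comb imC_comb !raddf0; case: p {h} => t s /= h /eqP.
by rewrite mulf_eq0 (negbTE a0) subr_eq0 => /eqP ->; congr pair; lra.
Qed.

Lemma log_on_conj (T : topologicalType) (K : set T) (f : T -> C) :
  log_on K f -> log_on K (fun x => Num.conj (f x)).
Proof.
move=> [th /subspace_continuousP cth h]; exists (fun x => - th x).
  by apply/subspace_continuousP => x Kx; apply: cvgN; exact: cth.
move=> x /h[r r0 ->]; exists r => //.
by rewrite rmorphM /= conj_toC cisN.
Qed.

Lemma log_on_pos (T : topologicalType) (K : set T) (f : T -> R) :
  (forall x, K x -> 0 < f x) -> log_on K (fun x => toC (f x)).
Proof.
move=> f0; exists (fun=> 0) => [x|x Kx]; first exact: cst_continuous.
by exists (f x); [exact: f0|rewrite cis0 mulr1].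
Qed.

(** The product of [zeta] and its conjugate is a positive real q, so the conjugate of zeta^m differs
    from zeta^(-m) by the positive factor q^m. *)
Lemma wind_conj L f m : 0 < L -> wind L f m -> wind L (fun p => Num.conj (f p)) (- m).
Proof.
move=> L0 wf.
pose q p := reC (zeta L p) ^+ 2 + imC (zeta L p) ^+ 2.
have qE p : Num.conj (zeta L p) * zeta L p = toC (q p).
  by apply: cplxP; rewrite ?reCM ?imCM reC_conj imC_conj ?reC_toC ?imC_toC /q; ring.
have q0 p : rect_bd L p -> 0 < q p.
  move=> bp; rewrite lt_neqAle addr_ge0 ?sqr_ge0// andbT eq_sym.
  by rewrite -toC_eq0 -qE mulf_neq0 ?fmorph_eq0 ?zeta_neq0.
have : log_on (rect_bd L) (fun p => toC (q p ^ m)).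
  by apply: log_on_pos => p /q0; exact: exprz_gt0.
move=> /(log_onM (log_on_conj wf)); apply: log_on_eq => p; rewrite inE => bp /=.
rewrite rmorphM /= fmorphV /= fmorphXz -invr_expz.
have -> : toC (q p ^ m) = (Num.conj (zeta L p) * zeta L p) ^ m by rewrite qE -fmorphXz.
rewrite exprzMl ?unitfE ?fmorph_eq0 ?zeta_neq0//.
by rewrite invrK mulrA mulfVK// expfz_neq0 ?fmorph_eq0 ?zeta_neq0.
Qed.

Lemma conv_gt0 (s u v : R) : 0 <= s <= 1 -> 0 < u -> 0 < v -> 0 < (1 - s) * u + s * v.
Proof.
move=> /andP[s0 s1] u0 v0; have [->|sn0] := eqVneq s 0.
  by rewrite subr0 mul1r mul0r addr0.
by rewrite ltr_wpDl// ?mulr_ge0 ?mulr_gt0 ?subr_ge0 ?(ltW u0)// lt_neqAle eq_sym sn0.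
Qed.

Lemma wind_lin_pos L a t0 : 0 < t0 < L -> 0 < a -> wind L (lin a t0) 1.
Proof.
move=> /andP[t00 t0L] a0; have L0 := lt_trans t00 t0L.
(* Linear interpolation from [lin] to [zeta]. On the vertical sides the real parts of both have the
   same sign, because a > 0 and 0 < t0 < L; on the horizontal sides the imaginary parts do. *)
pose F (q : R * (R * R)) := toC ((1 - q.1) * (a * (q.2.1 - t0)) + q.1 * (q.2.1 - L / 2))
   + iC R * toC (((1 - q.1) * 2 + q.1) * q.2.2).
have F0 : (fun p => F (0, p)) = lin a t0.
  by apply/funext => p; rewrite /F /lin /= subr0 !mul1r mul0r !addr0.
have F1 : (fun p => F (1, p)) = zeta L.
  by apply/funext => p; rewrite /F /zeta /= subrr !mul0r !add0r !mul1r.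
rewrite -F0; apply: wind_sym.
- apply: continuous_subspaceT => q; apply: cvgD.
    apply: (@cvg_toC _ _ _ _ (fun q : R * (R * R) => (1 - q.1) * (a * (q.2.1 - t0)) + q.1 * (q.2.1 - L / 2))).
    have c21 : (fun q : R * (R * R) => q.2.1) @ q --> q.2.1.
      by apply: (@cvg_comp _ _ _ snd fst); [exact: cvg_snd|exact: cvg_fst].
    have c1 : fst @ q --> q.1 by exact: cvg_fst.
    apply: cvgD; apply: cvgM => //.
    + by apply: cvgB => //; exact: cvg_cst.
    + by apply: cvgM; [exact: cvg_cst|apply: cvgB => //; exact: cvg_cst].
    + by apply: cvgB => //; exact: cvg_cst.
  apply: cvgM; first exact: cvg_cst.
  apply: (@cvg_toC _ _ _ _ (fun q : R * (R * R) => ((1 - q.1) * 2 + q.1) * q.2.2)).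
  have c22 : (fun q : R * (R * R) => q.2.2) @ q --> q.2.2.
    by apply: (@cvg_comp _ _ _ snd snd); exact: cvg_snd.
  have c1 : fst @ q --> q.1 by exact: cvg_fst.
  apply: cvgM => //; apply: cvgD => //; apply: cvgM; last exact: cvg_cst.
  by apply: cvgB => //; exact: cvg_cst.
- move=> s p; rewrite in_itv/= => /andP[s0 s1] bp; apply/eqP => Fz.
  have := congr1 (@reC R) Fz; have := congr1 (@imC R) Fz.
  rewrite /F reC_comb imC_comb !raddf0 /=.
  have -> : (1 - s) * 2 + s = 2 - s by ring.
  case: p bp {Fz} => t u [[/= [->|->] _]|[/= _ [->|->]]] h1 h2; try lra.
    have : 0 < (1 - s) * (a * t0) + s * (L / 2).
      by apply: conv_gt0; rewrite ?s0// ?mulr_gt0//; lra.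
    lra.
  have : 0 < (1 - s) * (a * (L - t0)) + s * (L / 2).
    by apply: conv_gt0; rewrite ?s0// ?mulr_gt0//; lra.
  lra.
- rewrite F1; have : log_on (rect_bd L) (fun=> (1 : C)) by apply: log_on_cst; rewrite oner_eq0.
  by apply: log_on_eq => p; rewrite inE => bp /=; rewrite expr1z divff// zeta_neq0.
Qed.

(** For a < 0, [lin a t0] is minus the conjugate of [lin (- a) t0], and conjugation reverses the
    winding. *)
Lemma wind_lin L a t0 : 0 < t0 < L -> a != 0 -> wind L (lin a t0) (sgz a).
Proof.
move=> ht a0; have /andP[t00 t0L] := ht; have L0 := lt_trans t00 t0L.
have [a1|a1|a1] := ltgtP a 0; last by rewrite a1 eqxx in a0.
  rewrite ltr0_sgz//.
  have na : 0 < - a by rewrite oppr_gt0.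
  have w1 : wind L (fun=> - (1 : C)) 0.
    by apply/wind0/(@log_on_cst R _ (rect_bd L)); rewrite oppr_eq0 oner_eq0.
  have := windM L0 w1 (wind_conj L0 (wind_lin_pos ht na)); rewrite add0r.
  apply: wind_eq => p _; apply: cplxP;
   by rewrite mulN1r raddfN /= ?reC_conj ?imC_conj /lin ?reC_comb ?imC_comb; ring.
by rewrite gtr0_sgz//; exact: wind_lin_pos.
Qed.

Lemma lin_continuous a t0 : continuous (lin a t0).
Proof.
move=> p; apply: cvgD.
  apply: (@cvg_toC _ _ _ _ (fun p : R * R => a * (p.1 - t0))).
  by apply: cvgM; [exact: cvg_cst|apply: cvgB; [exact: cvg_fst|exact: cvg_cst]].
apply: cvgM; [exact: cvg_cst|apply: (@cvg_toC _ _ _ _ (fun p : R * R => 2 * p.2))].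
by apply: cvgM; [exact: cvg_cst|exact: cvg_snd].
Qed.

(* Dividing out the linear models of the zeros leaves a nonvanishing function. *)
Lemma wind_zeros L (s : seq R) (a : R -> R) (f : R * R -> C) (kap : R -> C) :
  0 < L -> uniq s ->
  (forall t, t \in s -> 0 < t < L /\ a t != 0 /\ kap t != 0) ->
  {within rect L, continuous f} ->
  (forall p, rect L p -> f p = 0 <-> exists2 t, t \in s & p = (t, 0)) ->
  (forall t, t \in s ->
    (fun p => f p / lin (a t) t p) @ within (rect L) ((t, 0)^') --> kap t) ->
  wind L f (\sum_(t <- s) sgz (a t)).
Proof.
move=> L0; elim: s f kap => [|t s ih] f kap.
  move=> _ _ cf fz _; rewrite big_nil; apply: wind0.
  apply: log_on_sub (rect_bd_sub (ltW L0)) _; apply: log_on_rect => //; first exact: ltW.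
  by move=> p rp; apply/eqP => /(fz p rp)[].
move=> /= /andP[ts us] hs /subspace_continuousP cf fz flim.
have [/andP[t0 tL] [at0 kt0]] := hs t (mem_head _ _).
have nbd p : rect_bd L p -> p != (t, 0).
  by case: p => u v [[/= [->|->] _]|[/= _ [->|->]]]; rewrite xpair_eqE; apply/negP => /andP[/eqP ? /eqP ?]; lra.
have lin0 p : p != (t, 0) -> lin (a t) t p != 0.
  by move=> pt; apply: contra_neq pt; exact: lin_eq0.
pose g p := if p == (t, 0) then kap t else f p / lin (a t) t p.
have gE p : p != (t, 0) -> g p = f p / lin (a t) t p by rewrite /g => /negbTE ->.
have nearne (x y : R * R) : x != y -> \forall p \near x, p != y.
  move=> xy; have : (fun p => p - y) @ x --> x - y.
    by apply: cvgB; [exact: cvg_id|exact: cvg_cst].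
  move=> /cvgr_neq0/(_ _); rewrite subr_eq0 => /(_ xy).
  by apply: filterS => p; rewrite subr_eq0.
have wg : wind L g (\sum_(t' <- s) sgz (a t')).
  apply: (ih g (fun t' => kap t' / lin (a t) t (t', 0))) => //.
  - move=> t' t's; have [? [? ?]] := hs t' (mem_behead (s := t :: s) t's).
    do 2![split=> //]; rewrite mulf_neq0// invr_eq0; apply: lin0.
    by rewrite xpair_eqE eqxx andbT; apply: contraNneq ts => <-.
  - apply/subspace_continuousP => x rx.
    have [xt|xt] := eqVneq x (t, 0).
      have := flim t (mem_head _ _); rewrite {2}/from_subspace /g xt eqxx => H U kU.
      have H2 : nbhs (t, 0) (fun p : R * R => p != (t, 0) -> rect L p -> U (f p / lin (a t) t p)) := H U kU.
      suff H3 : nbhs (t, 0) (fun p : R * R => rect L p -> U (g p)) by exact: H3.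
      apply: filterS H2 => p h rp; rewrite /g; have [pt|pt] := eqVneq p (t, 0).
        exact: nbhs_singleton.
      exact: h.
    rewrite /from_subspace gE// => U kU.
    have H : (fun p => f p / lin (a t) t p) @ within (rect L) (nbhs x) --> f x / lin (a t) t x.
      apply: cvgM; first exact: cf.
      apply: cvgV; first exact: lin0.
      by apply: cvg_within_filter; exact: lin_continuous.
    have H2 : nbhs x (fun p : R * R => rect L p -> U (f p / lin (a t) t p)) := H U kU.
    suff H3 : nbhs x (fun p : R * R => rect L p -> U (g p)) by exact: H3.
    near=> p; rewrite gE; last by near: p; exact: nearne.
    by near: p.
  - move=> p rp; have [->|pt] := eqVneq p (t, 0).
      rewrite /g eqxx; split=> [k0|[t' t's [e]]]; first by rewrite k0 eqxx in kt0.
      by rewrite e t's in ts.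
    rewrite gE//; split=> [/eqP|[t' t's e]].
      rewrite mulf_eq0 invr_eq0 (negbTE (lin0 _ pt)) orbF => /eqP/(fz p rp)[t'].
      rewrite in_cons => /orP[/eqP ->|t's ->]; first by move=> e; rewrite e eqxx in pt.
      by exists t'.
    have -> : f p = 0 by apply/(fz p rp); exists t' => //; rewrite in_cons t's orbT.
    by rewrite mul0r.
  - move=> t' t's.
    have tt' : (t', 0 : R) != (t, 0 : R).
      by rewrite xpair_eqE eqxx andbT; apply: contraNneq ts => <-.
    have H : (fun p => f p / lin (a t') t' p / lin (a t) t p) @ within (rect L) ((t', 0)^') -->
        kap t' / lin (a t) t (t', 0).
      apply: cvgM; first by apply: flim; rewrite in_cons t's orbT.
      apply: cvgV; first exact: lin0.
      by do 2!apply: cvg_within_filter; exact: lin_continuous.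
    move=> U kU.
    have H2 : nbhs (t', 0) (fun p : R * R => p != (t', 0) -> rect L p ->
       U (f p / lin (a t') t' p / lin (a t) t p)) := H U kU.
    suff H3 : nbhs (t', 0) (fun p : R * R => p != (t', 0) -> rect L p -> U (g p / lin (a t') t' p)) by exact: H3.
    near=> p => pt' rp; rewrite gE; last by near: p; exact: nearne.
    by rewrite mulrAC; move: pt' rp; near: p.
rewrite big_cons; apply: wind_eq (windM L0 (wind_lin (L := L) (t0 := t) (a := a t) _ at0) wg) => [p|]; last by rewrite t0.
rewrite inE => bp; rewrite gE ?nbd// mulrC mulfVK// lin0// nbd//.
Unshelve. all: by end_near. Qed.
End Winding.

(** * Uniqueness of the intersection number *)

Section ConjTranspose.
Variable R : realType.
Local Notation C := (Cplx R).

(** The operation of [dagger] for rectangular matrices, so that it also applies to vectors. *)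
Definition dg m p (A : 'M[C]_(m, p)) : 'M[C]_(p, m) := (map_mx Num.conj A)^T.

Lemma dgE m p (A : 'M[C]_(m, p)) i j : dg A i j = Num.conj (A j i).
Proof. by rewrite !mxE. Qed.
Lemma dgK m p (A : 'M[C]_(m, p)) : dg (dg A) = A.
Proof. by apply/matrixP => i j; rewrite !dgE conjCK. Qed.
Lemma dgM m p q (A : 'M[C]_(m, p)) (B : 'M[C]_(p, q)) : dg (A *m B) = dg B *m dg A.
Proof. by rewrite /dg map_mxM trmx_mul. Qed.
Lemma dgD m p (A B : 'M[C]_(m, p)) : dg (A + B) = dg A + dg B.
Proof. by apply/matrixP => i j; rewrite !mxE rmorphD. Qed.
Lemma dgN m p (A : 'M[C]_(m, p)) : dg (- A) = - dg A.
Proof. by apply/matrixP => i j; rewrite !mxE rmorphN. Qed.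
Lemma dgZ m p a (A : 'M[C]_(m, p)) : dg (a *: A) = Num.conj a *: dg A.
Proof. by apply/matrixP => i j; rewrite !mxE rmorphM. Qed.
Lemma dg1 m : dg 1%:M = 1%:M :> 'M[C]_m.
Proof. by apply/matrixP => i j; rewrite dgE !mxE eq_sym rmorph_nat. Qed.
Lemma dg0 m p : dg 0 = 0 :> 'M[C]_(m, p).
Proof. by apply/matrixP => i j; rewrite dgE !mxE rmorph0. Qed.

Lemma dgxx_eq0 m (x : 'cV[C]_m) : dg x *m x = 0 -> x = 0.
Proof.
move=> /matrixP/(_ 0 0); rewrite !mxE.
under eq_bigr do rewrite dgE mulrC -normCK.
move=> /eqP; rewrite psumr_eq0 => [/allP h|i _]; last exact: exprn_ge0.
apply/colP => i; rewrite mxE; have := h i (mem_index_enum _).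
by rewrite /= expf_eq0 normr_eq0 => /eqP.
Qed.

Lemma det_rcol m (A : 'M[C]_m) : \det A = 0 -> exists2 x : 'cV[C]_m, x != 0 & A *m x = 0.
Proof.
rewrite -det_tr => /eqP/det0P[v v0 h]; exists v^T.
  by apply: contra v0 => /eqP/(congr1 trmx); rewrite trmxK trmx0 => ->.
by apply: trmx_inj; rewrite trmx_mul trmxK h trmx0.
Qed.

Lemma det_rcolP m (A : 'M[C]_m) (x : 'cV[C]_m) : x != 0 -> A *m x = 0 -> \det A = 0.
Proof.
move=> x0 h; rewrite -det_tr; apply/eqP/det0P; exists x^T.
  by apply: contra x0 => /eqP/(congr1 trmx); rewrite trmxK trmx0 => ->.
by rewrite -trmx_mul h trmx0.
Qed.
End ConjTranspose.

(** * The determinant that detects the Maslov cycle *)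

Section DetPath.
Variables (R : realType) (n : nat).
Local Notation C := (Cplx R).
Local Notation mat := 'M[Cplx R]_(n + n).
Local Notation J := (stdJ R n).
Local Notation Sp := (@Sp R n).

Lemma stdJ_sqr : J *m J = - 1%:M.
Proof.
rewrite /stdJ mulmx_block !mul0mx !mulmx0 !add0r !addr0 mulNmx mulmxN !mul1mx.
by rewrite [in RHS]scalar_mx_block opp_block_mx !oppr0.
Qed.

Lemma dg_stdJ : dg J = - J.
Proof.
rewrite /dg /stdJ map_block_mx tr_block_mx opp_block_mx !map_mx0 !trmx0 !oppr0 opprK.
by rewrite map_mxN map_mx1 linearN /= trmx1.
Qed.

(** The factor i makes the form Hermitian and an involution, so that its invariance under M can be
    compared with squared norms. *)
Definition KJ : mat := iC R *: J.

Lemma KJ_sqr : KJ *m KJ = 1%:M.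
Proof. by rewrite /KJ -scalemxAl -scalemxAr scalerA iC2 stdJ_sqr scaleN1r opprK. Qed.

Lemma dg_KJ : dg KJ = KJ.
Proof. by rewrite /KJ dgZ conj_iC dg_stdJ scaleNr scalerN opprK. Qed.

(* For [M] in [Sp] this vanishes exactly at the points with [s = 0] and [M] in the cycle, so that
   intersections with the cycle become zeros of a map from the plane to the plane. *)
Definition detP (M : mat) (s : R) : C :=
  \det (M - 1%:M + toC s *: ((M + 1%:M) *m KJ)).

Lemma detP0 M : detP M 0 = \det (M - 1%:M).
Proof. by rewrite /detP rmorph0 scale0r addr0. Qed.

Lemma Sp_KJ M : Sp M -> dg M *m KJ *m M = KJ.
Proof. by move=> [_ h]; rewrite /KJ -scalemxAr -scalemxAl; congr (_ *: _). Qed.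

(* If [M (1 + s K) x = (1 - s K) x], invariance of the form [K] gives
   [4 s |x|^2 = 0]. *)
Lemma detP_neq0 M s : Sp M -> s != 0 -> detP M s != 0.
Proof.
move=> /Sp_KJ MK s0; apply/eqP => /det_rcol[x x0].
pose y := KJ *m x; set c := toC s.
have Ky : KJ *m y = x by rewrite /y mulmxA KJ_sqr mul1mx.
have yy : dg y *m y = dg x *m x.
  by rewrite /y dgM dg_KJ mulmxA -[_ *m KJ *m KJ]mulmxA KJ_sqr mulmx1.
rewrite mulmxDl mulmxBl mul1mx -scalemxAl -mulmxA mulmxDl mul1mx -/y => h.
have {}h : M *m (x + c *: y) = x - c *: y.
  apply/eqP; rewrite -subr_eq0 -h mulmxDr -scalemxAr scalerDr opprB.
  by apply/eqP/colP => i; rewrite !mxE; ring.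
have : dg (M *m (x + c *: y)) *m KJ *m (M *m (x + c *: y))
     = dg (x - c *: y) *m KJ *m (x - c *: y) by rewrite h.
rewrite dgM -!mulmxA [KJ *m (M *m _)]mulmxA [dg M *m _]mulmxA [dg M *m _]mulmxA MK.
rewrite !mulmxDr !mulmxN -!scalemxAr -/y Ky !dgD dgN !dgZ !conj_toC.
rewrite !mulmxDl !mulNmx -!scalemxAl yy -/c => e.
have {e} e : (c * 4) *: (dg x *m x) = 0.
  move: (dg x *m y) (dg x *m x) (dg y *m x) e => u v w /eqP.
  rewrite -subr_eq0 => /eqP <-.
  by apply/matrixP => i j; rewrite !mxE; ring.
move: e => /eqP; rewrite scaler_eq0 mulf_eq0 toC_eq0 (negbTE s0) pnatr_eq0 /= => /eqP.
by move=> /dgxx_eq0 z; rewrite z eqxx in x0.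
Qed.

Lemma detP_neq0_nondeg M s : Sp M -> \det (M - 1%:M) != 0 -> detP M s != 0.
Proof.
by move=> sM d; case: (eqVneq s 0) => [->|s0]; [rewrite detP0|exact: detP_neq0].
Qed.

Lemma maslov_cycleP M : maslov_cycle M <-> Sp M /\ \det (M - 1%:M) = 0.
Proof.
split=> [[k /= k1 [sM rk]]|[sM dM]].
  split=> //; rewrite -det_tr; apply/eqP; apply: contraTT k1 => d.
  rewrite -leqNgt -ltnS -rk ltnS mxrank_ker leqn0 subn_eq0.
  by rewrite (mxrank_unit (_ : _ \in unitmx)) // unitmxE unitfE.
exists (\rank (kermx (M - 1%:M)^T)) => //=; rewrite mxrank_ker subn_gt0.
rewrite ltn_neqAle rank_leq_row andbT -/(row_free _) row_free_unit unitmxE unitfE det_tr dM.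
by rewrite eqxx.
Qed.
End DetPath.

(** * First-order expansion of determinants *)

Section DetExpansion.
Variable R : realType.
Local Notation C := (Cplx R).
Variable N : nat.
Implicit Types B E U V : 'M[C]_N.

(** Interpolates between B and B + E one row at a time; the determinant then telescopes into
    single-row changes, each linear in E. *)
Definition mixrows B E (k : nat) : 'M[C]_N :=
  \matrix_(i, j) (B i j + (if (i < k)%N then E i j else 0)).

Lemma det_mixrowsS B E (i : 'I_N) :
  \det (mixrows B E i.+1) - \det (mixrows B E i) =
  \sum_j E i j * cofactor (mixrows B E i) i j.
Proof.
rewrite (expand_det_row (mixrows B E i.+1) i) (expand_det_row (mixrows B E i) i) -sumrB.
apply: eq_bigr => j _.
have -> : cofactor (mixrows B E i.+1) i j = cofactor (mixrows B E i) i j.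
  rewrite /cofactor; congr (_ * \det _); apply/matrixP => k l; rewrite !mxE.
  by rewrite ltnS leq_eqVlt (inj_eq val_inj) eq_sym (negbTE (neq_lift _ _)).
by rewrite -mulrBl !mxE ltnSn ltnn addr0 addrAC subrr add0r.
Qed.

Lemma det_addE B E :
  \det (B + E) = \det B + \sum_i \sum_j E i j * cofactor (mixrows B E i) i j.
Proof.
rewrite -(eq_bigr _ (fun i _ => det_mixrowsS B E i)).
rewrite -(big_mkord xpredT (fun i => \det (mixrows B E i.+1) - \det (mixrows B E i))).
rewrite telescope_sumr//.
have -> : mixrows B E 0 = B by apply/matrixP => i j; rewrite !mxE addr0.
have -> : mixrows B E N = B + E by apply/matrixP => i j; rewrite !mxE ltn_ord.
by rewrite [RHS]addrC subrK.
Qed.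

(** Jacobi's formula in two directions at once. It is an exact identity whose coefficients converge,
    so it can later be divided by the linear model without estimating a remainder. *)
Lemma det_expansion (T : Type) (F : set_system T) (FF : Filter F) (B U0 V0 : 'M[C]_N)
    (al be : T -> C) (U V : T -> 'M[C]_N) :
  U @ F --> U0 -> V @ F --> V0 -> al @ F --> (0 : C) -> be @ F --> (0 : C) ->
  exists u v : T -> C,
  [/\ forall x, \det (B + (al x *: U x + be x *: V x)) = \det B + (al x * u x + be x * v x),
      u @ F --> \tr (\adj B *m U0) & v @ F --> \tr (\adj B *m V0)].
Proof.
move=> cU cV cal cbe; pose E x := al x *: U x + be x *: V x.
pose w (W : T -> 'M[C]_N) x := \sum_i \sum_j W x i j * cofactor (mixrows B (E x) i) i j.
have cU' := (cvg_mxP _ _ _).1 cU; have cV' := (cvg_mxP _ _ _).1 cV.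
have cE i j : (fun x => E x i j) @ F --> (0 : C).
  have -> : (fun x => E x i j) = (fun x => al x * U x i j + be x * V x i j).
    by apply/funext => x; rewrite !mxE.
  have : (fun x => al x * U x i j + be x * V x i j) @ F --> 0 * U0 i j + 0 * V0 i j.
    by apply: cvgD; apply: cvgM; [exact: cal|exact: cU'|exact: cbe|exact: cV'].
  by rewrite !mul0r addr0.
have cmix k : (fun x => mixrows B (E x) k) @ F --> B.
  apply/cvg_mxP => i j.
  have -> : (fun x => mixrows B (E x) k i j) =
      (fun x => B i j + (if (i < k)%N then E x i j else 0)).
    by apply/funext => x; rewrite !mxE.
  have : (fun x => B i j + (if (i < k)%N then E x i j else 0)) @ F --> B i j + 0.
    by apply: cvgD; [exact: cvg_cst|case: (i < k)%N; [exact: cE|exact: cvg_cst]].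
  by rewrite addr0.
have cw (W : T -> 'M[C]_N) (W0 : 'M[C]_N) : W @ F --> W0 -> w W @ F --> \tr (\adj B *m W0).
  move=> /cvg_mxP cW.
  have -> : \tr (\adj B *m W0) = \sum_i \sum_j W0 i j * cofactor B i j.
    rewrite mxtrace_mulC; apply: eq_bigr => i _; rewrite !mxE.
    by apply: eq_bigr => j _; rewrite /adjugate [X in _ * X]mxE.
  apply: cvg_big => [|i _]; first exact: add_continuous.
  apply: cvg_big => [|j _]; first exact: add_continuous.
  have H : (fun x => cofactor (mixrows B (E x) i) i j) @ F --> cofactor B i j.
    by apply: cvg_cofactor; exact: cmix.
  by apply: cvgM; [exact: (cW i j)|exact: H].
exists (w U), (w V); split; [move=> x|exact: cw|exact: cw].
rewrite det_addE; congr (_ + _); rewrite !mulr_sumr -big_split.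
apply: eq_bigr => i _ /=; rewrite !mulr_sumr -big_split.
by apply: eq_bigr => j _ /=; rewrite -/(E x) 3!mxE; ring.
Qed.

(** One block matrix is factored in two ways, through either of its Schur complements. *)
Lemma det_1Drank1 (p : 'cV[C]_N) (q : 'rV[C]_N) : \det (1%:M + p *m q) = 1 + (q *m p) 0 0.
Proof.
have e1 : block_mx 1%:M (- p) q 1%:M =
    block_mx 1%:M 0 q 1%:M *m block_mx 1%:M (- p) 0 (1%:M + q *m p) :> 'M[C]_(N + 1).
  rewrite mulmx_block ?mul1mx ?mulmx1 ?mul0mx ?mulmx0 ?addr0 ?add0r mulmxN.
  by congr block_mx; rewrite addrC addrK.
have e2 : block_mx 1%:M (- p) q 1%:M =
    block_mx (1%:M + p *m q) (- p) 0 1%:M *m block_mx 1%:M 0 q 1%:M :> 'M[C]_(N + 1).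
  rewrite mulmx_block ?mul1mx ?mulmx1 ?mul0mx ?mulmx0 ?addr0 ?add0r mulNmx.
  by congr block_mx; rewrite addrK.
have := congr1 (@determinant _ _) e1; rewrite e2 !det_mulmx !det_lblock !det_ublock !det1 !mul1r !mulr1.
by move=> ->; rewrite det_mx11 !mxE.
Qed.

(* If [det B = 0] and a rank-one perturbation of [B] is invertible, then
   [det (B + s p q) = s det (B + p q)], so the derivative [tr (adj B p q)] is
   nonzero. *)
Lemma adj_neq0 B (v : 'cV[C]_N) (q : 'cV[C]_N) : v != 0 -> B *m v = 0 ->
  \det (B + q *m dg v) != 0 -> \adj B != 0.
Proof.
move=> v0 Bv d0; apply/eqP => adj0.
have nv : (dg v *m v) 0 0 != 0.
  apply: contra v0 => /eqP h; apply/eqP/dgxx_eq0.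
  by apply/matrixP => i j; rewrite !ord1 h mxE.
set E := q *m dg v in d0; set c := (dg v *m v) 0 0 in nv.
have vv : dg v *m v = c%:M by apply/matrixP => i j; rewrite !ord1 [RHS]mxE eqxx mulr1n.
have scale s : \det (B + s *: E) = s * \det (B + E).
  have -> : B + s *: E = (B + E) *m (1%:M + (((s - 1) / c) *: v) *m dg v).
    rewrite mulmxDr mulmx1 mulmxDl -scalemxAl -scalemxAr [B *m _]mulmxA Bv mul0mx scaler0 add0r.
    rewrite -scalemxAr {2}/E -mulmxA [dg v *m _]mulmxA vv mul_scalar_mx -scalemxAr -/E scalerA.
    by rewrite divfK// scalerBl scale1r -addrA [E + _]addrC subrK.
  rewrite det_mulmx det_1Drank1 mulrC -scalemxAr vv mxE !mxE eqxx mulr1n divfK// [1 + _]addrC subrK.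
  by [].
have dB : \det B = 0 by have := scale 0; rewrite scale0r addr0 mul0r.
have idc : (@toC R) @ (0 : R)^' --> (0 : C).
  have : (@toC R \o id) @ (0 : R)^' --> toC (0 : R).
    by apply: cvg_toC; apply: cvg_within_filter; exact: cvg_id.
  by rewrite (rmorph0 (@toC R)).
have [u [v' [h cu _]]] := @det_expansion _ (0 : R)^' _ B E 0 (@toC R) (fun=> 0) (fun=> E) (fun=> 0)
  (cvg_cst _) (cvg_cst _) idc (cvg_cst _).
have : u @ (0 : R)^' --> \det (B + E).
  apply: cvg_trans (near_eq_cvg _) (cvg_cst (\det (B + E))).
  near=> s; have s0 : toC s != 0 by rewrite toC_eq0; near: s; exact: nbhs_dnbhs_neq.
  apply: (mulfI s0); have := h s; rewrite scale0r addr0 scale dB mul0r addr0 add0r.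
  by move=> ->.
have H := cu; rewrite adj0 mul0mx mxtrace0 in H.
move=> H'; have := cvg_unique (@norm_hausdorff _ C) H H' => e.
by rewrite -e eqxx in d0.
Unshelve. all: by end_near. Qed.
End DetExpansion.

(** * The functional that detects the tangent hyperplane *)

Section Crossings.
Variables (R : realType) (n : nat).
Local Notation C := (Cplx R).
Local Notation mat := 'M[Cplx R]_(n + n).
Local Notation J := (stdJ R n).
Local Notation Sp := (@Sp R n).

Lemma kernel_Sp1 (M : mat) : Sp_ 1 M -> exists v : 'cV[C]_(n + n),
  [/\ v != 0, (M - 1%:M) *m v = 0 & forall x, (M - 1%:M) *m x = 0 -> exists c, x = c *: v].
Proof.
move=> [_ rk]; set B := M - 1%:M in rk *.
have rk0 : kermx B^T != 0 by rewrite -mxrank_eq0 rk.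
have [i ri] : exists i, row i (kermx B^T) != 0.
  apply/existsP; apply: contra_neqT rk0 => /existsPn h.
  by apply/row_matrixP => i; rewrite row0; apply/eqP; have := h i; rewrite negbK.
set r := row i _ in ri.
have rker : (r <= kermx B^T)%MS by exact: row_sub.
have kr : (kermx B^T <= r)%MS.
  by have := mxrank_leqif_sup rker; rewrite rank_rV ri rk => /leqifP; case: (_ <= _)%MS.
exists r^T; split.
- by apply: contra ri => /eqP/(congr1 trmx); rewrite trmxK trmx0 => ->.
- by apply: trmx_inj; rewrite trmx_mul trmxK trmx0; exact/sub_kermxP.
- move=> x Bx; have : (x^T <= r)%MS.
    by apply: submx_trans kr; apply/sub_kermxP; rewrite -trmx_mul Bx trmx0.
  by move=> /sub_rVP[c e]; exists c; rewrite -[x]trmxK e linearZ.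
Qed.

(** Invariance of J turns right fixed vectors of M into left ones, and [fix_row_Sp] goes back; so
    when the right kernel of M - 1 is a line, the left kernel is the corresponding line. *)
Lemma Sp_fix_row (M : mat) (v : 'cV[C]_(n + n)) : Sp M -> (M - 1%:M) *m v = 0 ->
  dg v *m J *m (M - 1%:M) = 0.
Proof.
move=> [_ MJ] /eqP; rewrite mulmxBl mul1mx subr_eq0 => /eqP Mv.
have e : dg v *m J *m M = dg v *m J.
  by rewrite -{1}Mv dgM -!mulmxA [_ *m (_ *m M)]mulmxA MJ.
by rewrite mulmxBr mulmx1 e subrr.
Qed.

Lemma row_JJ (z : 'rV[C]_(n + n)) : z *m J *m J = - z.
Proof. by rewrite -mulmxA stdJ_sqr mulmxN mulmx1. Qed.

Lemma fix_row_Sp (M : mat) (r : 'rV[C]_(n + n)) : Sp M -> r *m (M - 1%:M) = 0 ->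
  (M - 1%:M) *m dg (- (r *m J)) = 0.
Proof.
move=> [uM MJ] /eqP; rewrite mulmxBr mulmx1 subr_eq0 => /eqP rM.
pose y := - (r *m J).
have yJ : y *m J = r by rewrite /y mulNmx row_JJ opprK.
have h : y *m dagger M *m J *m M = y *m J *m M.
  by rewrite yJ rM -yJ -2!mulmxA [dagger M *m _]mulmxA MJ.
have {}h : y *m dagger M *m J = y *m J.
  by rewrite -[LHS](mulmxK uM) h mulmxK.
have {}h : y *m dagger M = y.
  by rewrite -[LHS]opprK -(row_JJ (y *m dagger M)) h row_JJ opprK.
have e : M *m dg y = dg y by rewrite -{2}h dgM /dagger -/(dg M) dgK.
by rewrite -/y mulmxBl mul1mx e subrr.
Qed.

Lemma norm_col m (v : 'cV[C]_m) : v != 0 -> exists2 d : C, d != 0 & dg v *m v = d%:M.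
Proof.
move=> v0; exists ((dg v *m v) 0 0).
  apply: contra v0 => /eqP h; apply/eqP/dgxx_eq0.
  by apply/matrixP => i j; rewrite !ord1 h mxE.
by apply/matrixP => i j; rewrite !ord1 [RHS]mxE eqxx mulr1n.
Qed.

(* Both kernels of [M - 1] are lines, so [adj (M - 1) = c v v^* J]. *)
Lemma kappa_neq0 (M : mat) : Sp_ 1 M -> \tr (\adj (M - 1%:M) *m J) != 0.
Proof.
move=> M1; have [v [v0 Bv ker]] := kernel_Sp1 M1; have [sM _] := M1.
set B := M - 1%:M in Bv ker *.
have vJB := Sp_fix_row sM Bv; rewrite -/B in vJB.
have [d d0 vv] := norm_col v0.
have dB : \det B = 0 by exact: det_rcolP Bv.
have adj0 : \adj B != 0.
  (* The column J v lies outside the image of B: the row [dg v *m J] kills that image but pairs with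
     - J v to the squared norm of v. *)
  apply: (adj_neq0 v0 Bv (q := - (J *m v))); apply/eqP => /det_rcol[x x0].
  rewrite mulmxDl => h.
  have vx : dg v *m x = 0.
    have := congr1 (mulmx (dg v *m J)) h; rewrite mulmx0 mulmxDr mulmxA vJB mul0mx add0r.
    rewrite !mulNmx mulmxN -!mulmxA [J *m (J *m _)]mulmxA stdJ_sqr mulNmx mul1mx mulmxN opprK.
    rewrite mulmxA vv mul_scalar_mx => /eqP; rewrite scaler_eq0 (negbTE d0) => /eqP.
    exact.
  move: h; rewrite -mulmxA vx mulmx0 addr0 => /ker[c xc].
  move: vx; rewrite xc -scalemxAr vv => /matrixP/(_ 0 0).
  rewrite !mxE eqxx mulr1n => /eqP; rewrite mulf_eq0 (negbTE d0) orbF => /eqP c0.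
  by rewrite xc c0 scale0r eqxx in x0.
have [r rE] : exists r : 'rV[C]_(n + n), \adj B = v *m r.
  have /submxP[D DE] : ((\adj B)^T <= v^T)%MS.
    apply/row_subP => i; apply/sub_rVP.
    have [|c ec] := ker ((row i (\adj B)^T)^T).
      by rewrite tr_row trmxK colE mulmxA mul_mx_adj dB raddf0 mul0mx.
    by exists c; rewrite -[LHS]trmxK ec linearZ.
  by exists D^T; rewrite -[LHS]trmxK DE trmx_mul trmxK.
have rB : r *m B = 0.
  have : v *m (r *m B) = 0 by rewrite mulmxA -rE mul_adj_mx dB raddf0.
  move=> /(congr1 (mulmx (dg v))); rewrite mulmx0 mulmxA vv mul_scalar_mx => /eqP.
  by rewrite scaler_eq0 (negbTE d0) => /eqP.
have [c yc] := ker _ (fix_row_Sp sM rB).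
have rJ : r *m J = - (Num.conj c *: dg v).
  by rewrite -dgZ -yc dgK opprK.
have c0 : c != 0.
  apply: contra adj0 => /eqP c0; apply/eqP; rewrite rE -[r]opprK -(row_JJ r) rJ c0 rmorph0.
  by rewrite scale0r oppr0 mul0mx oppr0 mulmx0.
rewrite rE -mulmxA mxtrace_mulC rJ mulNmx -scalemxAl vv linearN linearZ /= mxtrace_scalar.
by rewrite mulr1n oppr_eq0 mulf_neq0// fmorph_eq0.
Qed.

(** Giving the quotient the value X at h = 0 replaces a punctured limit by an exact identity with a
    factor continuous at 0, which composes well. *)
Lemma velocityP (g : R -> mat) (t : R) (X : mat) : velocity g t X <->
  exists2 rho : R -> mat, (forall h, g (t + h) = g t + toC h *: rho h) & rho @ (0 : R) --> X.
Proof.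
split=> [gX|[rho grho rX]].
  exists (fun h => if h == 0 then X else toC h^-1 *: (g (t + h) - g t)).
    move=> h; case: eqP => [->|/eqP h0]; first by rewrite addr0 rmorph0 scale0r addr0.
    by rewrite scalerA -rmorphM mulfV// rmorph1 scale1r [RHS]addrC subrK.
  move=> U XU; have H : nbhs (0 : R) (fun h => h != 0 -> U (toC h^-1 *: (g (t + h) - g t))) := gX U XU.
  have HU := nbhs_singleton XU.
  suff : nbhs (0 : R) (fun h => U (if h == 0 then X else toC h^-1 *: (g (t + h) - g t))) by [].
  by apply: filterS H => h hU; case: eqP => [//|/eqP/hU].
move=> U /rX HU; have {}HU : nbhs (0 : R) (fun h => U (rho h)) := HU.
suff : nbhs (0 : R) (fun h => h != 0 -> U (toC h^-1 *: (g (t + h) - g t))) by [].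
apply: filterS HU => h hU h0; rewrite grho [g t + _]addrC addrK scalerA -rmorphM mulVf// rmorph1.
by rewrite scale1r.
Qed.

Lemma cvg_bounded_mul0 (T : Type) (F : set_system T) (FF : Filter F) (b w : T -> C) (c : R) :
  0 < c -> (\forall x \near F, `|b x| <= toC c) -> w @ F --> (0 : C) ->
  (fun x => b x * w x) @ F --> (0 : C).
Proof.
move=> c0 bc /cvgrPdist_lt w0; apply/cvgrPdist_lt => e e0.
have ce : 0 < e / toC c by rewrite divr_gt0// -(rmorph0 (@toC R)) toC_lt.
have := w0 _ ce; move: bc; apply: filterS2 => x bx wx.
rewrite sub0r normrN normrM; rewrite sub0r normrN in wx.
have c0' : 0 < toC c by rewrite -(rmorph0 (@toC R)) toC_lt.
apply: le_lt_trans (ler_wpM2r (normr_ge0 _) bx) _.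
by rewrite mulrC -ltr_pdivlMr.
Qed.

(** The determinant of c s - 1 is identically 0 along a curve in [Sp_ 1], so its derivative, given
    by Jacobi's formula, vanishes. *)
Lemma tangent_tr (M Y : mat) : tangent_Sp1 M Y -> \tr (\adj (M - 1%:M) *m Y) = 0.
Proof.
move=> [c [cs c0 /velocityP[rho crho rY]]].
have idc : @toC R @ (0 : R)^' --> (0 : C).
  have : (@toC R \o id) @ (0 : R)^' --> toC (0 : R).
    by apply: cvg_toC; apply: cvg_within_filter; exact: cvg_id.
  by rewrite (rmorph0 (@toC R)).
have rY' : rho @ (0 : R)^' --> Y by apply: cvg_within_filter.
have [u [v' [h cu _]]] := @det_expansion _ _ _ (0 : R)^' _ (M - 1%:M) Y 0 (@toC R) (fun=> 0)
  rho (fun=> 0) rY' (cvg_cst _) idc (cvg_cst _).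
have dc s : \det (c s - 1%:M) = 0.
  by apply: (iffLR (maslov_cycleP _) _).2; exists 1%N => //; exact: cs.
apply: (cvg_unique (@norm_hausdorff _ C) cu).
apply: cvg_trans (near_eq_cvg _) (cvg_cst (0 : C)).
near=> s; have s0 : toC s != 0 by rewrite toC_eq0; near: s; exact: nbhs_dnbhs_neq.
apply: (mulfI s0); rewrite mulr0; have := h s; rewrite scale0r addr0 mul0r addr0.
have -> : M - 1%:M + toC s *: rho s = c s - 1%:M.
  by rewrite -c0 addrAC -crho add0r.
by rewrite dc -c0 dc add0r => <-.
Unshelve. all: by end_near. Qed.
End Crossings.

(** * Intersection numbers as winding numbers *)

Section IntersectionNumber.
Variables (R : realType) (n : nat).
Local Notation C := (Cplx R).
Local Notation mat := 'M[Cplx R]_(n + n).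
Local Notation J := (stdJ R n).
Local Notation Sp := (@Sp R n).

Lemma cvg_detP (T : Type) (F : set_system T) (FF : Filter F) (M : T -> mat) (s : T -> R) (M0 : mat) (s0 : R) :
  M @ F --> M0 -> s @ F --> s0 -> (fun x => detP (M x) (s x)) @ F --> detP M0 s0.
Proof.
move=> cM cs; apply: cvg_det; apply: cvgD; first by apply: cvgB; [exact: cM|exact: cvg_cst].
have c1 : (fun x => (M x + 1%:M) *m KJ R n) @ F --> (M0 + 1%:M) *m KJ R n.
  by apply: cvg_mulmx; [apply: cvgD; [exact: cM|exact: cvg_cst]|exact: cvg_cst].
apply/cvg_mxP => i j; have := cvgM (cvg_toC FF cs) ((cvg_mxP FF _ _).1 c1 i j).
rewrite [X in _ -> _ --> X]mxE.
have -> : (fun x => (toC (s x) *: ((M x + 1%:M) *m KJ R n)) i j) =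
    (fun x => toC (s x) * ((M x + 1%:M) *m KJ R n) i j).
  by apply/funext => x; rewrite mxE.
exact.
Qed.

(** Both coordinates are of the order of [lin], so errors in the coefficients of the expansion that
    tend to 0 still do so after division by [lin]. *)
Lemma lin_bounds (a t0 : R) (p : R * R) : a != 0 -> p != (t0, 0) ->
  `|toC (p.1 - t0) / lin a t0 p| <= toC `|a|^-1 /\ `|toC p.2 / lin a t0 p| <= toC 1.
Proof.
move=> a0 pt; have l0 : lin a t0 p != 0 by apply: contra_neq pt; exact: lin_eq0.
have ln : 0 < `|lin a t0 p| by rewrite normr_gt0.
have h1 := norm_reC (lin a t0 p); have h2 := norm_imC (lin a t0 p).
rewrite /lin reC_comb -/(lin a t0 p) in h1; rewrite /lin imC_comb -/(lin a t0 p) in h2.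
have a1 : 0 < toC `|a|^-1 by rewrite -(rmorph0 (@toC R)) toC_lt invr_gt0 normr_gt0.
split; rewrite normrM normfV norm_toC ler_pdivrMr//.
  apply: le_trans (ler_wpM2l (ltW a1) h1).
  by rewrite -rmorphM toC_le normrM mulKf// normr_eq0.
apply: le_trans (le_trans _ h2) _; last by rewrite rmorph1 mul1r.
by rewrite toC_le normrM ger0_norm// ler_peMl// ler1n.
Qed.

(** Here kap = tr (adj B J) with B = g t0 - 1. As adj B (g t0) = adj B, the coefficient of t - t0
    tends to a kap and that of s to 2 i kap; this is the origin of the 2 in [lin]. *)
Lemma crossing_simple_zero (L : R) (g : R -> mat) (t0 : R) (e : int) : crossing g t0 e ->
  exists a kap, [/\ a != 0, e = sgz a, kap != 0 &
    (fun p => detP (g p.1) p.2 / lin a t0 p) @ within (rect L) ((t0, 0)^') --> (kap : C)].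
Proof.
move=> [a [Y [M1 tY /velocityP[rho grho crho] a0 ->]]].
exists a, (\tr (\adj (g t0 - 1%:M) *m J)).
have k0 := kappa_neq0 M1; split => //.
set B := g t0 - 1%:M in k0 *; set kap := \tr _ in k0 *.
have dB : \det B = 0 by apply: (iffLR (maslov_cycleP _) _).2; exists 1%N.
set F := within _ _; have FF : Filter F by exact: within_filter.
have c1 : (fun p : R * R => p.1 - t0) @ F --> (0 : R).
  rewrite -(subrr t0); apply: cvgB; last exact: cvg_cst.
  by do 2!apply: cvg_within_filter; exact: cvg_fst.
have c2 : (fun p : R * R => p.2) @ F --> (0 : R).
  by do 2!apply: cvg_within_filter; exact: cvg_snd.
have cU : (fun p : R * R => rho (p.1 - t0)) @ F --> toC a *: (g t0 *m J) + Y.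
  by apply: cvg_comp crho; exact: c1.
have ctc := cvg_toC FF c1.
have cg : (fun p : R * R => g p.1) @ F --> g t0.
  have : (fun p : R * R => g t0 + toC (p.1 - t0) *: rho (p.1 - t0)) @ F -->
      g t0 + toC (0 : R) *: (toC a *: (g t0 *m J) + Y).
    apply: cvgD; first exact: cvg_cst.
    by apply: cvgZ; [exact: ctc|exact: cU].
  rewrite rmorph0 scale0r addr0; apply: cvg_trans; apply: near_eq_cvg.
  by apply: nearW => p; rewrite -grho addrC subrK.
have cV : (fun p : R * R => (g p.1 + 1%:M) *m KJ R n) @ F --> (g t0 + 1%:M) *m KJ R n.
  by apply: cvg_mulmx; [apply: cvgD; [exact: cg|exact: cvg_cst]|exact: cvg_cst].
have ctc2 : (fun p : R * R => toC p.2) @ F --> (0 : C).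
  by rewrite -(rmorph0 (@toC R)); exact: (cvg_toC FF c2).
have ctc1 : (fun p : R * R => toC (p.1 - t0)) @ F --> (0 : C).
  by rewrite -(rmorph0 (@toC R)).
have [u [v [h cu cv]]] := det_expansion FF B cU cV ctc1 ctc2.
have detPE p : detP (g p.1) p.2 = toC (p.1 - t0) * u p + toC p.2 * v p.
  rewrite -[RHS]add0r -dB -h /detP; congr (\det _).
  by rewrite addrA; congr (_ + _); rewrite /B addrAC -grho [t0 + _]addrC subrK.
have adjM : \adj B *m g t0 = \adj B.
  have := mul_adj_mx B; rewrite dB raddf0 /B mulmxBr mulmx1 => /eqP.
  by rewrite subr_eq0 => /eqP.
have eU : \tr (\adj B *m (toC a *: (g t0 *m J) + Y)) = toC a * kap.
  rewrite mulmxDr linearD /= (tangent_tr tY) addr0 -scalemxAr linearZ /= mulmxA adjM.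
  by [].
have eV : \tr (\adj B *m ((g t0 + 1%:M) *m KJ R n)) = iC R * toC 2 * kap.
  rewrite mulmxA mulmxDr mulmx1 adjM /KJ -scalemxAr linearZ /= mulmxDl linearD /= -/kap.
  by rewrite (rmorph_nat (@toC R)); ring.
rewrite eU in cu; rewrite eV in cv.
have {}cu : (fun p => u p - toC a * kap) @ F --> (0 : C).
  by rewrite -(subrr (toC a * kap)); apply: cvgB; [exact: cu|exact: cvg_cst].
have {}cv : (fun p => v p - iC R * toC 2 * kap) @ F --> (0 : C).
  by rewrite -(subrr (iC R * toC 2 * kap)); apply: cvgB; [exact: cv|exact: cvg_cst].
have nF : \forall p \near F, p != (t0, 0).
  suff : nbhs (t0, 0 : R) (fun p : R * R => p != (t0, 0) -> rect L p -> p != (t0, 0)) by [].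
  by apply: filterE => p.
have b1 : \forall p \near F, `|toC (p.1 - t0) / lin a t0 p| <= toC `|a|^-1.
  by apply: filterS nF => p /(lin_bounds a0)[].
have b2 : \forall p \near F, `|toC p.2 / lin a t0 p| <= toC 1.
  by apply: filterS nF => p /(lin_bounds a0)[].
have ainv : 0 < `|a|^-1 by rewrite invr_gt0 normr_gt0.
have H1 := cvg_bounded_mul0 FF ainv b1 cu.
have H2 := cvg_bounded_mul0 FF ltr01 b2 cv.
have : (fun p => kap + (toC (p.1 - t0) / lin a t0 p * (u p - toC a * kap)
    + toC p.2 / lin a t0 p * (v p - iC R * toC 2 * kap))) @ F --> kap + (0 + 0).
  by apply: cvgD; [exact: cvg_cst|apply: cvgD; [exact: H1|exact: H2]].
rewrite !addr0; apply: cvg_trans; apply: near_eq_cvg; apply: filterS nF => p pt.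
have l0 : lin a t0 p != 0 by apply: contra_neq pt; exact: lin_eq0.
apply: (mulIf l0); rewrite detPE mulfVK//.
rewrite mulrDl mulrDl mulrAC (mulfVK l0) [X in _ + (_ + X)]mulrAC (mulfVK l0).
rewrite {1}/lin !rmorphM; ring.
Qed.
End IntersectionNumber.

Section IntersectionUniqueness.
Variables (R : realType) (n : nat).
Local Notation C := (Cplx R).
Local Notation mat := 'M[Cplx R]_(n + n).
Local Notation Sp := (@Sp R n).

(** Throughout the homotopy [detP] has no zero on the boundary: on the vertical sides the end-points
    are fixed and nondegenerate, on the horizontal ones s = 1 or s = -1. So the zeros counted for g'
    give the winding number for g. *)
Lemma intersection_wind (L : R) (g : R -> mat) (m : int) : 0 < L ->
  \det (g 0 - 1%:M) != 0 -> \det (g L - 1%:M) != 0 ->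
  is_intersection_number L g m -> wind L (fun p => detP (g p.1) p.2) m.
Proof.
move=> L0 d0 dL [g' [[H [/subspace_continuousP cH sH Ht Hs]] [s [e [us sP sc ->]]]]].
have I0 : (0 : R) \in `[0, 1] by rewrite in_itv/= lexx ler01.
have I1 : (1 : R) \in `[0, 1] by rewrite in_itv/= lexx ler01.
have J0 : (0 : R) \in `[0, L] by rewrite in_itv/= lexx ltW.
have JL : L \in `[0, L] by rewrite in_itv/= lexx ltW.
have g'0 : g' 0 = g 0 by rewrite -(Ht 0 J0).2 (Hs 1 I1).1.
have g'L : g' L = g L by rewrite -(Ht L JL).2 (Hs 1 I1).2.
have bdJ p : rect_bd L p -> p.1 \in `[0, L] by move=> /(rect_bd_sub (ltW L0))[].
have sH1 t : t \in `[0, L] -> Sp (g' t).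
  by move=> tL; rewrite -(Ht t tL).2; apply: sH; split.
have w1 : wind L (fun p => detP (g' p.1) p.2) (\sum_(t <- s) e t).
  have /choice[ak akP] : forall t, exists ak : R * C, t \in s ->
      [/\ ak.1 != 0, e t = sgz ak.1, ak.2 != 0 &
       (fun p => detP (g' p.1) p.2 / lin ak.1 t p) @ within (rect L) ((t, 0)^') --> ak.2].
    move=> t; have [ts|_] := boolP (t \in s); last by exists (0, 0).
    by have [a [k hk]] := crossing_simple_zero L (sc t ts); exists (a, k).
  have -> : \sum_(t <- s) e t = \sum_(t <- s) sgz (ak t).1.
    by rewrite big_seq [RHS]big_seq; apply: eq_bigr => t /akP[].
  apply: (@wind_zeros _ _ _ (fun t => (ak t).1) _ (fun t => (ak t).2)) => //.
  - move=> t ts; have [a0 _ k0 _] := akP t ts; split => //.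
    have [tL /maslov_cycleP[_ dt]] := (sP t).1 ts.
    move: tL; rewrite in_itv/= !le_eqVlt => /andP[/orP[/eqP t0|->] /orP[/eqP tL|->]] //.
    + by rewrite -t0 g'0 in dt; rewrite dt eqxx in d0.
    + by rewrite -t0 g'0 in dt; rewrite dt eqxx in d0.
    + by rewrite tL g'L in dt; rewrite dt eqxx in dL.
  - apply/subspace_continuousP => p [/= p1 p2].
    have H1 : (fun q : R * R => H (1, q.1)) @ within (rect L) (nbhs p) --> H (1, p.1).
      apply: (@cvg_within_pull _ _ _ (fun q : R * R => (1 : R, q.1)) H (rect L) (`[0, 1]%classic `*` `[0, L]%classic) p (H (1, p.1)) _ _ (cH (1, p.1) _)) => //.
        by apply: cvg_pair_fun; [exact: cvg_cst|exact: cvg_fst].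
      by move=> u [/= u1 _].
    have H2 : (fun q : R * R => detP (H (1, q.1)) q.2) @ within (rect L) (nbhs p) --> detP (H (1, p.1)) p.2.
      by apply: cvg_detP; [exact: H1|apply: cvg_within_filter; exact: cvg_snd].
    rewrite /from_subspace -(Ht p.1 p1).2 => U hU.
    have H3 : nbhs p (fun q : R * R => rect L q -> U (detP (H (1, q.1)) q.2)) := H2 U hU.
    suff : nbhs p (fun q : R * R => rect L q -> U (detP (g' q.1) q.2)) by [].
    apply: filterS H3 => q hq rq; have [q1 _] := rq.
    by rewrite -(Ht q.1 q1).2; exact: hq.
  - move=> [t u] [/= tL _]; split=> [du|[t' t's [-> ->]]].
      have u0 : u = 0 by apply/eqP; apply: contra_eqT du => u0; apply: detP_neq0 => //; exact: sH1.
      exists t; last by rewrite u0.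
      by apply/sP; split=> //; apply/maslov_cycleP; split; [exact: sH1|rewrite -detP0 -u0].
    by rewrite detP0; have [_ /maslov_cycleP[]] := (sP t').1 t's.
  - by move=> t /akP[].
pose F (q : R * (R * R)) := detP (H (q.1, q.2.1)) q.2.2.
have : wind L (fun p => F (0, p)) (\sum_(t <- s) e t).
  apply: wind_sym.
  - apply/subspace_continuousP => -[u p] [/= uI bp].
    have H1 : (fun q : R * (R * R) => H (q.1, q.2.1)) @ within (`[0, 1]%classic `*` rect_bd L) (nbhs (u, p)) --> H (u, p.1).
      apply: (@cvg_within_pull _ _ _ (fun q : R * (R * R) => (q.1, q.2.1)) H _ (`[0, 1]%classic `*` `[0, L]%classic) (u, p) (H (u, p.1)) _ _ (cH (u, p.1) _)) => //.
      + apply: cvg_pair_fun; first exact: cvg_fst.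
        by apply: (@cvg_comp _ _ _ snd fst); [exact: cvg_snd|exact: cvg_fst].
      + by move=> v [/= v1 v2]; split=> //; exact: bdJ.
      + by split=> //; exact: bdJ.
    apply: cvg_detP; first exact: H1.
    apply: cvg_within_filter.
    by apply: (@cvg_comp _ _ _ snd snd); exact: cvg_snd.
  - move=> u p uI bp; rewrite /F /=.
    have sHp : Sp (H (u, p.1)) by apply: sH; split=> //; exact: bdJ.
    move: (bp) => [[/= p1 _]|[/= _ p2]].
      apply: (detP_neq0_nondeg _ sHp).
      by case: p1 => ->; [rewrite (Hs u uI).1|rewrite (Hs u uI).2].
    apply: detP_neq0 => //; case: p2 => ->; first by rewrite oppr_eq0 oner_eq0.
    by rewrite oner_eq0.
  - apply: wind_eq w1 => p; rewrite inE => bp; rewrite /F /= (Ht p.1 _).2 //; exact: bdJ.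
apply: wind_eq => p; rewrite inE => bp; rewrite /F /= (Ht p.1 _).1 //; exact: bdJ.
Qed.

Lemma intersection_number_uniq (L : R) (g : R -> mat) (m : int) : 0 < L ->
  \det (g 0 - 1%:M) != 0 -> \det (g L - 1%:M) != 0 ->
  is_intersection_number L g m -> intersection_number L g = m.
Proof.
move=> L0 d0 dL gm; rewrite /intersection_number.
apply: (wind_uniq L0 _ (intersection_wind L0 d0 dL gm)).
apply: intersection_wind => //.
by apply: (@xgetPex _ _ [set m | is_intersection_number L g m]); exists m.
Qed.
End IntersectionUniqueness.

(** * The index of a path in a torus *)

Section Velocity.
Variables (R : realType) (n : nat).
Local Notation C := (Cplx R).
Local Notation mat := 'M[Cplx R]_(n + n).

Lemma velocity_near (f g : R -> mat) (t : R) (X : mat) :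
  (\forall s \near t, f s = g s) -> velocity f t X -> velocity g t X.
Proof.
move=> fg; have fgt : f t = g t by exact: nbhs_singleton fg.
apply: cvg_trans; apply: near_eq_cvg.
have H : nbhs (0 : R) (fun h => f (t + h) = g (t + h)).
  have : (fun h : R => t + h) @ (0 : R) --> t.
    rewrite -[X in _ --> X]addr0; apply: cvgD; [exact: cvg_cst|exact: cvg_id].
  by move=> /(_ _ fg).
suff : nbhs (0 : R) (fun h => h != 0 -> toC h^-1 *: (f (t + h) - f t) = toC h^-1 *: (g (t + h) - g t)) by [].
by apply: filterS H => h -> _; rewrite fgt.
Qed.

Lemma velocity_cst (A : mat) (t : R) : velocity (fun=> A) t 0.
Proof.
apply/velocityP; exists (fun=> 0); last exact: cvg_cst.
by move=> h; rewrite scaler0 addr0.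
Qed.

Lemma velocityM (f g : R -> mat) (t : R) (X Y : mat) : velocity f t X -> velocity g t Y ->
  velocity (fun s => f s *m g s) t (X *m g t + f t *m Y).
Proof.
move=> /velocityP[rf frf cf] /velocityP[rg grg cg]; apply/velocityP.
exists (fun h => rf h *m g (t + h) + f t *m rg h).
  move=> h; rewrite frf mulmxDl -scalemxAl {1}grg mulmxDr -scalemxAr scalerDr -addrA.
  by rewrite [in RHS](addrC (toC h *: (rf h *m _))).
have cgt : (fun h => g (t + h)) @ (0 : R) --> g t.
  have c0 : (fun h => toC h) @ (0 : R) --> toC (0 : R) by apply: (@cvg_toC _ _ _ _ id); exact: cvg_id.
  have : (fun h => g t + toC h *: rg h) @ (0 : R) --> g t + toC (0 : R) *: Y.
    by apply: cvgD; [exact: cvg_cst|apply: cvgZ; [exact: c0|exact: cg]].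
  rewrite rmorph0 scale0r addr0; apply: cvg_trans; apply: near_eq_cvg.
  by apply: nearW => h; rewrite -grg.
apply: cvgD; first by apply: cvg_mulmx; [exact: cf|exact: cgt].
by apply: cvg_mulmx; [exact: cvg_cst|exact: cg].
Qed.

(** A rational substitute for exp (2 A): it sends the Lie algebra of a form into its group, and s
    |-> [cayley] (s W / 2) has velocity W at 0. *)
Definition cayley (A : mat) : mat := invmx (1%:M - A) *m (1%:M + A).

Lemma cayley0 : cayley 0 = 1%:M.
Proof. by rewrite /cayley subr0 addr0 mulmx1 invmx1. Qed.

Lemma cayleyVK (A : mat) : 1%:M - A \in unitmx -> 1%:M + A \in unitmx ->
  cayley A *m cayley (- A) = 1%:M.
Proof.
by move=> u1 u2; rewrite /cayley opprK mulmxA (mulmxK u2) (mulVmx u1).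
Qed.

Lemma cvg_one_scale (W : mat) :
  (fun s : R => 1%:M - toC (s / 2) *: W) @ (0 : R) --> (1%:M : mat).
Proof.
have : (fun s : R => 1%:M - toC (s / 2) *: W) @ (0 : R) --> 1%:M - toC (0 / 2 : R) *: W.
  apply: cvgB; first exact: cvg_cst.
  apply: cvgZ; last exact: cvg_cst.
  by apply: (@cvg_toC _ _ _ _ (fun s => s / 2)); apply: cvgM; [exact: cvg_id|exact: cvg_cst].
by rewrite mul0r rmorph0 scale0r subr0.
Qed.

Lemma near_unit (T : Type) (F : set_system T) (FF : Filter F) (A : T -> mat) (A0 : mat) :
  A0 \in unitmx -> A @ F --> A0 -> \forall x \near F, A x \in unitmx.
Proof.
rewrite unitmxE unitfE => d0 cA; have H : F (fun x => \det (A x) != 0) by apply: (cvgr_neq0 _ (cvg_det FF cA) d0).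
apply: (@filterS _ F FF _ _ _ H) => x; by rewrite unitmxE unitfE.
Qed.

Lemma cvg_cayley (W : mat) : (fun s : R => cayley (toC (s / 2) *: W)) @ (0 : R) --> (1%:M : mat).
Proof.
have h1 := cvg_one_scale W; have h2 := cvg_one_scale (- W).
have : (fun s : R => cayley (toC (s / 2) *: W)) @ (0 : R) --> invmx 1%:M *m (1%:M : mat).
  apply: cvg_mulmx; first by apply: cvg_invmx; [exact: unitmx1|exact: h1].
  by apply: cvg_trans h2; apply: near_eq_cvg; apply: nearW => s; rewrite scalerN opprK.
by rewrite invmx1 mulmx1.
Qed.

Lemma velocity_cayley (W : mat) : velocity (fun s => cayley (toC (s / 2) *: W)) 0 W.
Proof.
have h1 := cvg_one_scale W.
have : (fun s : R => invmx (1%:M - toC (s / 2) *: W) *m W) @ (0 : R) --> invmx 1%:M *m W.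
  apply: cvg_mulmx; last exact: cvg_cst.
  by apply: cvg_invmx; [exact: unitmx1|exact: h1].
rewrite invmx1 mul1mx => h.
have : (fun s : R => invmx (1%:M - toC (s / 2) *: W) *m W) @ (0 : R)^' --> W.
  by apply: cvg_within_filter; exact: h.
apply: cvg_trans; apply: near_eq_cvg.
have u : \forall s \near (0 : R), 1%:M - toC (s / 2) *: W \in unitmx.
  by apply: near_unit h1; exact: unitmx1.
suff : nbhs (0 : R) (fun s : R => s != 0 -> invmx (1%:M - toC (s / 2) *: W) *m W =
    toC s^-1 *: (cayley (toC ((0 + s) / 2) *: W) - cayley (toC (0 / 2) *: W))) by [].
apply: filterS u => s us s0.
rewrite add0r mul0r rmorph0 scale0r cayley0 /cayley; set A := _ *: W in us *.
have e : invmx (1%:M - A) *m (1%:M + A) - 1%:M = invmx (1%:M - A) *m (toC s *: W).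
  rewrite -[X in _ - X](mulVmx us) -mulmxBr; congr (_ *m _).
  have -> : toC s = toC (s / 2) + toC (s / 2) by rewrite -rmorphD -splitr.
  by rewrite scalerDl -/A opprB addrC addrA subrK.
by rewrite e -scalemxAr scalerA -rmorphM mulVf// rmorph1 scale1r.
Qed.

End Velocity.

Lemma mxrank_conj (F : fieldType) (N : nat) (P A : 'M[F]_N) : P \in unitmx ->
  \rank (P *m A *m invmx P) = \rank A.
Proof.
move=> uP; rewrite mxrankMfree ?row_free_unit ?unitmx_inv//.
by rewrite -mxrank_tr trmx_mul mxrankMfree ?row_free_unit ?unitmx_tr// mxrank_tr.
Qed.

(** A rank-one term raises the rank by at most 1, so a singular matrix that it makes invertible has
    corank exactly 1. *)
Lemma rank_corank1 (F : fieldType) (N : nat) (A : 'M[F]_N) (j : 'I_N) :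
  \det A = 0 -> \det (A + delta_mx j j) != 0 -> \rank A = N.-1.
Proof.
move=> dA dE; have N0 : (0 < N)%N by rewrite (leq_ltn_trans _ (ltn_ord j)).
apply/eqP; rewrite eqn_leq; apply/andP; split.
  rewrite -ltnS prednK// ltn_neqAle rank_leq_row andbT -/(row_free _).
  by rewrite row_free_unit unitmxE unitfE dA eqxx.
rewrite -ltnS prednK//.
have uE : A + delta_mx j j \in unitmx by rewrite unitmxE unitfE.
have := mxrank_add A (delta_mx j j); rewrite (mxrank_unit uE) mxrank_delta addn1.
exact.
Qed.

(** * Symplectic matrices in a basis that diagonalises the form *)

Section Basis.
Variables (R : realType) (n : nat).
Local Notation C := (Cplx R).
Local Notation mat := 'M[Cplx R]_(n + n).
Local Notation J := (stdJ R n).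
Local Notation Sp := (@Sp R n).
Variables (V : mat) (kap : 'I_(n + n) -> R).
Hypothesis kap0 : forall j, kap j != 0.

(* [i krein] is the matrix of the symplectic form in the basis [V]. *)
Definition krein : mat := diag_mx (\row_j toC (kap j)).
Hypothesis VJV : dg V *m J *m V = iC R *: krein.

(** The unitary group of the diagonal Hermitian form, with its Lie algebra [skewK]; conjugation by V
    takes it into [Sp]. *)
Definition isoK (N : mat) : Prop := dg N *m krein *m N = krein.
Definition skewK (X : mat) : Prop := krein *m X + dg X *m krein = 0.

Lemma iC_neq0 : iC R != 0.
Proof. by rewrite -normr_eq0 norm_iC oner_eq0. Qed.

Lemma kreinE (A : mat) i k : (krein *m A) i k = toC (kap i) * A i k.
Proof. by rewrite /krein mul_diag_mx !mxE. Qed.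

Lemma mul_kreinE (A : mat) i k : (A *m krein) i k = A i k * toC (kap k).
Proof. by rewrite /krein mul_mx_diag !mxE. Qed.

Lemma krein_unit : krein \in unitmx.
Proof.
rewrite unitmxE unitfE det_diag; apply/prodf_neq0 => i _.
by rewrite mxE toC_eq0.
Qed.

Lemma dg_krein : dg krein = krein.
Proof.
apply/matrixP => i k; rewrite dgE /krein !mxE; have [->|ne] := eqVneq k i.
  by rewrite !mulr1n conj_toC.
by rewrite !mulr0n rmorph0.
Qed.

Lemma basis_unit : V \in unitmx.
Proof.
have : iC R *: krein \in unitmx by rewrite unitmxZ ?krein_unit// unitfE iC_neq0.
by rewrite -VJV unitmx_mul => /andP[].
Qed.

Lemma isoK_unit (N : mat) : isoK N -> N \in unitmx.
Proof. by move=> h; have := krein_unit; rewrite -{1}h unitmx_mul => /andP[]. Qed.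

Lemma isoKM (A B : mat) : isoK A -> isoK B -> isoK (A *m B).
Proof.
by rewrite /isoK => hA hB; rewrite dgM -[RHS]hB -[in RHS]hA !mulmxA.
Qed.

Lemma skewKN (X : mat) : skewK X -> skewK (- X).
Proof. by rewrite /skewK dgN mulmxN mulNmx -opprD => ->; rewrite oppr0. Qed.

Lemma skewKZ (s : R) (X : mat) : skewK X -> skewK (toC s *: X).
Proof.
rewrite /skewK dgZ conj_toC -scalemxAl -scalemxAr -scalerDr => ->.
by rewrite scaler0.
Qed.

(** For skew X the cross terms cancel, so 1 + X and 1 - X pull the form [krein] back to the same
    matrix, and the Cayley transform maps one onto the other. *)
Lemma isoK_cayley (X : mat) : skewK X -> 1%:M - X \in unitmx -> isoK (cayley X).
Proof.
rewrite /skewK => sX uX.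
have NX : cayley X *m (1%:M - X) = 1%:M + X.
  have com : (1%:M + X) *m (1%:M - X) = (1%:M - X) *m (1%:M + X).
    transitivity (1%:M - X *m X).
      by rewrite mulmxDl mul1mx mulmxBr mulmx1 addrA subrK.
    by rewrite mulmxBl mul1mx mulmxDr mulmx1 opprD addrA addrK.
  by rewrite /cayley -mulmxA com mulKmx.
move: (cayley X) NX => N NX.
have quad (Y : mat) : krein *m Y + dg Y *m krein = 0 ->
    dg (1%:M + Y) *m krein *m (1%:M + Y) = krein + dg Y *m krein *m Y.
  move=> sY; rewrite dgD dg1 mulmxDl mul1mx mulmxDr mulmx1 mulmxDl addrA.
  by rewrite -[krein + _ + _]addrA [dg Y *m krein + _]addrC sY addr0.
have e : dg (1%:M - X) *m (dg N *m krein *m N) *m (1%:M - X) =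
         dg (1%:M - X) *m krein *m (1%:M - X).
  have -> : dg (1%:M - X) *m (dg N *m krein *m N) *m (1%:M - X) =
      dg (N *m (1%:M - X)) *m krein *m (N *m (1%:M - X)) by rewrite dgM !mulmxA.
  rewrite NX quad// quad; last first.
    by rewrite dgN mulmxN mulNmx -opprD sX oppr0.
  by rewrite dgN !mulNmx mulmxN opprK.
have uX' : dg (1%:M - X) \in unitmx by rewrite /dg unitmx_tr map_unitmx.
exact: (can_inj (mulKmx uX') (can_inj (mulmxK uX) e)).
Qed.

Lemma Sp_conj (N : mat) : isoK N -> Sp (V *m N *m invmx V).
Proof.
move=> hN; have uV := basis_unit; split.
  by rewrite !unitmx_mul uV unitmx_inv uV isoK_unit.
rewrite /dagger -/(dg _) !dgM.
have e1 : dg (invmx V) *m dg V = 1%:M by rewrite -dgM mulmxV// dg1.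
have e2 : dg N *m (dg V *m J *m V) *m N = dg V *m J *m V.
  by rewrite VJV -scalemxAr -scalemxAl hN.
have e3 : dg (invmx V) *m (dg V *m J *m V) *m invmx V = J.
  by rewrite !mulmxA e1 mul1mx mulmxK.
rewrite -[RHS]e3 -[in RHS]e2 !mulmxA; reflexivity.
Qed.

Lemma conj_sub1 (N : mat) : V *m N *m invmx V - 1%:M = V *m (N - 1%:M) *m invmx V.
Proof. by rewrite mulmxBr mulmx1 mulmxBl mulmxV ?basis_unit. Qed.

Lemma det_conj_sub1 (N : mat) : \det (V *m N *m invmx V - 1%:M) = \det (N - 1%:M).
Proof.
by rewrite conj_sub1 !det_mulmx mulrAC -det_mulmx mulmxV ?basis_unit// det1 mul1r.
Qed.
End Basis.

(** * Tangent vectors to the top stratum at a point of the torus *)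

Section Tangent.
Variables (R : realType) (n : nat).
Local Notation C := (Cplx R).
Local Notation mat := 'M[Cplx R]_(n + n).
Local Notation J := (stdJ R n).
Local Notation Sp := (@Sp R n).
Variables (V : mat) (kap : 'I_(n + n) -> R).
Hypothesis kap0 : forall j, kap j != 0.
Hypothesis VJV : dg V *m J *m V = iC R *: krein kap.
Local Notation conjV N := (V *m N *m invmx V).

Definition dmx (z : 'I_(n + n) -> C) : mat := diag_mx (\row_i z i).

Lemma dmxE z i k : dmx z i k = (z i) *+ (i == k).
Proof. by rewrite /dmx !mxE. Qed.

Lemma mul_dmxl p z (A : 'M[C]_(n + n, p)) i k : (dmx z *m A) i k = z i * A i k.
Proof. by rewrite /dmx mul_diag_mx !mxE. Qed.

Lemma mul_dmxr z (A : mat) i k : (A *m dmx z) i k = A i k * z k.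
Proof. by rewrite /dmx mul_mx_diag !mxE. Qed.

Lemma isoK_dmx z : (forall i, Num.conj (z i) * z i = 1) -> isoK kap (dmx z).
Proof.
move=> hz; rewrite /isoK; apply/matrixP => i k.
rewrite mul_dmxr mul_kreinE dgE dmxE eq_sym /krein !mxE.
have [->|ne] := eqVneq i k; last by rewrite !mulr0n rmorph0 !mul0r.
by rewrite !mulr1n mulrAC hz mul1r.
Qed.

Lemma det_dmx_sub1 z : \det (dmx z - 1%:M) = \prod_i (z i - 1).
Proof.
have -> : dmx z - 1%:M = diag_mx (\row_i (z i - 1)).
  apply/matrixP => i k; rewrite !mxE; case: eqP => _; last by rewrite subr0.
  by rewrite !mulr1n.
by rewrite det_diag; apply: eq_bigr => i _; rewrite mxE.
Qed.

Lemma Sp1_rank (M : mat) (P A : mat) (j : 'I_(n + n)) : Sp M -> P \in unitmx ->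
  M - 1%:M = P *m A *m invmx P -> \det A = 0 -> \det (A + delta_mx j j) != 0 -> Sp_ 1 M.
Proof.
move=> sM uP MP dA dE; split => //.
have N0 : (0 < n + n)%N by rewrite (leq_ltn_trans _ (ltn_ord j)).
by rewrite mxrank_ker mxrank_tr MP mxrank_conj// (rank_corank1 dA dE) -{1}(prednK N0) subSnn.
Qed.

Section Curve.
Variables (z : 'I_(n + n) -> C) (j : 'I_(n + n)) (Z : mat).
Hypotheses (z1 : forall i, Num.conj (z i) * z i = 1) (zj : z j = 1)
  (zi : forall i, i != j -> z i != 1) (sZ : skewK kap Z) (Zjj : Z j j = 0).
Let D := dmx z.

Let z0 i : z i != 0.
Proof. by apply/eqP => e; have := z1 i; rewrite e mulr0 => /eqP; rewrite eq_sym oner_eq0. Qed.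

(** Solves D Z = W D - D W on the entries where exactly one index is j; the denominator is nonzero
    there because z j = 1 and no other z i is 1. The remaining entries go into [W'], which
    annihilates the basis vector of index j. *)
Let W : mat := \matrix_(i, k) if (i == j) (+) (k == j) then Z i k / (z k / z i - 1) else 0.
Let W' : mat := \matrix_(i, k) if (i == j) || (k == j) then 0 else Z i k.

Lemma skewKP (X : mat) : skewK kap X <->
  forall i k, toC (kap i) * X i k + Num.conj (X k i) * toC (kap k) = 0.
Proof.
split=> [/matrixP h i k|h]; first by have := h i k; rewrite mxE kreinE mul_kreinE dgE => ->; rewrite mxE.
by apply/matrixP => i k; rewrite mxE kreinE mul_kreinE dgE h mxE.
Qed.

Let sW : skewK kap W.
Proof.
apply/skewKP => i k; rewrite !mxE addbC; case: ifP => [h|_]; last by rewrite rmorph0 !mulr0 mul0r addr0.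
have -> : Num.conj (Z k i / (z i / z k - 1)) = Num.conj (Z k i) / (z k / z i - 1).
  have cz u : Num.conj (z u) = (z u)^-1 by apply: (mulIf (z0 u)); rewrite z1 mulVf.
  by rewrite rmorphM fmorphV rmorphB rmorph1 rmorphM fmorphV /= !cz invrK [(z i)^-1 * _]mulrC.
by rewrite mulrA [_ / _ * toC (kap k)]mulrAC -mulrDl ((skewKP Z).1 sZ) mul0r.
Qed.

Let sW' : skewK kap W'.
Proof.
apply/skewKP => i k; rewrite !mxE orbC; case: ifP => _; first by rewrite rmorph0 !mulr0 mul0r addr0.
exact: (skewKP Z).1.
Qed.

Let DZ : D *m Z = W *m D - D *m W + D *m W'.
Proof.
apply/matrixP => i k; rewrite [RHS]mxE [X in X + _]mxE [X in _ + X + _]mxE !mul_dmxl mul_dmxr.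
rewrite [W i k]mxE [W' i k]mxE.
have [->|ij] := eqVneq i j; have [->|kj] := eqVneq k j; rewrite /=.
- by rewrite Zjj !(mulr0, mul0r) subrr addr0.
- have d : z k - 1 != 0 by rewrite subr_eq0 zi.
  by rewrite zj divr1 mulr0 addr0 !mul1r -[X in _ = _ - X]mulr1 -mulrBr mulfVK.
- have d : (z i)^-1 - 1 != 0.
    by rewrite subr_eq0 -[1]invr1 (inj_eq invr_inj) zi.
  rewrite zj mulr0 addr0 mulr1 div1r -{1}[Z i j](divfK d).
  move: (Z i j / _) => t; rewrite mulrBr mulr1 mulrBr mulrCA mulfV ?mulr1//.
- by rewrite !(mulr0, mul0r) subrr add0r.
Qed.

Let E s := cayley (toC (s / 2) *: W).
Let E' s := cayley (toC (s / 2) *: - W).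
Let F s := cayley (toC (s / 2) *: W').
(** [tangent_Sp1] wants a curve in the top stratum for every s, while the Cayley transforms are
    controlled only near 0; elsewhere [c] is constant. The last condition keeps the eigenvalue 1
    simple in rank. *)
Let good s := [&& 1%:M - toC (s / 2) *: W \in unitmx, 1%:M - toC (s / 2) *: - W \in unitmx,
  1%:M - toC (s / 2) *: W' \in unitmx &
  D *m F s - 1%:M + delta_mx j j \in unitmx].
Let c s := if good s then conjV (E s *m D *m F s *m E' s) else conjV D.

Let detD1 : \det (D - 1%:M + delta_mx j j) != 0.
Proof.
have -> : D - 1%:M + delta_mx j j = dmx (fun i => if i == j then 1 else z i - 1).
  apply/matrixP => i k; rewrite !mxE; have [->|ik] := eqVneq i k.
    by case: eqP => [->|_]; rewrite ?zj ?subrr ?add0r ?addr0// mulr1n.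
  have -> : (i == j) && (k == j) = false.
    by apply/negP => /andP[/eqP ij /eqP kj]; rewrite ij kj eqxx in ik.
  by rewrite !mulr0n subr0 addr0.
rewrite /dmx det_diag; apply/prodf_neq0 => i _; rewrite mxE.
by case: (eqVneq i j) => [_|ij]; [rewrite oner_eq0|rewrite subr_eq0 zi].
Qed.

Let F_fix s : 1%:M - toC (s / 2) *: W' \in unitmx -> F s *m delta_mx j (0 : 'I_1) = delta_mx j 0.
Proof.
move=> u; have W'e : W' *m delta_mx j (0 : 'I_1) = 0.
  apply/matrixP => i k; rewrite -colE !mxE eqxx orbT; by [].
rewrite /F /cayley -mulmxA mulmxDl mul1mx -scalemxAl W'e scaler0 addr0.
have e : (1%:M - toC (s / 2) *: W') *m delta_mx j (0 : 'I_1) = delta_mx j 0.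
  by rewrite mulmxBl mul1mx -scalemxAl W'e scaler0 subr0.
by rewrite -[in LHS]e mulKmx.
Qed.

Let D_fix : D *m delta_mx j (0 : 'I_1) = delta_mx j 0.
Proof.
apply/matrixP => i k; rewrite /D mul_dmxl !mxE !ord1 eqxx andbT.
by case: eqP => [->|_]; rewrite ?zj ?mulr1// mulr0.
Qed.

Let det_fix (A : mat) : A *m delta_mx j (0 : 'I_1) = delta_mx j 0 -> \det (A - 1%:M) = 0.
Proof.
move=> e; apply: (@det_rcolP _ _ _ (delta_mx j (0 : 'I_1))).
  by apply/eqP => /matrixP/(_ j 0); rewrite !mxE !eqxx => /eqP; rewrite oner_eq0.
by rewrite mulmxBl mul1mx e subrr.
Qed.

Let uV := basis_unit kap0 VJV.
Let iD := isoK_dmx z1.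

Let c_Sp1 s : Sp_ 1 (c s).
Proof.
rewrite /c; case: ifP => [/and4P[u1 u2 u3 u4]|_]; last first.
  exact: (Sp1_rank (Sp_conj kap0 VJV iD) uV (conj_sub1 kap0 VJV D) (det_fix D_fix) detD1).
have EE : E s *m E' s = 1%:M.
  rewrite /E /E' scalerN; apply: (cayleyVK u1).
  by move: u2; rewrite scalerN opprK.
have [uE _] := mulmx1_unit EE.
have E'E : E' s = invmx (E s) by rewrite -[LHS](mulKmx uE) EE mulmx1.
apply: (Sp1_rank (P := V *m E s) (j := j) (A := D *m F s - 1%:M)).
- apply: (Sp_conj kap0 VJV).
  apply: isoKM; last exact: (isoK_cayley (skewKZ _ (skewKN sW)) u2).
  apply: isoKM; last exact: (isoK_cayley (skewKZ _ sW') u3).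
  by apply: isoKM; [exact: (isoK_cayley (skewKZ _ sW) u1)|exact: iD].
- by rewrite unitmx_mul uV uE.
- rewrite (conj_sub1 kap0 VJV) E'E.
  have -> : invmx (V *m E s) = invmx (E s) *m invmx V.
    have uVE : V *m E s \in unitmx by rewrite unitmx_mul uV uE.
    apply: (can_inj (mulKmx uVE)); rewrite (mulmxV uVE) mulmxA (mulmxK uE) (mulmxV uV).
    by [].
  have e : E s *m D *m F s *m invmx (E s) - 1%:M = E s *m (D *m F s - 1%:M) *m invmx (E s).
    rewrite mulmxBr mulmx1 mulmxBl (mulmxV uE) [E s *m (D *m F s)]mulmxA; reflexivity.
  rewrite e !mulmxA; reflexivity.
- by apply: det_fix; rewrite -mulmxA F_fix.
- by rewrite -unitfE -unitmxE.
Qed.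

(** The curve E D F E^(-1) has a fixed vector for all s, because D and F both fix the basis vector
    of index j. Its velocity at 0 is W D + D W' - D W = D Z; the hyperplane is Z j j = 0. *)
Lemma tangent_diag : tangent_Sp1 (conjV D) (conjV (D *m Z)).
Proof.
have W0 (A : mat) : toC (0 / 2) *: A = 0 by rewrite mul0r rmorph0 scale0r.
have E0 : E 0 = 1%:M by rewrite /E W0 cayley0.
have E'0 : E' 0 = 1%:M by rewrite /E' W0 cayley0.
have F0 : F 0 = 1%:M by rewrite /F W0 cayley0.
exists c; split; first exact: c_Sp1.
  by rewrite /c E0 E'0 F0 !mulmx1 mul1mx if_same.
have gd : \forall s \near (0 : R), good s.
  have h1 : \forall s \near (0 : R), 1%:M - toC (s / 2) *: W \in unitmx.
    by apply: near_unit (cvg_one_scale _); exact: unitmx1.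
  have h2 : \forall s \near (0 : R), 1%:M - toC (s / 2) *: - W \in unitmx.
    by apply: near_unit (cvg_one_scale _); exact: unitmx1.
  have h3 : \forall s \near (0 : R), 1%:M - toC (s / 2) *: W' \in unitmx.
    by apply: near_unit (cvg_one_scale _); exact: unitmx1.
  have h4 : \forall s \near (0 : R), D *m F s - 1%:M + delta_mx j j \in unitmx.
    have hc : (fun s => D *m F s - 1%:M + delta_mx j j) @ (0 : R) --> D *m 1%:M - 1%:M + delta_mx j j.
      apply: cvgD; last exact: cvg_cst.
      apply: cvgB; last exact: cvg_cst.
      by apply: cvg_mulmx; [exact: cvg_cst|exact: cvg_cayley].
    by apply: near_unit hc; rewrite mulmx1 unitmxE unitfE.
  apply: filterS (filterI (filterI h1 h2) (filterI h3 h4)) => s [[a1 a2] [a3 a4]].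
  by apply/and4P; split; [exact: a1|exact: a2|exact: a3|exact: a4].
apply: (@velocity_near _ _ (fun s => V *m (E s *m D *m F s *m E' s) *m invmx V)).
  by apply: filterS gd => s gs; rewrite /c gs.
have vE : velocity E 0 W by exact: velocity_cayley.
have vE' : velocity E' 0 (- W) by exact: velocity_cayley.
have vF : velocity F 0 W' by exact: velocity_cayley.
have v1 := velocityM (velocityM (velocityM vE (velocity_cst D 0)) vF) vE'.
have := velocityM (velocityM (velocity_cst V 0) v1) (velocity_cst (invmx V) 0).
rewrite E0 F0 E'0 ?(mulmx1, mul1mx, mulmx0, mul0mx, addr0, add0r) mulmxN DZ.
suff -> : W *m D + D *m W' - D *m W = W *m D - D *m W + D *m W' by [].
by rewrite addrAC.
Unshelve. all: by end_near. Qed.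
End Curve.
End Tangent.

Lemma cvg_cis_diff (R : realType) (s : R) :
  (fun h : R => toC h^-1 * (cis (s * h) - 1)) @ (0 : R)^' --> iC R * toC s.
Proof.
have dlim (f : R -> R) (df : R) : is_derive (0 : R) 1 f df ->
    (fun h => h^-1 * (f h - f 0)) @ (0 : R)^' --> df.
  move=> fd; have e : (fun h => h^-1 *: (f (h *: 1 + 0) - f 0)) = (fun h => h^-1 * (f h - f 0)).
    by apply/funext => h; rewrite addr0 [h *: 1]mulr1.
  have /cvg_ex[l hl] := @ex_derive _ _ _ _ _ _ _ fd.
  have := @derive_val _ _ _ _ _ _ _ fd; rewrite /derive.
  have hl' : (fun h => h^-1 *: (f (h *: 1 + 0) - f 0)) @ (0 : R)^' --> l by exact: hl.
  rewrite (cvg_lim (@norm_hausdorff _ _) hl') => <-.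
  by move: hl'; rewrite e.
have dg0 : is_derive (0 : R) 1 (fun h : R => s * h) s.
  have := @is_deriveZ _ _ _ (@id R) s 0 1 1 (is_derive_id _ _).
  by rewrite /= [s *: 1]mulr1.
have dc : is_derive (0 : R) 1 (fun h : R => cos (s * h)) 0.
  have := @is_derive1_comp _ (@cos R) (fun h => s * h) 0 _ s (is_derive_cos _) dg0.
  by rewrite mulr0 sin0 oppr0 mul0r.
have ds : is_derive (0 : R) 1 (fun h : R => sin (s * h)) s.
  have := @is_derive1_comp _ (@sin R) (fun h => s * h) 0 _ s (is_derive_sin _) dg0.
  by rewrite mulr0 cos0 mul1r.
have {}dc := dlim _ _ dc; have {}ds := dlim _ _ ds.
rewrite !mulr0 ?cos0 ?sin0 in dc ds.
have h1 := cvg_toC _ dc; have h2 := cvg_toC _ ds.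
have : (fun h : R => toC (h^-1 * (cos (s * h) - 1)) + iC R * toC (h^-1 * (sin (s * h) - 0))) @ (0 : R)^'
    --> toC (0 : R) + iC R * toC s.
  by apply: cvgD; [exact: h1|apply: cvgM; [exact: cvg_cst|exact: h2]].
rewrite rmorph0 add0r; apply: cvg_trans; apply: near_eq_cvg; apply: nearW => h.
rewrite subr0 !rmorphM rmorphB rmorph1 /cis; ring.
Qed.

Lemma mxsubZE (F : pzRingType) m p (A B : 'M[F]_(m, p)) c i k :
  (A - c *: B) i k = A i k - c * B i k.
Proof. by rewrite !mxE. Qed.

Lemma mxZsubE (F : pzRingType) m p (A B : 'M[F]_(m, p)) c i k :
  (c *: (A - B)) i k = c * (A i k - B i k).
Proof. by rewrite !mxE. Qed.

(** * Crossings produced by one moving phase *)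

Section TorusCrossing.
Variables (R : realType) (n : nat).
Local Notation C := (Cplx R).
Local Notation mat := 'M[Cplx R]_(n + n).
Local Notation J := (stdJ R n).
Local Notation Sp := (@Sp R n).
Variables (V : mat) (kap : 'I_(n + n) -> R).
Hypothesis kap0 : forall j, kap j != 0.
Hypothesis VJV : dg V *m J *m V = iC R *: krein kap.
Local Notation conjV N := (V *m N *m invmx V).
Let uV := basis_unit kap0 VJV.

Let Nm : mat := dg V *m V.
Let J' : mat := invmx V *m J *m V.

Lemma col_norm_gt0 (j : 'I_(n + n)) : exists2 r : R, 0 < r & Nm j j = toC r.
Proof.
apply: gt0_toC; rewrite lt_neqAle; apply/andP; split; last first.
  rewrite mxE; apply: sumr_ge0 => i _; rewrite dgE mulrC -normCK.
  by apply: exprn_ge0; exact: normr_ge0.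
rewrite eq_sym; apply/eqP => Nj.
have Vj : col j V = 0.
  apply: dgxx_eq0; apply/matrixP => a b; rewrite !ord1 [RHS]mxE -Nj !mxE.
  by apply: eq_bigr => i _; rewrite !mxE.
have := mulVmx uV => /(congr1 (col j)); rewrite colE -mulmxA -colE Vj mulmx0.
move=> /matrixP/(_ j 0); rewrite !mxE eqxx => /eqP; rewrite eq_sym oner_eq0; exact/negP.
Qed.

Let kJ' : krein kap *m J' = iC R *: Nm.
Proof.
have -> : krein kap = (- iC R) *: (dg V *m J *m V).
  by rewrite VJV scalerA mulNr iC2 opprK scale1r.
rewrite -scalemxAl /J' !mulmxA (mulmxK uV) -[_ *m J *m J]mulmxA stdJ_sqr mulmxN mulmx1 mulNmx.
by rewrite scalerN scaleNr opprK.
Qed.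

Let sJ' : skewK kap J'.
Proof.
have dk : dg (krein kap) = krein kap by exact: dg_krein.
have -> : skewK kap J' = (krein kap *m J' + dg (krein kap *m J') = 0) by rewrite dgM dk.
rewrite kJ' dgZ conj_iC /Nm dgM dgK scaleNr; exact: subrr.
Qed.

(** In the basis V, the matrix J has diagonal entry i r / kap j, where r > 0 is the squared norm of
    column j, and the path has logarithmic velocity i sl at that entry alone. So a = sl kap j / r is
    the coefficient whose removal leaves a zero diagonal entry, that is a tangent vector. *)
Lemma torus_crossing (g : R -> mat) (t0 sl : R) (th : 'I_(n + n) -> R) (j : 'I_(n + n)) :
  (\forall t \near t0, g t = conjV (dmx (fun i => cis (th i + (if i == j then sl * (t - t0) else 0))))) ->
  cis (th j) = 1 -> (forall i, i != j -> cis (th i) != 1) -> sl != 0 ->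
  crossing g t0 (sgz (sl * kap j)).
Proof.
move=> gnear thj thi sl0; have [r r0 Nr] := col_norm_gt0 j.
pose z i := cis (th i).
pose X : mat := (iC R * toC sl) *: delta_mx j j.
pose a := sl * kap j / r.
pose Z : mat := X - toC a *: J'.
have Xjj : X j j = iC R * toC sl by rewrite !mxE !eqxx mulr1.
have J'jj : J' j j = iC R * toC (r / kap j).
  have kj : toC (kap j) != 0 by rewrite toC_eq0.
  apply: (mulfI kj); rewrite -(kreinE kap) kJ' mxE Nr mulrCA -rmorphM.
  by rewrite mulrCA mulfV// mulr1.
have Zjj : Z j j = 0.
  rewrite /Z mxsubZE Xjj J'jj mulrCA -rmorphM /a.
  by rewrite -mulrBr -rmorphB; have -> : sl - sl * kap j / r * (r / kap j) = 0;
    [field; rewrite (kap0 j) gt_eqF|rewrite rmorph0 mulr0].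
have sX : skewK kap X.
  apply/skewKP => i k; rewrite /X !mxE.
  have [->|ij] := eqVneq i j; have [->|kj] := eqVneq k j; rewrite /= ?(mulr0, mul0r, rmorph0, addr0)//.
  rewrite !mulr1 rmorphM /= conj_iC conj_toC; ring.
have sZ : skewK kap Z.
  apply/skewKP => i k.
  have h1 := (skewKP kap X).1 sX i k; have h2 := (skewKP kap _).1 (skewKN (skewKZ a sJ')) i k.
  rewrite /Z [(X + _) i k]mxE [(X + _) k i]mxE mulrDr rmorphD mulrDl addrACA h1 h2; exact: addr0.
have gt0 : g t0 = conjV (dmx z).
  rewrite (nbhs_singleton gnear); congr (V *m dmx _ *m _); apply/funext => i.
  by rewrite subrr mulr0 if_same addr0.
have z1 i : Num.conj (z i) * z i = 1 by exact: cis_conjM.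
have tY := tangent_diag kap0 VJV z1 thj thi sZ Zjj.
exists a, (conjV (dmx z *m Z)); split.
- by have [c [cs c0 _]] := tY; rewrite gt0 -c0; exact: cs.
- by rewrite gt0.
- have -> : toC a *: (g t0 *m J) + conjV (dmx z *m Z) = conjV (dmx z *m X).
    have e : g t0 *m J = conjV (dmx z *m J').
      rewrite gt0 /J' !mulmxA (mulmxK uV); reflexivity.
    have e2 : toC a *: J' + Z = X by rewrite /Z addrC subrK.
    rewrite e scalemxAl scalemxAr -mulmxDl -mulmxDr [toC a *: _]scalemxAr -mulmxDr e2.
    reflexivity.
  apply: (@velocity_near _ _ (fun t => conjV (dmx (fun i => cis (th i + (if i == j then sl * (t - t0) else 0)))))).
    apply: filterS gnear => t e; exact: esym e.
  have vD : velocity (fun t => dmx (fun i => cis (th i + (if i == j then sl * (t - t0) else 0)))) t0 (dmx z *m X).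
    apply/cvg_mxP => i k; rewrite [X in _ --> X]mul_dmxl [X i k]mxE [delta_mx _ _ _ _]mxE.
    have -> : (fun h : R => (toC h^-1 *:
       (dmx (fun i0 => cis (th i0 + (if i0 == j then sl * (t0 + h - t0) else 0))) -
        dmx (fun i0 => cis (th i0 + (if i0 == j then sl * (t0 - t0) else 0))))) i k) =
       (fun h => z i * ((toC h^-1 * (cis (sl * h) - 1)) * ((i == j) && (k == j))%:R)).
      apply/funext => h; rewrite mxZsubE !dmxE.
      rewrite [t0 + h]addrC addrK subrr mulr0 if_same addr0 -/(z i).
      have [->|ij] := eqVneq i j; last by rewrite addr0 subrr !mulr0.
      have [->|kj] := eqVneq j k; last first.
        rewrite /= !mulr0n subrr !mulr0; reflexivity.
      rewrite /= !mulr1n mulr1 cisD -/(z k) mulrCA; congr (_ * _).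
      by rewrite mulrBr mulr1.
    apply: cvgM; first exact: cvg_cst.
    by apply: cvgM; [exact: cvg_cis_diff|exact: cvg_cst].
  have := velocityM (velocityM (velocity_cst V t0) vD) (velocity_cst (invmx V) t0).
  by rewrite mul0mx add0r mulmx0 addr0.
- by rewrite /a !mulf_neq0// invr_eq0 gt_eqF.
- have -> : sl * kap j = a * r by rewrite /a divfK// gt_eqF.
  by rewrite sgzM (gtr0_sgz r0) mulr1.
Qed.
End TorusCrossing.

(** * Integers passed by a moving phase *)

Section SignedList.
Variable R : realType.

(* The integers strictly between 1/2 and a noninteger [y] with [floor y = f]. *)
Definition between_half (f : int) : seq int :=
  match f with
  | Posz m => [seq Posz i.+1 | i <- iota 0 m]
  | Negz m => [seq - Posz i | i <- iota 0 m.+1]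
  end.

Lemma between_half_uniq f : uniq (between_half f).
Proof.
case: f => m; rewrite /between_half map_inj_uniq ?iota_uniq//.
  by move=> i j [].
by move=> i j /oppr_inj[].
Qed.

Lemma mem_between_half f (l : int) :
  (l \in between_half f) = (1 <= l <= f) || (f + 1 <= l <= 0).
Proof.
case: f => m; rewrite /between_half; apply/mapP/idP.
- by case=> i; rewrite mem_iota => /andP[_ im] ->; lia.
- case: l => l h; last by lia.
  by exists l.-1; rewrite ?mem_iota; [lia|congr Posz; lia].
- by case=> i; rewrite mem_iota NegzE => /andP[_ im] ->; lia.
- rewrite NegzE => h; exists `|l|%N; rewrite ?mem_iota; lia.
Qed.

(** The quotient is the time in (0, 1) at which uniform motion from 1/2 to y passes l; this form
    treats y above and below 1/2 alike. *)
Lemma between_halfP (y : R) (l : int) : (forall k : int, y != k%:~R) ->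
  (l \in between_half (Num.floor y)) = (0 < (l%:~R - 2^-1) / (y - 2^-1) < 1).
Proof.
move=> yn; have /andP[f1 f2] := floor_itv y; set f := Num.floor y in f1 f2 *.
rewrite intrD mulr1z in f2.
have {}f1 : f%:~R < y by rewrite lt_neqAle eq_sym yn.
rewrite mem_between_half.
have lc : l <= 0 \/ 1 <= l by lia.
have fc : f <= -1 \/ f = 0 \/ 1 <= f by lia.
have lf : l <= f \/ f + 1 <= l by lia.
have cast (a b : int) : a <= b -> (a%:~R : R) <= b%:~R by rewrite ler_int.
have [y12|y12|y12] := ltgtP y 2^-1; last first.
- rewrite y12 subrr invr0 mulr0 ltxx /=; apply/negbTE/negP.
  case: fc => [/cast|[->|/cast]]; [|lia|by rewrite mulr1z => ?; exfalso; lra].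
  by rewrite mulrNz mulr1z => ?; exfalso; lra.
- have d : 0 < y - 2^-1 by lra.
  rewrite ltr_pdivrMr// pmulr_lgt0 ?invr_gt0// mul1r ltrD2r subr_gt0.
  have f0 : 0 <= f.
    by case: fc => [/cast|]; [rewrite mulrNz mulr1z => ?; exfalso; lra|lia].
  apply/idP/idP => [h|/andP[h1 h2]].
    have /andP[/cast l1 /cast l2] : 1 <= l <= f by lia.
    by rewrite mulr1z in l1; apply/andP; split; lra.
  case: lc => [/cast|l1]; first by rewrite mulr0z => ?; exfalso; lra.
  case: lf => [l2|/cast]; first by rewrite l1 l2.
  by rewrite intrD mulr1z => ?; exfalso; lra.
- have d : y - 2^-1 < 0 by lra.
  rewrite ltr_ndivrMr// nmulr_lgt0 ?invr_lt0// mul1r ltrD2r subr_lt0.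
  have f0 : f <= 0.
    case: fc => [|[|/cast]]; [lia|lia|rewrite mulr1z => ?; exfalso; lra].
  apply/idP/idP => [h|/andP[h1 h2]].
    have /andP[/cast l1 /cast l2] : f + 1 <= l <= 0 by lia.
    by rewrite mulr0z in l2; rewrite intrD mulr1z in l1; apply/andP; split; lra.
  case: lc => [l1|/cast]; last by rewrite mulr1z => ?; exfalso; lra.
  case: lf => [/cast|l2]; first by move=> ?; exfalso; lra.
  by rewrite l1 l2 orbT.
Qed.

(** The floor is 0 at the starting point 1/2 and changes by the sign of the motion at each integer
    passed; going down, 0 itself is passed, whence m + 1 terms for [Negz m]. *)
Lemma sum_between_half (y : R) : (forall k : int, y != k%:~R) ->
  \sum_(l <- between_half (Num.floor y)) sgz (y - 2^-1) = Num.floor y.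
Proof.
move=> yn; have /andP[f1 f2] := floor_itv y; rewrite intrD mulr1z in f2.
move: f1 f2; case E : (Num.floor y) => [m|m] f1 f2; rewrite /between_half big_map big_const_seq count_predT size_iota.
  case: m E f1 f2 => [//|m] E f1 f2.
  have : (1 : R) <= (Posz m.+1)%:~R by rewrite -[1]/(1%:~R) ler_int.
  by move=> h; rewrite gtr0_sgz; [rewrite iter_addr addr0; lia|lra].
have : (Negz m)%:~R + 1 <= 0 :> R by rewrite -[1]/(1%:~R) -intrD -[0]/(0%:~R) ler_int; lia.
move=> h; rewrite ltr0_sgz; [rewrite iter_addr addr0 NegzE; lia|lra].
Qed.
End SignedList.

Lemma block_symplectic (F : comNzRingType) (n : nat) (a b : F) : a * b = 1 ->
  block_mx a%:M 0 0 b%:M *m block_mx 0 (- 1%:M) 1%:M 0 *m block_mx a%:M 0 0 b%:M =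
  block_mx 0 (- 1%:M) 1%:M 0 :> 'M[F]_(n + n).
Proof.
move=> ab; rewrite !mulmx_block ?(mulmx0, mul0mx, addr0, add0r, mulmx1) mulmxN mulmx1 mulNmx.
by rewrite -!scalar_mxM ab mulrC ab ?(mulmx0, mul0mx, addr0, add0r).
Qed.

Lemma det_block_scalar (F : comNzRingType) (n : nat) (a b c : F) :
  \det ((block_mx a%:M 0 0 b%:M : 'M[F]_(n + n)) *m c%:M - 1%:M) =
  (a * c - 1) ^+ n * (b * c - 1) ^+ n.
Proof.
rewrite [c%:M]scalar_mx_block [1%:M]scalar_mx_block mulmx_block.
rewrite ?(mulmx0, mul0mx, addr0, add0r) opp_block_mx add_block_mx ?oppr0 ?addr0.
by rewrite det_ublock -!scalar_mxM -!raddfB !det_scalar.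
Qed.

Section XiPath.
Variables (R : realType) (n : nat).
Local Notation C := (Cplx R).
Local Notation mat := 'M[Cplx R]_(n + n).
Local Notation J := (stdJ R n).
Local Notation Sp := (@Sp R n).

Lemma SpM (A B : mat) : Sp A -> Sp B -> Sp (A *m B).
Proof.
move=> [uA hA] [uB hB]; split; first by rewrite unitmx_mul uA.
rewrite /dagger -/(dg _) dgM; rewrite /dagger -/(dg _) in hA hB.
by rewrite -[RHS]hB -[in RHS]hA !mulmxA.
Qed.

Lemma xiE (T t : R) : xi n T t = toC (2 - t / T) *: block_mx 1%:M 0 0 0
   + toC (2 - t / T)^-1 *: block_mx 0 0 0 1%:M.
Proof.
by rewrite /xi !scale_block_mx !scaler0 add_block_mx !addr0 !add0r !scalemx1.
Qed.

Lemma Sp_xi (T t : R) : 2 - t / T != 0 -> Sp (xi n T t).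
Proof.
move=> d0; have dx : dagger (xi n T t) = xi n T t.
  rewrite /dagger /xi map_block_mx tr_block_mx !map_mx0 !trmx0 !map_scalar_mx !tr_scalar_mx.
  by rewrite /= !conj_toC.
split.
  rewrite unitmxE unitfE /xi det_ublock !det_scalar mulf_neq0// expf_neq0// toC_eq0//.
  by rewrite invr_eq0.
by rewrite dx /xi /stdJ block_symplectic// -rmorphM mulfV// rmorph1.
Qed.

Lemma xiT (T : R) : T != 0 -> xi n T T = 1%:M.
Proof.
move=> T0; rewrite /xi divff//; have -> : (2 - 1 : R) = 1 by lra.
by rewrite invr1 rmorph1 -scalar_mx_block.
Qed.

Lemma det_xi_scalar (T t : R) (c : C) :
  \det (xi n T t *m c%:M - 1%:M) =
  (toC (2 - t / T) * c - 1) ^+ n * (toC (2 - t / T)^-1 * c - 1) ^+ n.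
Proof.
exact: det_block_scalar.
Qed.

Lemma cvg_xi (X : Type) (F : set_system X) (FF : Filter F) (T : R) (f : X -> R) (t : R) :
  2 - t / T != 0 -> f @ F --> t -> (fun x => xi n T (f x)) @ F --> xi n T t.
Proof.
move=> d0 cf; have cd : (fun x => 2 - f x / T) @ F --> 2 - t / T.
  by apply: cvgB; [exact: cvg_cst|apply: cvgM; [exact: cf|exact: cvg_cst]].
have c1 := cvg_toC FF cd; have c2 := cvg_toC FF (cvgV d0 cd).
have : (fun x => toC (2 - f x / T) *: (block_mx 1%:M 0 0 0 : mat)
   + toC (2 - f x / T)^-1 *: block_mx 0 0 0 1%:M) @ F -->
   toC (2 - t / T) *: (block_mx 1%:M 0 0 0 : mat) + toC (2 - t / T)^-1 *: block_mx 0 0 0 1%:M.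
  by apply: cvgD; apply: cvgZ; [exact: c1|exact: cvg_cst|exact: c2|exact: cvg_cst].
rewrite -xiE; apply: cvg_trans; apply: near_eq_cvg; apply: nearW => x.
by rewrite -xiE.
Qed.

Lemma cvg_dmx (X : Type) (F : set_system X) (FF : Filter F) (f : 'I_(n + n) -> X -> R)
    (a : 'I_(n + n) -> R) :
  (forall i, f i @ F --> a i) ->
  (fun x => dmx (fun i => cis (f i x))) @ F --> (dmx (fun i => cis (a i)) : mat).
Proof.
move=> cf; apply/cvg_mxP => i k; rewrite dmxE.
have -> : (fun x => (dmx (fun i0 => cis (f i0 x)) : mat) i k) = (fun x => cis (f i x) *+ (i == k)).
  by apply/funext => x; rewrite dmxE.
case: (i == k); last exact: cvg_cst.
exact: (cvg_cis FF (cf i)).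
Qed.

End XiPath.

(** * Deforming a torus path to one with transversal crossings *)

Section TorusIndex.
Variables (R : realType) (n : nat).
Local Notation C := (Cplx R).
Local Notation mat := 'M[Cplx R]_(n + n).
Local Notation J := (stdJ R n).
Local Notation Sp := (@Sp R n).
Local Notation I := 'I_(n + n).
Variables (V : mat) (kap : I -> R).
Hypothesis kap0 : forall j, kap j != 0.
Hypothesis VJV : dg V *m J *m V = iC R *: krein kap.
Local Notation conjV N := (V *m N *m invmx V).
Let uV := basis_unit kap0 VJV.
Variables (T : R) (w : I -> R) (g : R -> mat).
Hypothesis T0 : 0 < T.
Hypothesis gE : forall t, 0 <= t <= T -> g t = conjV (dmx (fun i => cis (w i * t))).
Hypothesis nres : forall (j : I) (k : int), w j * T / (2 * pi) != k%:~R.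

Let NN : R := (n + n)%:R.
Let phi j := w j * T.
Let yy j := phi j / (2 * pi).
(** Rescaled time, running from 0 to n + n on [T, 2 T]; phase j moves while it lies between j and j
    + 1. *)
Let xx t := NN * (t - T) / T.
Let clamp (x : R) := Num.max 0 (Num.min x 1).
Let uu (j : I) t := clamp (xx t - j%:R).
(* In the deformed path the common phase first grows from 0 to pi along [xi];
   then the phases move one after the other from pi to their final values. *)
Let theta (j : I) t := pi * Num.min (t / T) 1 + uu j t * (phi j - pi).
(** Straight-line homotopy between real lifts of the phases. Both lifts start at 0 and end at
    [phi j], not merely modulo 2 pi, so the end-points stay fixed. *)
Let Phi (j : I) (p : R * R) := (1 - p.1) * (w j * Num.max (p.2 - T) 0) + p.1 * theta j p.2.
Let H (p : R * R) : mat := xi n T (Num.min p.2 T) *m conjV (dmx (fun i => cis (Phi i p))).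
(** The fraction of window j after which the phase, moving from pi to [phi j], equals 2 pi l. *)
Let qq (j : I) (l : int) : R := (l%:~R - 2^-1) / (yy j - 2^-1).
Let time (p : I * int) : R := T + T / NN * (p.1%:R + qq p.1 p.2).

Let pi0 : 0 < (pi : R). Proof. exact: pi_gt0. Qed.

Let cvg_minr (X : Type) (F : set_system X) (FF : Filter F) (f h : X -> R) (x y : R) :
  f @ F --> x -> h @ F --> y -> (fun t => Num.min (f t) (h t)) @ F --> Num.min x y.
Proof.
move=> fx hy; have e a b : Num.min a b = - Num.max (- a) (- b) :> R by rewrite -oppr_min opprK.
have : (fun t => - Num.max (- f t) (- h t)) @ F --> - Num.max (- x) (- y).
  by apply: cvgN; apply: cvg_maxr; apply: cvgN.
rewrite -e; apply: cvg_trans; apply: near_eq_cvg; apply: nearW => t.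
by rewrite e.
Qed.

Let clamp0 x : x <= 0 -> clamp x = 0.
Proof. by move=> x0; rewrite /clamp min_l ?max_l//; lra. Qed.
Let clamp1 x : 1 <= x -> clamp x = 1.
Proof. by move=> x0; rewrite /clamp min_r ?max_r//; lra. Qed.
Let clampx x : 0 <= x <= 1 -> clamp x = x.
Proof. by move=> /andP[x0 x1]; rewrite /clamp min_l ?max_r//; lra. Qed.

Let cvg_clamp (X : Type) (F : set_system X) (FF : Filter F) (f : X -> R) (x : R) :
  f @ F --> x -> (fun t => clamp (f t)) @ F --> clamp x.
Proof.
by move=> fx; apply: cvg_maxr; [exact: cvg_cst|apply: cvg_minr; [exact: fx|exact: cvg_cst]].
Qed.

Let cvg_xx (X : Type) (F : set_system X) (FF : Filter F) (f : X -> R) (x : R) :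
  f @ F --> x -> (fun t => xx (f t)) @ F --> xx x.
Proof.
move=> fx; apply: cvgM; last exact: cvg_cst.
by apply: cvgM; [exact: cvg_cst|apply: cvgB; [exact: fx|exact: cvg_cst]].
Qed.

Let cvg_theta (X : Type) (F : set_system X) (FF : Filter F) (j : I) (f : X -> R) (x : R) :
  f @ F --> x -> (fun t => theta j (f t)) @ F --> theta j x.
Proof.
move=> fx; apply: cvgD.
  apply: cvgM; first exact: cvg_cst.
  by apply: cvg_minr; [apply: cvgM; [exact: fx|exact: cvg_cst]|exact: cvg_cst].
apply: cvgM; last exact: cvg_cst.
by apply: cvg_clamp; apply: cvgB; [exact: cvg_xx|exact: cvg_cst].
Qed.

Let cvg_Phi (X : Type) (F : set_system X) (FF : Filter F) (j : I) (f : X -> R * R) (p : R * R) :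
  (fun t => (f t).1) @ F --> p.1 -> (fun t => (f t).2) @ F --> p.2 ->
  (fun t => Phi j (f t)) @ F --> Phi j p.
Proof.
move=> f1 f2; apply: cvgD; apply: cvgM.
- by apply: cvgB; [exact: cvg_cst|exact: f1].
- apply: cvgM; first exact: cvg_cst.
  by apply: cvg_maxr; [apply: cvgB; [exact: f2|exact: cvg_cst]|exact: cvg_cst].
- exact: f1.
- exact: cvg_theta.
Qed.

Let min_lt2 t : 2 - Num.min t T / T != 0.
Proof.
have : Num.min t T / T <= 1 by rewrite ler_pdivrMr// mul1r ge_min lexx orbT.
by move=> h; apply/eqP => e; lra.
Qed.

Let cvg_H (p : R * R) : H @ p --> H p.
Proof.
have c1 : (fun q : R * R => q.1) @ p --> p.1 by exact: cvg_fst.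
have c2 : (fun q : R * R => q.2) @ p --> p.2 by exact: cvg_snd.
apply: cvg_mulmx.
  apply: cvg_xi; first exact: min_lt2.
  by apply: cvg_minr; [exact: c2|exact: cvg_cst].
apply: cvg_mulmx; last exact: cvg_cst.
apply: cvg_mulmx; first exact: cvg_cst.
by apply: cvg_dmx => i; apply: cvg_Phi; [exact: c1|exact: c2].
Qed.

Let dmx_cst (c : R) : dmx (fun _ : I => cis c) = (cis c)%:M :> mat.
Proof. by apply/matrixP => i k; rewrite dmxE !mxE. Qed.

Let conj_cst (c : R) : conjV (dmx (fun _ : I => cis c)) = (cis c)%:M.
Proof. by rewrite dmx_cst mul_mx_scalar -scalemxAl mulmxV// scalemx1. Qed.

Let SpH p : Sp (H p).
Proof.
apply: SpM; first by apply: Sp_xi; exact: min_lt2.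
by apply: (Sp_conj kap0 VJV); apply: isoK_dmx => i; exact: cis_conjM.
Qed.

Let H0 t : 0 <= t <= T + T -> H (0, t) = concat_xi T g t.
Proof.
move=> /andP[t0 t2]; rewrite /H /concat_xi /=; case: ifP => [tT|/negbT].
  rewrite min_l//; have -> : (fun i => cis (Phi i (0, t))) = (fun _ : I => cis 0).
    apply/funext => i; rewrite /Phi /= subr0 mul1r mul0r addr0 max_r ?mulr0//.
    by rewrite subr_le0.
  by rewrite conj_cst cis0 mulmx1.
rewrite -ltNge => tT; rewrite min_r ?ltW// xiT ?gt_eqF// mul1mx gE; last first.
  by apply/andP; split; lra.
have -> : (fun i => cis (Phi i (0, t))) = (fun i => cis (w i * (t - T))); last by [].
apply/funext => i; rewrite /Phi /= subr0 mul1r mul0r addr0.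
by rewrite max_l// subr_ge0 ltW.
Qed.

Let xx_le0 t : t <= T -> xx t <= 0.
Proof.
move=> tT; rewrite /xx pmulr_lle0 ?invr_gt0//.
by rewrite mulr_ge0_le0 ?ler0n// subr_le0.
Qed.

Let thetaT j t : t <= T -> theta j t = pi * (t / T).
Proof.
move=> tT; rewrite /theta /uu clamp0; last first.
  by have := xx_le0 tT; have := ler0n R j; lra.
by rewrite mul0r addr0 min_l// ler_pdivrMr// mul1r.
Qed.

Let theta_end j : theta j (T + T) = phi j.
Proof.
rewrite /theta /uu clamp1; last first.
  rewrite /xx addrK mulfK ?gt_eqF// lerBrDr /NN -[1]/(1%:R) -natrD ler_nat.
  exact: ltn_ord.
rewrite mul1r min_r; first by ring.
by rewrite mulrDl divff ?gt_eqF//; lra.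
Qed.

Let phiE j : phi j - pi = 2 * pi * (yy j - 2^-1).
Proof. by rewrite /yy; move: (phi j) (pi : R) pi0 => f p p0; field; rewrite gt_eqF. Qed.

Let phi_nres j : cis (phi j) != 1.
Proof.
apply/eqP => /cis_eq1[k e]; have /eqP := nres j k; apply.
by rewrite -/(phi j) e mulrAC divff ?mul1r// mulf_neq0 ?gt_eqF.
Qed.

Let cispi : cis pi != 1 :> C.
Proof.
apply/eqP => /(congr1 (@reC R)); rewrite reC_cis cospi -(rmorph1 (@toC R)) reC_toC => h; lra.
Qed.

Let H1 t : T <= t -> H (1, t) = conjV (dmx (fun i => cis (theta i t))).
Proof.
move=> tT; rewrite /H /= min_r// xiT ?gt_eqF// mul1mx.
have -> : (fun i => cis (Phi i (1, t))) = (fun i => cis (theta i t)); last by [].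
by apply/funext => i; rewrite /Phi /= subrr mul0r add0r mul1r.
Qed.

(** The eigenvalues are d c and c / d with |c| = 1 and d = 2 - t / T >= 1. One of them can equal 1
    only if d = 1, that is t = T, and then c = cis pi = -1. *)
Let H1_early t : 0 <= t <= T -> \det (H (1, t) - 1%:M) != 0.
Proof.
move=> /andP[t0 tT]; rewrite /H /= min_l//.
have -> : (fun i => cis (Phi i (1, t))) = (fun _ : I => cis (pi * (t / T))).
  by apply/funext => i; rewrite /Phi /= subrr mul0r add0r mul1r thetaT.
rewrite conj_cst det_xi_scalar; set c := cis _; set d := 2 - t / T.
have d1 : 1 <= d by rewrite /d; have : t / T <= 1; [rewrite ler_pdivrMr// mul1r|lra].
have nc : `|c| = 1.
  rewrite normCE reC_cis imC_cis cos2Dsin2 sqrtr1; exact: rmorph1.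
have key (r : R) : 0 < r -> toC r * c = 1 -> r = 1 /\ c = 1.
  move=> r0 h; have rn : r = 1.
    have := congr1 Num.norm h; rewrite normrM nc mulr1 norm_toC gtr0_norm// normr1.
    by rewrite -(rmorph1 (@toC R)) => /toC_inj.
  by split=> //; rewrite rn rmorph1 mul1r in h.
have cT (r : R) : 0 < r -> (r = 1 -> d = 1) -> toC r * c != 1.
  move=> r0 rd; apply/eqP => /(key r r0)[/rd d1' c1].
  have tT' : t / T = 1 by rewrite /d in d1'; lra.
  by move: c1; rewrite /c tT' mulr1 => /eqP; rewrite (negbTE cispi).
apply: mulf_neq0; apply: expf_neq0; rewrite subr_eq0; apply: cT => //; try lra.
  by rewrite invr_gt0; lra.
by move=> /(congr1 (@GRing.inv _)); rewrite invrK invr1.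
Qed.

Let slj j : R := (phi j - pi) * NN / T.

Let window (j : I) t := j%:R < xx t < j%:R + 1.

Let xx_gt0 t : 0 < xx t -> T < t.
Proof. by move=> h; rewrite ltNge; apply/negP => /xx_le0; lra. Qed.

Let window_theta (j i : I) t : window j t ->
  theta i t = if (i < j)%N then phi i else if i == j then pi + (xx t - j%:R) * (phi j - pi) else pi.
Proof.
move=> /andP[h1 h2]; have tT : T < t by apply: xx_gt0; have := ler0n R j; lra.
rewrite /theta min_r; last by rewrite ler_pdivlMr// mul1r ltW.
rewrite mulr1 /uu; case: ltngtP => ij.
- rewrite clamp1; first by ring.
  by have : (i.+1%:R : R) <= j%:R; [rewrite ler_nat|rewrite -natr1; lra].
- rewrite clamp0; last first.
    by have : (j.+1%:R : R) <= i%:R; [rewrite ler_nat|rewrite -natr1; lra].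
  rewrite mul0r addr0; case: eqP => // e; move: ij; rewrite e ltnn; by [].
- have -> : i = j by exact: val_inj.
  by rewrite eqxx clampx//; apply/andP; split; lra.
Qed.

Let NN_gt0 (j : I) : 0 < NN.
Proof. by rewrite /NN ltr0n (leq_ltn_trans _ (ltn_ord j)). Qed.

Let xx_time p : xx (time p) = p.1%:R + qq p.1 p.2.
Proof.
rewrite /xx /time; have := NN_gt0 p.1; rewrite [T + _]addrC addrK.
move: NN (_ + qq _ _) => N a N0; by field; rewrite !gt_eqF.
Qed.

Let LL (j : I) := between_half (Num.floor (yy j)).

Let LLP j l : (l \in LL j) = (0 < qq j l < 1).
Proof. by apply: between_halfP => k; exact: nres. Qed.

Let window_time p : p.2 \in LL p.1 -> window p.1 (time p).
Proof. by rewrite LLP /window xx_time => /andP[h1 h2]; apply/andP; split; lra. Qed.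

Let qq_phi j l : l \in LL j -> pi + qq j l * (phi j - pi) = 2 * pi * l%:~R.
Proof.
rewrite LLP => /andP[q0 _]; have y0 : yy j - 2^-1 != 0.
  by apply: contraTneq q0; rewrite /qq => ->; rewrite invr0 mulr0 ltxx.
by rewrite phiE mulrCA /qq divfK//; field.
Qed.

(** Neither the waiting value pi nor the final value [phi j] is a multiple of 2 pi, so a phase that
    is one lies strictly inside its window, where the motion is linear and can be solved for t. *)
Let zero_time t : T <= t <= T + T -> \det (H (1, t) - 1%:M) = 0 ->
  exists p, p.2 \in LL p.1 /\ t = time p.
Proof.
move=> /andP[tT t2]; rewrite H1// (det_conj_sub1 kap0 VJV) det_dmx_sub1 => /eqP.
move=> /prodf_eq0[j _]; rewrite subr_eq0 => /eqP/cis_eq1[l e].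
have e1 : theta j t = pi + uu j t * (phi j - pi).
  by rewrite /theta min_r ?mulr1// ler_pdivlMr// mul1r.
rewrite e in e1.
have N0 := NN_gt0 j.
have upi : uu j t != 0.
  apply/eqP => u0; move: e1; rewrite u0 mul0r addr0 => e1.
  by have := cispi; rewrite -e1 cis2pi_int eqxx.
have u1 : uu j t != 1.
  apply/eqP => u1; move: e1; rewrite u1 mul1r addrC subrK => e1.
  by have := phi_nres j; rewrite -e1 cis2pi_int eqxx.
have x0 : 0 < xx t - j%:R.
  by rewrite ltNge; apply/negP => /clamp0 h; rewrite /uu h eqxx in upi.
have x1 : xx t - j%:R < 1.
  by rewrite ltNge; apply/negP => /clamp1 h; rewrite /uu h eqxx in u1.
have ux : uu j t = xx t - j%:R by rewrite /uu clampx//; apply/andP; split; lra.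
have ql : qq j l = xx t - j%:R.
  have p2 : 2 * pi != 0 :> R by rewrite mulf_neq0// gt_eqF.
  have y0 : yy j - 2^-1 != 0.
    apply/eqP => y0; move: e1; rewrite phiE y0 !mulr0 addr0 => e1.
    by have := cispi; rewrite -e1 cis2pi_int eqxx.
  rewrite /qq -ux; apply: (mulIf y0); rewrite divfK//; apply: (mulfI p2).
  rewrite [LHS](_ : _ = 2 * pi * l%:~R - pi); last by field.
  by rewrite e1 phiE; ring.
exists (j, l); split; first by rewrite LLP ql x0 x1.
rewrite /time /= ql; have -> : j%:R + (xx t - j%:R) = xx t by ring.
by rewrite /xx; move: NN N0 => N N0'; field; rewrite !gt_eqF.
Qed.

Let time_crossing p : p.2 \in LL p.1 ->
  crossing (fun t => H (1, t)) (time p) (sgz (slj p.1 * kap p.1)).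
Proof.
case: p => j l /= jl; have wt := @window_time (j, l) jl; rewrite /= in wt.
have N0 := NN_gt0 j.
have /andP[q0 q1] : 0 < qq j l < 1 by rewrite -LLP.
have xE := xx_time (j, l); rewrite /= in xE.
apply: (torus_crossing kap0 VJV (th := fun i => theta i (time (j, l)))).
- have cx : xx @ time (j, l) --> xx (time (j, l)) by apply: cvg_xx; exact: cvg_id.
  have n1 : \forall t \near time (j, l), j%:R < xx t.
    by apply: (cvgr_gt _ cx); rewrite xE; lra.
  have n2 : \forall t \near time (j, l), xx t < j%:R + 1.
    by apply: (cvgr_lt _ cx); rewrite xE; lra.
  apply: filterS (filterI n1 n2) => t [t1 t2].
  have wt' : window j t by apply/andP.
  have tT : T < t by apply: xx_gt0; have := ler0n R j; lra.
  rewrite (H1 (ltW tT)).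
  have -> : (fun i => cis (theta i t)) = (fun i => cis (theta i (time (j, l)) +
     (if i == j then slj j * (t - time (j, l)) else 0))); last by [].
  apply/funext => i; congr cis; rewrite (window_theta _ wt') (window_theta _ wt).
  case: ltnP => ij; first by rewrite (ltn_eqF ij : (i == j) = false) addr0.
  have [ej|_] := eqVneq i j; last by rewrite addr0.
  by rewrite /slj /xx; move: (time _) NN (phi j) (pi : R) T0 => tm N f p T1; field; rewrite gt_eqF.
- rewrite (window_theta _ wt) ltnn eqxx xE [_ + qq _ _]addrC addrK qq_phi//.
  exact: cis2pi_int.
- move=> i ij; rewrite (window_theta _ wt) (negbTE ij); case: ifP => _; first exact: phi_nres.
  exact: cispi.
- have p2 : 2 * pi != 0 :> R by rewrite mulf_neq0// gt_eqF.
  apply: mulf_neq0; last by rewrite invr_eq0 gt_eqF.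
  apply: mulf_neq0; last by rewrite gt_eqF.
  rewrite phiE; apply: mulf_neq0 => //.
  by apply/eqP => y0; move: q0; rewrite /qq y0 invr0 mulr0 ltxx.
Qed.

Let pairs := [seq (j, l) | j <- enum I, l <- LL j].
Let times := map time pairs.
(** Signs have to be a function of the time alone; the windows are disjoint, so at most one term is
    present. *)
Let ee t : int := \sum_j (if window j t then sgz (slj j * kap j) else 0).

Let mem_pairs p : (p \in pairs) = (p.2 \in LL p.1).
Proof.
apply/allpairsPdep/idP => [[j [l [_ jl ->]]]//|h].
by exists p.1, p.2; rewrite mem_enum -surjective_pairing.
Qed.

Let window_uniq j i t : window j t -> window i t -> i = j.
Proof.
move=> /andP[a1 a2] /andP[b1 b2]; apply: val_inj.
have lt_cast (a b : nat) : (a < b)%N -> (a%:R : R) + 1 <= b%:R.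
  by move=> ab; rewrite natr1 ler_nat.
have [/lt_cast ij|/lt_cast ij|//] := ltngtP (i : nat) j; exfalso; lra.
Qed.

Let uniq_times : uniq times.
Proof.
rewrite map_inj_in_uniq.
  apply: allpairs_uniq_dep => [|j _|[j l] [j' l'] _ _ [-> ->]] //; first exact: enum_uniq.
  exact: between_half_uniq.
move=> [j l] [j' l']; rewrite !mem_pairs /= => jl jl' e.
have w1 := @window_time (j, l) jl; have w2 := @window_time (j', l') jl'; rewrite /= in w1 w2.
rewrite e in w1; have jj : j' = j by exact: window_uniq w1 w2.
subst j'; congr pair.
have := congr1 xx e; rewrite !xx_time /= => /addrI.
move: jl; rewrite LLP /qq => /andP[q0 _].
have y0 : yy j - 2^-1 != 0.
  by apply: contraTneq q0 => ->; rewrite invr0 mulr0 ltxx.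
by move=> /(mulIf (_ : (yy j - 2^-1)^-1 != 0)); rewrite invr_eq0 => /(_ y0)/addIr/eqP; rewrite eqr_int => /eqP.
Qed.

Let ee_time p : p.2 \in LL p.1 -> ee (time p) = sgz (slj p.1 * kap p.1).
Proof.
move=> pl; rewrite /ee (bigD1 p.1)//= window_time// big1 ?addr0// => i ip.
case: ifP => // wi; have := window_uniq (window_time pl) wi => e.
by rewrite e eqxx in ip.
Qed.

Let sum_ee : \sum_(t <- times) ee t = \sum_j sgz (kap j) * Num.floor (yy j).
Proof.
rewrite big_map big_seq (eq_bigr (fun p => sgz (slj p.1 * kap p.1))); last first.
  by move=> p; rewrite mem_pairs => /ee_time.
rewrite -big_seq /pairs big_allpairs_dep /= big_enum /=.
apply: eq_bigr => j _; rewrite -[in RHS](sum_between_half (nres j)) big_distrr /=.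
apply: eq_bigr => l _; rewrite sgzM mulrC; congr (_ * _).
have N0 := NN_gt0 j.
have -> : slj j = (2 * pi * NN / T) * (yy j - 2^-1) by rewrite /slj phiE; ring.
by rewrite sgzM gtr0_sgz ?mul1r// divr_gt0// !mulr_gt0.
Qed.

Lemma torus_index : is_intersection_number (T + T) (concat_xi T g)
  (\sum_j sgz (kap j) * Num.floor (w j * T / (2 * pi))).
Proof.
have T2 : 0 < T + T by rewrite addr_gt0.
exists (fun t => H (1, t)); split.
  exists H; split.
  - by apply: continuous_subspaceT => p; exact: cvg_H.
  - by move=> p _; exact: SpH.
  - by move=> t; rewrite in_itv/= => tI; rewrite H0.
  - move=> s _; rewrite -!H0; try by apply/andP; split; lra.
    split; rewrite /H /=.
      have -> : (fun i => cis (Phi i (s, 0))) = (fun i => cis (Phi i (0, 0))); last by [].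
      apply/funext => i; rewrite /Phi /= max_r; last by rewrite sub0r oppr_le0 ltW.
      by rewrite !mulr0 thetaT ?(ltW T0)// mul0r !mulr0.
    have -> : (fun i => cis (Phi i (s, T + T))) = (fun i => cis (Phi i (0, T + T))); last by [].
    apply/funext => i; rewrite /Phi /= theta_end addrK max_l ?(ltW T0)// /phi.
    by congr cis; ring.
exists times, ee; split.
- exact: uniq_times.
- move=> t; split.
    move=> /mapP[p]; rewrite mem_pairs => pl ->; have wt := window_time pl.
    have N0 := NN_gt0 p.1.
    have tT : T < time p by apply: xx_gt0; move: wt => /andP[]; have := ler0n R p.1; lra.
    have t2 : time p <= T + T.
      move: wt => /andP[_]; have : (p.1.+1%:R : R) <= NN by rewrite ler_nat.
      rewrite -natr1 => a1 a2; have {a1 a2} : xx (time p) < NN by lra.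
      rewrite /xx ltr_pdivrMr// ltr_pM2l//; lra.
    split; first by rewrite in_itv/= t2 andbT; lra.
    apply/maslov_cycleP; split; first exact: SpH.
    have [a [Y [M1 _ _ _ _]]] := time_crossing pl.
    by apply: (iffLR (maslov_cycleP _) _).2; exists 1%N.
  move=> [tI /maslov_cycleP[_ d0]]; move: tI; rewrite in_itv/= => /andP[t0 t2].
  have [tT|tT] := leP t T.
    by have := H1_early (t := t); rewrite t0 tT d0 eqxx => /(_ isT).
  have [|p [pl ->]] := zero_time (t := t) _ d0; first by rewrite ltW.
  by apply/mapP; exists p => //; rewrite mem_pairs.
- by move=> t /mapP[p]; rewrite mem_pairs => pl ->; rewrite ee_time//; exact: time_crossing.
- by rewrite sum_ee.
Qed.
End TorusIndex.

Lemma eigenvalue1_det (F : fieldType) (N : nat) (A : 'M[F]_N) :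
  eigenvalue A 1 = (\det (A - 1%:M) == 0).
Proof.
apply/eigenvalueP/det0P => -[v].
  by rewrite scale1r => vA v0; exists v; rewrite // mulmxBr mulmx1 vA subrr.
move=> v0 /eqP; rewrite mulmxBr mulmx1 subr_eq0 => /eqP vA.
by exists v; rewrite ?scale1r.
Qed.

Section TorusI1.
Variables (R : realType) (n : nat).
Local Notation C := (Cplx R).
Local Notation mat := 'M[Cplx R]_(n + n).
Local Notation J := (stdJ R n).
Variables (V : mat) (kap : 'I_(n + n) -> R).
Hypothesis kap0 : forall j, kap j != 0.
Hypothesis VJV : dg V *m J *m V = iC R *: krein kap.
Variables (T : R) (w : 'I_(n + n) -> R) (g : R -> mat).
Hypothesis T0 : 0 < T.
Hypothesis gE : forall t, 0 <= t <= T -> g t = V *m dmx (fun i => cis (w i * t)) *m invmx V.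

Lemma torus_det : \det (g T - 1%:M) = \prod_i (cis (w i * T) - 1).
Proof.
rewrite gE; last by rewrite ltW //= lexx.
by rewrite (det_conj_sub1 kap0 VJV) det_dmx_sub1.
Qed.

Hypothesis nres : forall j (k : int), w j * T / (2 * pi) != k%:~R.

Lemma torus_det_neq0 : \det (g T - 1%:M) != 0.
Proof.
rewrite torus_det; apply/prodf_neq0 => i _; rewrite subr_eq0; apply/eqP => /cis_eq1[m e].
have p0 : (2 * pi : R) != 0 by rewrite mulf_neq0 ?lt0r_neq0 ?pi_gt0.
by have /eqP := nres i m; apply; rewrite e mulrC mulKf.
Qed.

Lemma i1_torus : i1 T g = ((\sum_j sgz (kap j) * Num.floor (w j * T / (2 * pi)))%:~R)%:E.
Proof.
rewrite /i1 /Defs.nondegenerate eigenvalue1_det (negbTE torus_det_neq0) /=.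
congr ((_ %:~R)%:E); rewrite /i1_nondegenerate; apply: intersection_number_uniq.
- by rewrite addr_gt0.
- rewrite /concat_xi (ltW T0) -[xi _ _ _]mulmx1 (det_xi_scalar n T 0 1).
  by rewrite mulf_neq0// expf_neq0// mul0r subr0 mulr1 -(rmorph1 (@toC R)) -rmorphB toC_eq0; apply/eqP; lra.
- have -> : concat_xi T g (T + T) = g T.
    by rewrite /concat_xi ifF ?addrK// gerDl leNgt T0.
  exact: torus_det_neq0.
- exact: (torus_index kap0 VJV T0 gE nres).
Qed.

End TorusI1.

(** * The Lagrangian solution *)

Section ExpDiag.
Variables (R : realType) (N : nat).
Local Notation C := (Cplx R).
Variables (Lam : 'M[R]_N.+1) (V : 'M[C]_N.+1) (om : 'I_N.+1 -> R).
Hypothesis LV : map_mx (@toC R) Lam *m V = V *m diag_mx (\row_j (iC R * toC (om j))).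
Hypothesis uV : V \in unitmx.

(** Written with the parity factors of [cos_coeff] and [sin_coeff], so that the series can be
    compared term by term. *)
Lemma iC_expn m : iC R ^+ m = toC ((~~ odd m)%:R * (-1) ^+ m./2) +
   iC R * toC ((odd m)%:R * (-1) ^+ m.-1./2).
Proof.
rewrite -[in LHS](odd_double_half m) exprD -mul2n exprM expr2 iC2.
have -> : (-1 : C) = toC (-1) by rewrite rmorphN rmorph1.
case o : (odd m); rewrite /= -rmorphXn.
  have -> : m.-1./2 = m./2 by rewrite -[in LHS](odd_double_half m) o /= doubleK.
  by rewrite mul0r rmorph0 add0r expr1 mul1r.
by rewrite expr0 mul0r rmorph0 mulr0 addr0 !mul1r.
Qed.

Lemma exp_coeffE (x : R) m : toC (m`!%:R^-1) * (iC R * toC x) ^+ m =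
  toC (cos_coeff x m) + iC R * toC (sin_coeff x m).
Proof.
rewrite exprMn iC_expn /cos_coeff /sin_coeff !rmorphM /= !rmorphXn /=; ring.
Qed.

Lemma cvg_exp_cis (x : R) :
  (fun n : nat => \sum_(0 <= m < n) toC (m`!%:R^-1) * (iC R * toC x) ^+ m) @ \oo --> cis x.
Proof.
have -> : (fun n : nat => \sum_(0 <= m < n) toC (m`!%:R^-1) * (iC R * toC x) ^+ m) =
   (fun n : nat => toC (series (cos_coeff x) n) + iC R * toC (series (sin_coeff x) n)).
  apply/funext => n; rewrite /series /= !rmorph_sum /= mulr_sumr -big_split /=.
  by apply: eq_bigr => m _; rewrite exp_coeffE.
have hc : series (cos_coeff x) @ \oo --> cos x.
  by have := @is_cvg_series_cos_coeff R x; rewrite cos.unlock.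
have hs : series (sin_coeff x) @ \oo --> sin x.
  by have := @is_cvg_series_sin_coeff R x; rewrite sin.unlock.
by apply: cvgD; [exact: (cvg_toC _ hc)|apply: cvgM; [exact: cvg_cst|exact: (cvg_toC _ hs)]].
Qed.

Lemma map_exp_term t m : map_mx (@toC R) ((m`!%:R : R)^-1 *: (t *: Lam) ^+ m) *m V =
  V *m diag_mx (\row_j (toC (m`!%:R^-1) * (iC R * toC (om j * t)) ^+ m)).
Proof.
have D z u : diag_mx (\row_j z j) *m diag_mx (\row_j u j) = diag_mx (\row_j (z j * u j)) :> 'M[C]_N.+1.
  by rewrite mulmx_diag; congr diag_mx; apply/rowP => j; rewrite !mxE.
have h : map_mx (@toC R) ((t *: Lam) ^+ m) *m V = V *m diag_mx (\row_j ((iC R * toC (om j * t)) ^+ m)).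
  elim: m => [|m ih].
    rewrite expr0 map_mx1 mul1mx -[LHS]mulmx1; congr (_ *m _).
    by rewrite -diag_const_mx; congr diag_mx; apply/rowP => j; rewrite !mxE.
  rewrite exprSr -mulmxE map_mxM -mulmxA map_mxZ -scalemxAl LV.
  have -> : toC t *: (V *m diag_mx (\row_j (iC R * toC (om j)))) =
      V *m diag_mx (\row_j (iC R * toC (om j * t))).
    rewrite scalemxAr; congr (_ *m _); apply/matrixP => i k; rewrite !mxE.
    by rewrite mulrnAr rmorphM /= mulrC mulrA.
  rewrite mulmxA ih -mulmxA D; congr (_ *m diag_mx _); apply/rowP => j.
  by rewrite !mxE exprSr.
rewrite map_mxZ -scalemxAl h scalemxAr; congr (_ *m _); apply/matrixP => i k; rewrite !mxE.
by rewrite mulrnAr.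
Qed.

(** Convergence is obtained over the complex numbers in the eigenbasis. Real parts then give the
    limit of the real series, and imaginary parts, all 0 along the sequence, show that the limit is
    real. *)
Lemma map_expmx t : map_mx (@toC R) (expmx (t *: Lam)) =
  V *m diag_mx (\row_j cis (om j * t)) *m invmx V.
Proof.
set P := V *m _ *m _; pose S n := series (fun m : nat => (m`!%:R : R)^-1 *: (t *: Lam) ^+ m) n.
have FN : Filter (\oo : set_system nat) by exact: _.
have SE n : map_mx (@toC R) (S n) =
   V *m diag_mx (\row_j \sum_(0 <= m < n) toC (m`!%:R^-1) * (iC R * toC (om j * t)) ^+ m) *m invmx V.
  rewrite -[LHS](mulmxK uV); congr (_ *m _).
  rewrite /S /series /= map_mx_sum mulmx_suml (eq_bigr _ (fun m _ => map_exp_term t m)) -mulmx_sumr.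
  congr (_ *m _); apply/matrixP => i k; rewrite summxE !mxE -sumrMnl.
  by apply: eq_bigr => m _; rewrite !mxE.
have cS : (fun n => map_mx (@toC R) (S n)) @ \oo --> P.
  have -> : (fun n => map_mx (@toC R) (S n)) = (fun n => V *m diag_mx (\row_j \sum_(0 <= m < n)
     toC (m`!%:R^-1) * (iC R * toC (om j * t)) ^+ m) *m invmx V) by exact/funext.
  apply: cvg_mulmx; last exact: cvg_cst.
  apply: cvg_mulmx; first exact: cvg_cst.
  apply/cvg_mx_coordP => i k.
  have -> : (diag_mx (\row_j cis (om j * t)) : 'M[C]_N.+1) i k = cis (om i * t) *+ (i == k) by rewrite !mxE.
  under eq_fun do rewrite !mxE.
  by case: (i == k); [exact: cvg_exp_cis|exact: cvg_cst].
have c1 : S @ \oo --> map_mx (@reC R) P.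
  apply/cvg_mx_coordP => i k; rewrite mxE.
  have := cvg_reC FN ((cvg_mx_coordP FN _ _).1 cS i k).
  have -> : reC (R:=R) \o (fun n => map_mx (@toC R) (S n) i k) = (fun n => S n i k).
    by apply/funext => n /=; rewrite mxE reC_toC.
  exact.
have im0 i k : imC (P i k) = 0.
  have h := cvg_imC FN ((cvg_mx_coordP FN _ _).1 cS i k).
  apply: (cvg_unique _ h) => //.
  have -> : imC (R:=R) \o (fun n => map_mx (@toC R) (S n) i k) = cst 0.
    by apply/funext => n /=; rewrite mxE imC_toC.
  exact: cvg_cst.
rewrite /expmx (cvg_lim _ c1); last exact: norm_hausdorff.
by apply/matrixP => i k; rewrite 2!mxE; apply: cplxP; rewrite ?reC_toC ?imC_toC ?im0.
Qed.

End ExpDiag.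

(** * Eigenvectors of the linearised system *)

Section LagrangeBasis.
Variable R : realType.
Local Notation C := (Cplx R).
Local Notation mat := 'M[Cplx R]_(2 + 2).
Local Notation J := (stdJ R 2).

Lemma dgJE (V : mat) j k : (dg V *m J *m V) j k =
  - (Num.conj (V (lshift 2 0) j) * V (rshift 2 0) k)
  - Num.conj (V (lshift 2 1) j) * V (rshift 2 1) k
  + Num.conj (V (rshift 2 0) j) * V (lshift 2 0) k
  + Num.conj (V (rshift 2 1) j) * V (lshift 2 1) k.
Proof.
have -> : dg V *m J *m V = dg V *m col_mx (- dsubmx V) (usubmx V).
  rewrite -mulmxA; congr (_ *m _).
  by rewrite -{1}(vsubmxK V) /stdJ mul_block_col !mul0mx mulNmx !mul1mx add0r addr0.
rewrite mxE big_split_ord /= !big_ord_recl !big_ord0 !addr0.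
rewrite !(col_mxEu, col_mxEd) !mxE !mulrN.
have -> : lift ord0 ord0 = 1 :> 'I_2 by apply/val_inj.
by rewrite addrA.
Qed.

Variables A B : R.
Hypothesis A1 : A + 1 != 0.

(** With last entry 2, the second and third rows of the eigenvector equation determine this first
    entry, and the first row determines [lag_c]. The remaining condition x^2 c = - (b + 2) is the
    characteristic equation. *)
Definition lag_b (x : R) := B - 1 + x ^+ 2.
Definition lag_c (x : R) := (lag_b x - 2) / (A + 1).

(* The eigenvector of [lag_mx] for the eigenvalue [i x], normalised by its last entry. *)
Definition lag_vec (x : R) : seq C :=
  [:: toC (lag_b x); iC R * toC (x * (lag_c x + 2)); iC R * toC (x * lag_c x); toC 2].

Definition lag_basis (om : 'I_(2 + 2) -> R) : mat := \matrix_(i, j) (lag_vec (om j))`_i.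

(** The symplectic pairing of two eigenvectors divided by i. Its first factor vanishes for opposite
    frequencies, its second for frequencies whose squares are the two different roots. *)
Definition lag_form (x y : R) := (x + y) * (4 - (lag_b x - 2) * (lag_b y - 2) / (A + 1)).

Lemma lag_basis_form om j k :
  (dg (lag_basis om) *m J *m lag_basis om) j k = iC R * toC (lag_form (om j) (om k)).
Proof.
rewrite dgJE !mxE /=; set x := om j; set y := om k.
have -> : lag_form x y = - (lag_b x * (y * lag_c y)) + x * (lag_c x + 2) * 2
  - x * lag_c x * lag_b y + 2 * (y * (lag_c y + 2)).
  by rewrite /lag_form /lag_c; field.
move: (lag_b x) (lag_b y) (lag_c x) (lag_c y) => bx bby cx cy.
rewrite !(rmorphD, rmorphB, rmorphN, rmorphM) /= conj_iC !conj_toC.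
ring.
Qed.

Definition lag_mx : 'M[R]_4 := \matrix_(i, j)
  (nth [::] [:: [:: 0; 1; A; 0]; [:: -1; 0; 0; B]; [:: 1; 0; 0; 1]; [:: 0; 1; -1; 0]] i)`_j.

Lemma lag_basis_eigen om :
  (forall j, om j ^+ 4 - (2 - A - B) * om j ^+ 2 + (A * B + A + B + 1) = 0) ->
  map_mx (@toC R) lag_mx *m lag_basis om = lag_basis om *m diag_mx (\row_j (iC R * toC (om j))).
Proof.
move=> h; apply/matrixP => i j; rewrite mul_mx_diag [RHS]mxE [X in _ * X]mxE mxE.
have hj := h j.
set x := om j in hj *.
rewrite !big_ord_recl big_ord0 !mxE /=.
have e : x ^+ 2 * lag_c x = - (lag_b x + 2).
  rewrite /lag_c /lag_b mulrA.
  apply: (canLR (mulfK A1)).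
  by rewrite -[LHS]subr0 -hj; ring.
have e1 : lag_c x * (A + 1) = lag_b x - 2 by rewrite /lag_c mulfVK.
have {}e1 : x * (lag_c x * (A + 1)) = x * (lag_b x - 2) by rewrite e1.
case: i => [] [|[|[|[|i]]]] //= _; apply: cplxP; rewrite ?(reCM, imCM, raddfD, reC_toC, imC_toC, reC_i, imC_i)/=.
all: rewrite ?(raddfN, raddf0)/= ?(reC_toC, imC_toC)/= -/x.
all: clear h hj; move: e e1; rewrite /lag_b; move: (lag_c x) => c e e1; clear -e e1; lra.
Qed.

End LagrangeBasis.

(** * Squared frequencies as coordinates on the stability region *)

Section Frequencies.
Variable R : realType.
Implicit Types (p : R * R) (x y : R).
Local Notation C := (Cplx R).
Local Notation mat := 'M[Cplx R]_(2 + 2).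

(* [freq_hi] and [freq_lo] are the squares of the frequencies, that is the roots of
   [w ^ 2 - (2 - alpha) w + (alpha + 2) ^ 2 beta / 36]; [freq_point] recovers [(beta, alpha)]. *)
Definition freq_disc p := (2 - p.2) ^+ 2 - (p.2 + 2) ^+ 2 * p.1 / 9.
Definition freq_hi p := (2 - p.2 + Num.sqrt (freq_disc p)) / 2.
Definition freq_lo p := (2 - p.2 - Num.sqrt (freq_disc p)) / 2.

(** The defining inequality of [LS] is positivity of the discriminant. The bound 2 on the squared
    frequencies is what limits l to the integer part of sqrt 2 k. *)
Lemma LSP p : LS R p -> [/\ 0 < freq_lo p, freq_lo p < freq_hi p, freq_hi p < 2,
  freq_hi p + freq_lo p = 2 - p.2 & freq_hi p * freq_lo p = (p.2 + 2) ^+ 2 * p.1 / 36].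
Proof.
case: p => be al [[/=/andP[b0 b9]]]; rewrite /alpha_range /= in_itv/= => /andP[a0 a2] bl.
have a4 : 0 < (al + 2) ^+ 2 by rewrite exprn_gt0//; lra.
have m0 : 0 < (al + 2) ^+ 2 * be by rewrite mulr_gt0.
have d0 : 0 < freq_disc (be, al).
  rewrite /freq_disc /= subr_gt0 ltr_pdivrMr//.
  by move: bl; rewrite expr_div_n mulrA ltr_pdivlMr//; nra.
have d2 : freq_disc (be, al) < (2 - al) ^+ 2 by rewrite /freq_disc /=; lra.
set d := Num.sqrt (freq_disc (be, al)).
have dd : d ^+ 2 = freq_disc (be, al) by rewrite sqr_sqrtr// ltW.
have d_gt0 : 0 < d by rewrite sqrtr_gt0.
have d_lt : d < 2 - al by rewrite -dd in d2; rewrite ltNge; apply/negP => h; nra.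
rewrite /freq_lo /freq_hi /= -/d; split; try lra.
suff -> : (2 - al + d) / 2 * ((2 - al - d) / 2) = ((2 - al) ^+ 2 - d ^+ 2) / 4.
  by rewrite dd /freq_disc /=; field.
by field.
Qed.

Definition freq_point x y : R * R := (36 * (x * y) / (4 - x - y) ^+ 2, 2 - x - y).

(** In these coordinates [LS] is a triangle, in which x + y <= 2 expresses alpha >= 0; paths along
    which a single frequency crosses a resonance are then easy to write. *)
Lemma freq_pointP x y : 0 < y -> y < x -> x + y <= 2 ->
  [/\ LS R (freq_point x y), freq_hi (freq_point x y) = x & freq_lo (freq_point x y) = y].
Proof.
move=> y0 yx xy; have a4 : 4 - x - y != 0 by apply: lt0r_neq0; lra.
have a40 : 0 < (4 - x - y) ^+ 2 by rewrite exprn_gt0//; lra.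
have d : Num.sqrt (freq_disc (freq_point x y)) = x - y.
  have -> : freq_disc (freq_point x y) = (x - y) ^+ 2.
    rewrite /freq_disc /freq_point /=.
    have -> : 2 - x - y + 2 = 4 - x - y by lra.
    by field.
  by rewrite sqrtr_sqr gtr0_norm// subr_gt0.
rewrite /freq_hi /freq_lo d /=; split; try lra.
have lt9 : 36 * (x * y) / (4 - x - y) ^+ 2 < 9 * ((x + y) / (4 - x - y)) ^+ 2.
  rewrite expr_div_n [ltRHS]mulrA ltr_pM2r ?invr_gt0//.
  have : 0 < (x - y) ^+ 2 by rewrite exprn_gt0// subr_gt0.
  by lra.
split; last first.
  rewrite /freq_point /=; have -> : 2 - x - y - 2 = - (x + y) by lra.
  have -> : 2 - x - y + 2 = 4 - x - y by lra.
  by rewrite mulNr sqrrN.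
split => /=; last by rewrite /alpha_range /= in_itv/=; apply/andP; split; lra.
apply/andP; split; first by rewrite divr_gt0// !mulr_gt0//; lra.
apply: (le_trans (ltW lt9)); rewrite -[leRHS]mulr1 ler_pM2l// expr_div_n.
by rewrite ler_pdivrMr// mul1r lerXn2r ?nnegrE//; lra.
Qed.

Lemma freq_pointE p : LS R p -> p = freq_point (freq_hi p) (freq_lo p).
Proof.
move=> lsp; have [_ _ _ hs hm] := LSP lsp.
have e : 4 - freq_hi p - freq_lo p = p.2 + 2 by lra.
rewrite /freq_point e hm [LHS]surjective_pairing; congr (_, _); last by lra.
have [[_ ra] _] := lsp; move: ra; rewrite /alpha_range /= in_itv/= => /andP[a0 _].
by field; apply: lt0r_neq0; lra.
Qed.

End Frequencies.

Section LagrangeTorus.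
Variables (R : realType) (p : R * R).
Hypothesis lsp : LS R p.
Local Notation C := (Cplx R).
Local Notation mat := 'M[Cplx R]_(2 + 2).
Local Notation J := (stdJ R 2).

Let s := (p.2 + 2) / 3 * Num.sqrt (9 - p.1).
Let A := (p.2 + s) / 2.
Let B := (p.2 - s) / 2.
Let X := freq_hi p.
Let Y := freq_lo p.

Definition lag_freq (j : 'I_(2 + 2)) : R :=
  [:: Num.sqrt X; - Num.sqrt X; Num.sqrt Y; - Num.sqrt Y]`_j.
Let om := lag_freq.
Let V := lag_basis A B om.
Let kap j := lag_form A B (om j) (om j).

Let s0 : 0 <= s.
Proof.
have [[_ ra] _] := lsp; move: ra; rewrite /alpha_range /= in_itv/= => /andP[a0 _].
by rewrite mulr_ge0 ?sqrtr_ge0//; lra.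
Qed.

Let A1_gt0 : 0 < A + 1.
Proof.
have [[_ ra] _] := lsp; move: ra; rewrite /alpha_range /= in_itv/= => /andP[a0 _].
by have := s0; rewrite /A; lra.
Qed.
Let A1_neq0 : A + 1 != 0 := lt0r_neq0 A1_gt0.

Let Y0 : 0 < Y. Proof. by have [] := LSP lsp. Qed.
Let YX : Y < X. Proof. by have [] := LSP lsp. Qed.
Let X0 : 0 < X. Proof. exact: lt_trans YX. Qed.

Let sumXY : X + Y = 2 - A - B.
Proof. by have [_ _ _ -> _] := LSP lsp; rewrite /A /B; lra. Qed.

Let prodXY : X * Y = A * B + A + B + 1.
Proof.
have [_ _ _ _ ->] := LSP lsp; have [[/andP[_ b9] _] _] := lsp.
have hs : Num.sqrt (9 - p.1) ^+ 2 = 9 - p.1 by rewrite sqr_sqrtr// subr_ge0.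
have -> : A * B + A + B + 1 = ((p.2 + 2) ^+ 2 - s ^+ 2) / 4 by rewrite /A /B; field.
by rewrite /s exprMn hs; field.
Qed.

Let om_sqr j : om j ^+ 2 = X \/ om j ^+ 2 = Y.
Proof.
rewrite /om /lag_freq; case: j => [] [|[|[|[|i]]]] //= _; rewrite ?sqrrN sqr_sqrtr ?ltW//; tauto.
Qed.

Let om_eigen j : om j ^+ 4 - (2 - A - B) * om j ^+ 2 + (A * B + A + B + 1) = 0.
Proof.
by rewrite -sumXY -prodXY (_ : 4 = 2 * 2)%N// exprM; case: (om_sqr j) => ->; ring.
Qed.

(** The characteristic polynomial in x^2, whose roots are X and Y, evaluated at 3 - B. *)
Let bXY : (B - 1 + X - 2) * (B - 1 + Y - 2) = 4 * (A + 1).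
Proof. by have := prodXY; have := sumXY; nra. Qed.

Lemma lag_basis_krein : dg V *m J *m V = iC R *: krein kap.
Proof.
have sx : Num.sqrt X ^+ 2 = X by rewrite sqr_sqrtr// ltW.
have sy : Num.sqrt Y ^+ 2 = Y by rewrite sqr_sqrtr// ltW.
have mixed x y : x ^+ 2 = X -> y ^+ 2 = Y -> lag_form A B x y = 0 /\ lag_form A B y x = 0.
  move=> ex ey; suff h : lag_form A B x y = 0 by split=> //; rewrite -h /lag_form; ring.
  by rewrite /lag_form /lag_b ex ey bXY mulfK// subrr mulr0.
have opp x : lag_form A B x (- x) = 0 /\ lag_form A B (- x) x = 0.
  by rewrite /lag_form subrr addNr !mul0r.
apply/matrixP => j k; rewrite lag_basis_form// mxE /krein !mxE.
have [<-|jk] := eqVneq j k; first by rewrite mulr1n.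
rewrite mulr0n; congr (_ * _); apply/eqP; rewrite toC_eq0; apply/eqP.
rewrite /om /lag_freq.
have [sxN syN] : (- Num.sqrt X) ^+ 2 = X /\ (- Num.sqrt Y) ^+ 2 = Y by rewrite !sqrrN.
have [m1 m1'] := mixed _ _ sx sy.
have [m2 m2'] := mixed _ _ sx syN.
have [m3 m3'] := mixed _ _ sxN sy.
have [m4 m4'] := mixed _ _ sxN syN.
have [q1 q1'] := opp (Num.sqrt X); have [q2 q2'] := opp (Num.sqrt Y).
by case: j k jk => [] [|[|[|[|i]]]] // ? [] [|[|[|[|i']]]] //=.
Qed.

(** By [bXY] the two factors have positive product, and their sum is - s - 4 < 0, so both are
    negative. The sign left over is that of Y - X or X - Y times the frequency: the two pairs of
    frequencies have opposite Krein signs. *)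
Lemma sgz_lag_form j : sgz (kap j) = [:: 1; -1; -1; 1]`_j.
Proof.
have X_b : B - 1 + X - 2 < 0.
  have sum_lt0 : (B - 1 + X - 2) + (B - 1 + Y - 2) < 0.
    by have := sumXY; have := s0; rewrite /A /B; lra.
  have prod_gt0 : 0 < (B - 1 + X - 2) * (B - 1 + Y - 2) by rewrite bXY mulr_gt0.
  rewrite ltNge; apply/negP => hX; have hY : B - 1 + Y - 2 < 0 by lra.
  by move: prod_gt0; rewrite ltNge; apply/negP/negPn; rewrite mulr_ge0_le0// ltW.
have Y_b : B - 1 + Y - 2 < 0 by have := YX; lra.
have kX x : x ^+ 2 = X -> lag_form A B x x = x * (2 * (B - 1 + X - 2) * (Y - X) / (A + 1)).
  move=> ex; rewrite /lag_form /lag_b ex.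
  have -> : 4 = (B - 1 + X - 2) * (B - 1 + Y - 2) / (A + 1) by rewrite bXY mulfK.
  by field.
have kY x : x ^+ 2 = Y -> lag_form A B x x = x * (- (2 * - (B - 1 + Y - 2) * (X - Y) / (A + 1))).
  move=> ex; rewrite /lag_form /lag_b ex.
  have -> : 4 = (B - 1 + X - 2) * (B - 1 + Y - 2) / (A + 1) by rewrite bXY mulfK.
  by field.
have pX : 0 < 2 * (B - 1 + X - 2) * (Y - X) / (A + 1).
  by rewrite divr_gt0// -mulrA mulr_gt0// nmulr_rgt0// subr_lt0 YX.
have pY : 0 < 2 * - (B - 1 + Y - 2) * (X - Y) / (A + 1).
  by rewrite divr_gt0// -mulrA mulr_gt0// mulr_gt0 ?oppr_gt0// subr_gt0 YX.
have sx : Num.sqrt X ^+ 2 = X by rewrite sqr_sqrtr// ltW.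
have sy : Num.sqrt Y ^+ 2 = Y by rewrite sqr_sqrtr// ltW.
have s1 (x : R) : 0 < x -> sgz (Num.sqrt x) = 1 by move=> ?; rewrite gtr0_sgz// sqrtr_gt0.
rewrite /kap /om /lag_freq; case: j => [] [|[|[|[|i]]]] //= _.
- by rewrite kX ?sqrrN// sgzM s1// gtr0_sgz.
- by rewrite kX ?sqrrN// sgzM sgzN s1// gtr0_sgz.
- by rewrite kY ?sqrrN// sgzM sgzN s1// gtr0_sgz.
- by rewrite kY ?sqrrN// sgzM !sgzN s1// gtr0_sgz.
Qed.

Lemma lag_form_neq0 j : kap j != 0.
Proof.
rewrite -sgz_eq0 sgz_lag_form; case: j => [] [|[|[|[|i]]]] //.
Qed.

Lemma phi3_torus t : phi3 p t = V *m dmx (fun j => cis (om j * t)) *m invmx V.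
Proof.
have -> : phi3 p t = map_mx (@toC R) (expmx (t *: lag_mx A B)).
  rewrite /phi3; congr (map_mx _ (expmx (_ *: _))).
  by rewrite /Lambda3 /lag_mx /A /B /s; case: p.
rewrite (map_expmx (V := V) (om := om))//; last exact: (basis_unit lag_form_neq0 lag_basis_krein).
exact: lag_basis_eigen.
Qed.

End LagrangeTorus.

(** * The index of the iterates *)

Section IterateIndex.
Variables (R : realType).
Implicit Types (p : R * R) (x : R) (k : nat).

Lemma iteration_torus (n : nat) (V : 'M[Cplx R]_(n + n)) (w : 'I_(n + n) -> R) (T : R)
    (g : R -> 'M[Cplx R]_(n + n)) : T != 0 -> V \in unitmx ->
  (forall t, g t = V *m dmx (fun i => cis (w i * t)) *m invmx V) ->
  forall t, iteration T g t = V *m dmx (fun i => cis (w i * t)) *m invmx V.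
Proof.
move=> T0 uV gE t; rewrite /iteration; move: (Num.truncn _) => j.
have D (z u : 'I_(n + n) -> Cplx R) :
    V *m dmx z *m invmx V *m (V *m dmx u *m invmx V) = V *m dmx (fun i => z i * u i) *m invmx V.
  have -> : dmx (fun i => z i * u i) = dmx z *m dmx u.
    by apply/matrixP => i k; rewrite mul_dmxl !dmxE mulrnAr.
  by rewrite !mulmxA (mulmxKV uV).
have E (a b : R) : (fun i => cis (w i * a) * cis (w i * b)) = (fun i => cis (w i * (a + b))).
  by apply/funext => i; rewrite -cisD mulrDr.
have -> : g T ^+ j = V *m dmx (fun i => cis (w i * (j%:R * T))) *m invmx V.
  elim: j => [|j ih].
    have -> : dmx (fun i => cis (w i * (0%:R * T))) = 1%:M :> 'M[Cplx R]_(n + n).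
      by apply/matrixP => i k; rewrite dmxE mul0r mulr0 cis0 mxE.
    by rewrite mulmx1 mulmxV// expr0.
  by rewrite exprSr ih gE -mulmxE D E -natr1 mulrDl mul1r.
by rewrite gE D E subrK.
Qed.

(** The joint contribution of the two opposite frequencies of a pair; it equals 2 floor x + 1 when x
    is not an integer. *)
Definition odd_floor x : int := Num.floor x - Num.floor (- x).

Definition nonresonant k p := forall m : int,
  k%:R * Num.sqrt (freq_hi p) != m%:~R /\ k%:R * Num.sqrt (freq_lo p) != m%:~R.

Lemma index_iterateE k p : (0 < k)%N -> LS R p -> nonresonant k p ->
  index_iterate R k p = ((odd_floor (k%:R * Num.sqrt (freq_hi p))
     - odd_floor (k%:R * Num.sqrt (freq_lo p)))%:~R)%:E.
Proof.
move=> k0 lsp nr; have pi0 : (pi : R) != 0 by rewrite lt0r_neq0 ?pi_gt0.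
have T0 : 0 < k%:R * (2 * pi) :> R by rewrite !mulr_gt0 ?ltr0n ?pi_gt0.
have uV := basis_unit (lag_form_neq0 lsp) (lag_basis_krein lsp).
have wT j : lag_freq p j * (k%:R * (2 * pi)) / (2 * pi) = k%:R * lag_freq p j.
  by generalize (pi : R) pi0 => q q0; field.
rewrite /index_iterate (i1_torus (lag_form_neq0 lsp) (lag_basis_krein lsp) T0 (w := lag_freq p)).
- congr (_%:~R%:E).
  rewrite (eq_bigr _ (fun j _ => congr2 *%R (sgz_lag_form lsp j) (congr1 Num.floor (wT j)))).
  rewrite !big_ord_recl big_ord0 /lag_freq /= !mulrN /odd_floor; ring.
- move=> t _; apply: iteration_torus uV _ t.
    by rewrite mulf_neq0.
  by move=> t; exact: phi3_torus.
- move=> j m; rewrite wT /lag_freq.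
  have hN (y : R) : (forall m : int, y != m%:~R) -> forall m : int, - y != m%:~R.
    by move=> h i; rewrite -[m in - y != m]opprK -mulrNz eqr_opp.
  case: j => [] [|[|[|[|i]]]] //= _; rewrite ?mulrN; try by case: (nr m).
    by apply: hN => i; case: (nr i).
  by apply: hN => i; case: (nr i).
Qed.

End IterateIndex.

(** * Jumps of the index *)

Section Jumps.
Variables (R : realType).
Implicit Types (p q : R * R) (x y h a b : R) (k l : nat) (e : int).

Lemma floor_between x e : e%:~R < x < (e + 1)%:~R ->
  [/\ Num.floor x = e, odd_floor x = 2 * e + 1 & forall m : int, x != m%:~R].
Proof.
move=> /andP[ex xe]; have f1 : Num.floor x = e by apply: floor_def; rewrite ltW.
have f2 : Num.floor (- x) = - (e + 1).
  apply: floor_def; have -> : - (e + 1) + 1 = - e by lia.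
  by rewrite !mulrNz lerN2 ltrN2 (ltW xe) ex.
split=> // [|m]; first by rewrite /odd_floor f1 f2; lia.
by apply/eqP => xm; move: ex xe; rewrite xm !ltr_int; lia.
Qed.

(** The equation of [f_kl] says that l^2 / k^2 is a root of the quadratic satisfied by the squared
    frequencies. *)
Lemma f_kl_freqP k l p : (0 < k)%N -> LS R p -> f_kl R k l p <->
  l%:R = k%:R * Num.sqrt (freq_hi p) \/ l%:R = k%:R * Num.sqrt (freq_lo p).
Proof.
move=> k0 lsp; have [y0 yx _ hs hm] := LSP lsp; have [[_ ra] _] := lsp.
have x0 := lt_trans y0 yx; have k1 : 0 < k%:R :> R by rewrite ltr0n.
have a2 : p.2 + 2 != 0.
  by move: ra; rewrite /alpha_range /= in_itv/= => /andP[? _]; apply: lt0r_neq0; lra.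
pose t : R := l%:R ^+ 2 / k%:R ^+ 2.
have root (z : R) : 0 < z -> l%:R = k%:R * Num.sqrt z <-> t = z.
  move=> z0; split=> [e|e].
    by rewrite /t e exprMn sqr_sqrtr ?ltW// mulrC mulKf// expf_neq0// gt_eqF.
  by rewrite -e /t -expr_div_n sqrtr_sqr ger0_norm ?divr_ge0// mulrC divfK// gt_eqF.
have -> : f_kl R k l p <-> (t - freq_hi p) * (t - freq_lo p) = 0.
  have -> : (t - freq_hi p) * (t - freq_lo p) = t * (t + p.2 - 2) + (p.2 + 2) ^+ 2 * p.1 / 36.
    by rewrite -hm; have -> : p.2 = 2 - freq_hi p - freq_lo p by [lra]; ring.
  rewrite /f_kl /graph /= -/t; split=> [[_ ->]|h]; first by field.
  split=> //; rewrite -mulrA; apply: (@mulfI _ ((p.2 + 2) ^+ 2 / 36)).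
    by rewrite mulf_neq0// expf_neq0.
  have {}h : t * (t + p.2 - 2) = - ((p.2 + 2) ^+ 2 * p.1 / 36) by apply/eqP; rewrite -addr_eq0 h.
  by rewrite h; field.
rewrite !root//; split=> [/eqP|[->|->]]; rewrite ?subrr ?mul0r ?mulr0//.
by rewrite mulf_eq0 !subr_eq0 => /orP[/eqP|/eqP]; tauto.
Qed.

Lemma resonance_f_kl k p : (0 < k)%N -> LS R p -> ~ nonresonant k p ->
  exists l, (1 <= l <= Num.truncn (Num.sqrt 2 * k%:R : R))%N /\ f_kl R k l p.
Proof.
move=> k0 lsp; have [y0 yx x2 _ _] := LSP lsp; have x0 := lt_trans y0 yx.
have k1 : 0 < k%:R :> R by rewrite ltr0n.
have key (z : R) (m : int) : 0 < z -> z <= 2 -> k%:R * Num.sqrt z = m%:~R ->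
    exists2 l : nat, (1 <= l <= Num.truncn (Num.sqrt 2 * k%:R : R))%N & l%:R = k%:R * Num.sqrt z.
  move=> z0 z2 e; have : 0 < m%:~R :> R by rewrite -e mulr_gt0// sqrtr_gt0.
  rewrite ltr0z => m0.
  have me : (`|m|%N)%:R = k%:R * Num.sqrt z by rewrite e -[in RHS](gez0_abs (ltW m0)).
  exists `|m|%N => //; apply/andP; split; first by lia.
  rewrite truncn_ge_nat ?mulr_ge0 ?sqrtr_ge0// me mulrC ler_pM2r// ler_wsqrtr//.
move=> /existsNP[m /not_andP[|] /negP/negPn/eqP e].
  by have [l hl el] := key _ _ x0 (ltW x2) e; exists l; split=> //; apply/f_kl_freqP => //; left.
have [l hl el] := key _ _ y0 (ltW (lt_trans yx x2)) e; exists l; split=> //.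
by apply/f_kl_freqP => //; right.
Qed.

Lemma continuous_freq p :
  (fun q => Num.sqrt (freq_hi q)) @ p --> Num.sqrt (freq_hi p) /\
  (fun q => Num.sqrt (freq_lo q)) @ p --> Num.sqrt (freq_lo p).
Proof.
have c1 : (fun q : R * R => q.1) @ p --> p.1 by exact: cvg_fst.
have c2 : (fun q : R * R => q.2) @ p --> p.2 by exact: cvg_snd.
have cd : (fun q => Num.sqrt (freq_disc q)) @ p --> Num.sqrt (freq_disc p).
  apply: continuous_cvg; first exact: sqrt_continuous.
  rewrite /freq_disc; apply: cvgB.
    by rewrite expr2; apply: cvgM; apply: cvgB => //; exact: cvg_cst.
  apply: cvgM; last exact: cvg_cst.
  apply: cvgM => //; rewrite expr2; apply: cvgM; apply: cvgD => //; exact: cvg_cst.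
split; (apply: continuous_cvg; first exact: sqrt_continuous);
  apply: cvgM; try exact: cvg_cst.
  by apply: cvgD cd; apply: cvgB => //; exact: cvg_cst.
by apply: cvgB cd; apply: cvgB => //; exact: cvg_cst.
Qed.

Lemma near_floor (T : Type) (F : set_system T) (f : T -> R) a e :
  e%:~R < a < (e + 1)%:~R -> Filter F -> f @ F --> a -> \forall t \near F, e%:~R < f t < (e + 1)%:~R.
Proof.
move=> /andP[ea ae] FF fa; near=> t; apply/andP; split; near: t.
  exact: cvgr_gt fa _ ea.
exact: cvgr_lt fa _ ae.
Unshelve. all: by end_near. Qed.

Lemma nonresonant_not_jumps k p : (0 < k)%N -> LS R p -> nonresonant k p ->
  ~ jumps_at (LS R) (index_iterate R k) p.
Proof.
move=> k0 lsp nr; apply.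
have itv x : (forall m : int, x != m%:~R) -> (Num.floor x)%:~R < x < (Num.floor x + 1)%:~R.
  move=> xm; have /andP[h1 h2] := floor_itv x; rewrite h2 andbT lt_neqAle h1 andbT eq_sym.
  exact: xm.
have [ch cl] := continuous_freq p.
have ih := itv _ (fun m => (nr m).1); have il := itv _ (fun m => (nr m).2).
have nh : \forall q \near p, (Num.floor (k%:R * Num.sqrt (freq_hi p)))%:~R <
    k%:R * Num.sqrt (freq_hi q) < (Num.floor (k%:R * Num.sqrt (freq_hi p)) + 1)%:~R.
  by apply: (near_floor ih (nbhs_filter p)); apply: cvgM ch; exact: cvg_cst.
have nl : \forall q \near p, (Num.floor (k%:R * Num.sqrt (freq_lo p)))%:~R <
    k%:R * Num.sqrt (freq_lo q) < (Num.floor (k%:R * Num.sqrt (freq_lo p)) + 1)%:~R.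
  by apply: (near_floor il (nbhs_filter p)); apply: cvgM cl; exact: cvg_cst.
suff : nbhs p (fun q => LS R q -> index_iterate R k q = index_iterate R k p) by [].
apply: filterS2 nh nl => q hq lq lsq.
have [_ eh nhq] := floor_between hq; have [_ el nlq] := floor_between lq.
have [_ eh' _] := floor_between ih; have [_ el' _] := floor_between il.
have nrq : nonresonant k q by move=> m; split; [exact: nhq|exact: nlq].
by rewrite (index_iterateE k0 lsq nrq) (index_iterateE k0 lsp nr) eh el eh' el'.
Qed.

Lemma cvg_freq_point (T : Type) (F : set_system T) (FF : Filter F) (f h : T -> R) a b :
  4 - a - b != 0 -> f @ F --> a -> h @ F --> b ->
  (fun t => freq_point (f t) (h t)) @ F --> freq_point a b.
Proof.
move=> ab fa hb; rewrite /freq_point; apply: (cvg_pair_fun FF).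
  apply: cvgM; first by apply: cvgM; [exact: cvg_cst|exact: cvgM].
  apply: cvgV; first by rewrite expf_neq0.
  rewrite expr2; apply: cvgM; apply: cvgB => //; apply: cvgB => //; exact: cvg_cst.
by apply: cvgB => //; apply: cvgB => //; exact: cvg_cst.
Qed.

Lemma cvg_shift a c : (fun h => a + c * h) @ 0^'+ --> a.
Proof.
suff : (fun h => a + c * h) @ (0 : R) --> a + c * 0.
  by rewrite mulr0 addr0 => h; exact: cvg_within_filter.
by apply: cvgD; [exact: cvg_cst|apply: cvgM; [exact: cvg_cst|exact: cvg_id]].
Qed.

Lemma cvg_sqrt_shift k a c :
  (fun h => k%:R * Num.sqrt (a + c * h)) @ 0^'+ --> k%:R * Num.sqrt a.
Proof.
apply: cvgM; first exact: cvg_cst.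
apply: continuous_cvg; first exact: sqrt_continuous.
exact: cvg_shift.
Qed.

(** One-sided limits of the floor, valid also when k sqrt a is an integer: moving up the floor is
    kept, and in [near_floor_down] it becomes the ceiling minus 1. *)
Lemma near_floor_up k a c : (0 < k)%N -> 0 < a -> 0 < c ->
  let e := Num.floor (k%:R * Num.sqrt a) in
  \forall h \near 0^'+, e%:~R < k%:R * Num.sqrt (a + c * h) < (e + 1)%:~R.
Proof.
move=> k0 a0 c0 e; have k1 : 0 < k%:R :> R by rewrite ltr0n.
have /andP[f1 f2] := floor_itv (k%:R * Num.sqrt a).
have h0 : \forall h \near 0^'+, 0 < h :> R by exact: nbhs_right_gt.
have h2 : \forall h \near 0^'+, k%:R * Num.sqrt (a + c * h) < (e + 1)%:~R.
  exact: cvgr_lt (@cvg_sqrt_shift k a c) _ f2.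
apply: filterS2 h0 h2 => h h0 ->; rewrite andbT; apply: (le_lt_trans f1).
by rewrite ltr_pM2l// ltr_sqrt ?ltrDl ?mulr_gt0// addr_gt0 ?mulr_gt0.
Qed.

Lemma near_floor_down k a c : (0 < k)%N -> 0 < a -> c < 0 ->
  let e := Num.ceil (k%:R * Num.sqrt a) - 1 in
  \forall h \near 0^'+, e%:~R < k%:R * Num.sqrt (a + c * h) < (e + 1)%:~R.
Proof.
move=> k0 a0 c0 e; have k1 : 0 < k%:R :> R by rewrite ltr0n.
have /andP[f1 f2] := ceil_itv (k%:R * Num.sqrt a).
have h0 : \forall h \near 0^'+, 0 < h :> R by exact: nbhs_right_gt.
have h2 : \forall h \near 0^'+, e%:~R < k%:R * Num.sqrt (a + c * h).
  exact: cvgr_gt (@cvg_sqrt_shift k a c) _ f1.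
apply: filterS2 h0 h2 => h h0 -> /=; rewrite subrK; apply: (lt_le_trans _ f2).
by rewrite ltr_pM2l// ltr_sqrt// gtrDl nmulr_rlt0.
Qed.

(* [c + d < 0] keeps [alpha], which is 2 minus the sum of the squared frequencies,
   nonnegative along the ray. *)
Lemma near_index_shift k p (c d : R) (e e' : int) : (0 < k)%N -> LS R p -> c + d < 0 ->
  (\forall h \near 0^'+, e%:~R < k%:R * Num.sqrt (freq_hi p + c * h) < (e + 1)%:~R) ->
  (\forall h \near 0^'+, e'%:~R < k%:R * Num.sqrt (freq_lo p + d * h) < (e' + 1)%:~R) ->
  ~ jumps_at (LS R) (index_iterate R k) p ->
  index_iterate R k p = ((2 * (e - e'))%:~R)%:E.
Proof.
move=> k0 lsp cd ne ne' /contrapT lc; have [y0 yx x2 hs _] := LSP lsp.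
have [[_ ra] _] := lsp; move: ra; rewrite /alpha_range /= in_itv/= => /andP[a0 _].
pose Q h := freq_point (freq_hi p + c * h) (freq_lo p + d * h).
have cx := @cvg_shift (freq_hi p) c; have cy := @cvg_shift (freq_lo p) d.
have cQ : Q @ 0^'+ --> p.
  rewrite [X in _ --> X](freq_pointE lsp); apply: cvg_freq_point => //.
  by apply: lt0r_neq0; lra.
have nlc : \forall h \near 0^'+, LS R (Q h) -> index_iterate R k (Q h) = index_iterate R k p := cQ _ lc.
have ny0 : \forall h \near 0^'+, 0 < freq_lo p + d * h by exact: cvgr_gt cy _ y0.
have nyx : \forall h \near 0^'+, 0 < (freq_hi p + c * h) - (freq_lo p + d * h).
  have cxy : (fun h => (freq_hi p + c * h) - (freq_lo p + d * h)) @ 0^'+ --> freq_hi p - freq_lo p.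
    exact: cvgB cx cy.
  have xy : 0 < freq_hi p - freq_lo p by rewrite subr_gt0.
  exact: cvgr_gt cxy _ xy.
have nh0 : \forall h \near 0^'+, 0 < h :> R by exact: nbhs_right_gt.
have [h [[h1 h2 h3] [h4 h5 h6]]] : exists h, [/\ LS R (Q h) -> index_iterate R k (Q h) = index_iterate R k p,
   0 < freq_lo p + d * h & 0 < (freq_hi p + c * h) - (freq_lo p + d * h)] /\ [/\ 0 < h,
   e%:~R < k%:R * Num.sqrt (freq_hi p + c * h) < (e + 1)%:~R &
   e'%:~R < k%:R * Num.sqrt (freq_lo p + d * h) < (e' + 1)%:~R].
  apply: (@filter_ex _ (0^'+ : set_system R)).
  near=> h; split; split; near: h => //.
have [] := @freq_pointP _ (freq_hi p + c * h) (freq_lo p + d * h) h2 _ _; [lra| |].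
  by have : (c + d) * h < 0; [rewrite nmulr_rlt0|lra].
rewrite -/(Q h) => lsq eh el; rewrite -(h1 lsq) {h1}.
have [_ o1 n1] := floor_between h5; have [_ o2 n2] := floor_between h6.
have nr : nonresonant k (Q h) by move=> m; rewrite eh el; split; [exact: n1|exact: n2].
rewrite (index_iterateE k0 lsq nr) eh el o1 o2.
have -> : 2 * e + 1 - (2 * e' + 1) = 2 * (e - e') by ring.
exact: erefl.
Unshelve. all: by end_near. Qed.

(** Two rays leave p with the same motion of one frequency and opposite motions of the resonant one,
    whose floor is l on one ray and l - 1 on the other. Local constancy at p would equate two values
    that differ by 2. *)
Lemma jumps_f_kl k l p : (0 < k)%N -> LS R p -> f_kl R k l p ->
  jumps_at (LS R) (index_iterate R k) p.
Proof.
move=> k0 lsp /(f_kl_freqP l k0 lsp) hl; apply: contrapT => nj.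
have [y0 yx _ _ _] := LSP lsp; have x0 := lt_trans y0 yx.
have fl : Num.floor (l%:R : R) = l by rewrite (intrKfloor l).
have cl : Num.ceil (l%:R : R) = l by rewrite (intrKceil l).
have up (a c : R) := @near_floor_up k a c k0.
have dn (a c : R) := @near_floor_down k a c k0.
(* Slope -2 for the other frequency outweighs slope 1 for the resonant one, so the sum of the slopes
   is negative on both rays. *)
have c1 : 0 < 1 :> R by []; have cN1 : -1 < 0 :> R by []; have cN2 : -2 < 0 :> R by [].
case: hl => hl.
  have v1 := near_index_shift k0 lsp _ (up _ _ x0 c1) (dn _ _ y0 cN2) nj.
  have v2 := near_index_shift k0 lsp _ (dn _ _ x0 cN1) (dn _ _ y0 cN2) nj.
  have := v1 ltac:(lra); rewrite v2; last by lra.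
  by rewrite -hl fl cl => -[] /intr_inj e; clear -e; lia.
have v1 := near_index_shift k0 lsp _ (dn _ _ x0 cN2) (up _ _ y0 c1) nj.
have v2 := near_index_shift k0 lsp _ (dn _ _ x0 cN2) (dn _ _ y0 cN1) nj.
have := v1 ltac:(lra); rewrite v2; last by lra.
by rewrite -hl fl cl => -[] /intr_inj e; clear -e; lia.
Qed.

End Jumps.

Theorem mainTheorem6 (R : realType) :
  (forall k : nat, (0 < k)%N -> forall p : R * R, LS R p ->
     (jumps_at (LS R) (index_iterate R k) p <->
      exists l : nat,
        (1 <= l <= Num.truncn (Num.sqrt 2 * k%:R : R))%N /\ f_kl R k l p))
  /\
  (forall k l : nat, (0 < k)%N ->
     (1 <= l <= Num.truncn (Num.sqrt 2 * k%:R : R))%N ->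
     convex_curve (alpha_range R) (f_kl R k l) /\
     ((l <= k)%N -> forall p : R * R,
        tangent_at (alpha_range R) (f_kl R k l) (SS R) p <->
        p = (9 * l%:R ^+ 4 / (2 * k%:R ^+ 2 - l%:R ^+ 2) ^+ 2,
             2 * (1 - l%:R ^+ 2 / k%:R ^+ 2))))
  /\
  is_envelope (alpha_range R) `]0, 1]%classic (f_t R) (SS R).
Proof.
split; last split; last exact: envelope_SS.
- move=> k k0 p lsp; split=> [hj|[l [_]]]; last exact: jumps_f_kl.
  by apply: (resonance_f_kl k0 lsp) => nr; exact: (nonresonant_not_jumps k0 lsp nr hj).
- move=> k l k0 /andP[l0 lk]; split; first exact: convex_f_kl.
  by move=> lek p; apply: tangent_f_kl_SS; rewrite ?l0.
Qed.
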